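(* For every $n\in\mathbb C\setminus\mathbb Z_{\leq0}$ and $(\lambda,\mu)\in\mathbb C^2$ with $\mu\neq0$ there exists a unique (up to a constant factor) function $E(z)\not\equiv0$ holomorphic on a neighborhood of zero such that $\mathcal L E=c$, where $c$ is a constant independent of $z$. The function $E$ is entire and can be normalized so that $c=\xi_{n-1}(\lambda,\mu)$ depends holomorphically on $(n,\lambda,\mu)$ and $E$ also depends holomorphically on $(n,\lambda,\mu)$.
   Context: For $n,\lambda,\mu\in\mathbb C$, $$\mathcal L E=z^2E''+(nz+\mu(1-z^2))E'+(\lambda-\mu nz)E .$$ Here $\mathbb Z_{\le0}$ is the set of non-positive integers, and $\xi_{n-1}(\lambda,\mu)$ is simply the notation for the value of the constant $c$ in this normalization. *)

(* Defs.v *)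
From Stdlib Require Import Reals.
From Coquelicot Require Import Coquelicot.
Open Scope C_scope.

Definition nonpos_integer (n : C) : Prop := exists k : nat, n = - RtoC (INR k).

Definition whole_plane : C -> Prop := fun _ => True.

Definition connected_set (U : C -> Prop) : Prop :=
  forall A B : C -> Prop,
    @open C_UniformSpace A -> @open C_UniformSpace B ->
    (forall z, U z -> A z \/ B z) ->
    (exists z, U z /\ A z) -> (exists z, U z /\ B z) ->
    exists z, U z /\ A z /\ B z.

(* Connectedness is what makes "E is not identically zero on U" a condition
   on the germ of E at zero. *)
Definition zero_neighborhood (U : C -> Prop) : Prop :=
  @open C_UniformSpace U /\ connected_set U /\ U (RtoC 0).

Definition holomorphic_on (U : C -> Prop) (E : C -> C) : Prop :=
  forall z, U z -> @ex_derive C_AbsRing C_NormedModule E z.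

Definition C3 : NormedModule C_AbsRing :=
  prod_NormedModule C_AbsRing
    (prod_NormedModule C_AbsRing C_NormedModule C_NormedModule) C_NormedModule.

Definition C4 : NormedModule C_AbsRing :=
  prod_NormedModule C_AbsRing C3 C_NormedModule.

(* Holomorphy in several variables: C-linear Frechet differentiability at every
   point of D ([filterdiff] over [C_AbsRing] asks for a C-linear differential). *)
Definition holomorphic_on_module (V : NormedModule C_AbsRing)
    (D : V -> Prop) (f : V -> C) : Prop :=
  forall x : V, D x -> @ex_filterdiff C_AbsRing V C_NormedModule f (locally x).

(* [C_derive] is the complex derivative wherever the latter exists
   ([is_C_derive_unique]); here L is only applied to holomorphic functions. *)
Definition heun_L (n lam mu : C) (E : C -> C) (z : C) : C :=
  z ^ 2 * C_derive (C_derive E) z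
  + (n * z + mu * (1 - z ^ 2)) * C_derive E z
  + (lam - mu * n * z) * E z.

Definition heun_solution (n lam mu : C) (U : C -> Prop) (E : C -> C) (c : C) : Prop :=
  holomorphic_on U E
  /\ (exists z, U z /\ E z <> 0)
  /\ (forall z, U z -> heun_L n lam mu E z = c).

Definition param_domain (p : C * C * C) : Prop :=
  ~ nonpos_integer (fst (fst p)) /\ snd p <> RtoC 0.

(* Main.v *)
(* Writing E = sum a_k z^k and a_k = mu^k b_k / k!, the equation L E = c says that
     b_k = (1 + lam / ((k+1)(k+n))) b_(k+1) + mu^2 / ((k+1)(k+n)) b_(k+2)   (k >= 0)
   and c = mu^2 b_1 + lam b_0.  The coefficients being O(1/k^2), running the recursion backward
   from (1, 1) at infinity converges to a solution with b_k -> 1, which gives an entire E.  Any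
   other germ yields a sequence b of at most factorial growth; its Casoratian with the minimal
   solution is multiplied by about -k^2 / mu^2 at each step, so it must vanish and the two are
   proportional.  Proportionality spreads from the germ to a connected U by the identity theorem,
   for which complex differentiability is turned into power series expansions by Cauchy's formula
   on squares.  Holomorphy in the parameters holds because the finite backward recursions have
   Taylor remainders of second order with constants uniform in the number of steps. *)

Require Import Defs.
From Stdlib Require Import Reals Lra Lia Classical ClassicalEpsilon.
From Coquelicot Require Import Coquelicot.
Open Scope C_scope.

(** * Complex differentiability *)

(** The scaling by [mu ^ k / k!] turns the recurrence into a summable perturbation of b_k = b_(k+1);
    the divisors (k+1)(k+n) are where the non-positive integers must be avoided. Normalizing at
    infinity instead of by E(0) = 1 is what makes the dependence on the parameters holomorphic: b_0
    may vanish for some parameters, whereas a sequence tending to 1 is never identically zero.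
    Nonvanishing of [mu] serves to recover b from the Taylor coefficients and to run the recurrence
    forward from b_0 and b_1.

    Solutions are assumed to be merely differentiable at each point, with no continuity of the
    derivative. Taylor coefficients, and even the meaning of the second derivative in the equation,
    are therefore available only after Goursat's lemma. The winding integral over a square is never
    evaluated; it is enough that it is nonzero.

    In several variables no integral formula is used. The functions are limits of polynomial
    expressions in [lam], [mu], z and the inverses of n + k, and quantitative first-order expansions
    are carried through sums, products and limits. *)

Lemma Cmod_sym (a b : C) : Cmod (a - b) = Cmod (b - a).
Proof. rewrite <- (Cmod_opp (a - b)); f_equal; ring. Qed.

Lemma Cmod_minus_le (a b : C) : Cmod (a - b) <= Cmod a + Cmod b.
Proof. rewrite <- (Cmod_opp b); apply Cmod_triangle. Qed.

Lemma Cmod_triangle_mid (b a c : C) : Cmod (a - c) <= Cmod (a - b) + Cmod (b - c).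
Proof. replace (a - c) with ((a - b) + (b - c)) by ring; apply Cmod_triangle. Qed.

Lemma Cmod_triangle_inv (a b : C) : (Cmod a - Cmod b <= Cmod (a - b))%R.
Proof.
  generalize (Cmod_triangle (a - b) b); replace (a - b + b) with a by ring; lra.
Qed.

Lemma Cmod_le_abs (z : C) : (Cmod z <= Rabs (Re z) + Rabs (Im z))%R.
Proof.
  destruct z as [x y]; simpl.
  replace (x, y) with (RtoC x + Ci * RtoC y)
    by (unfold Ci, Cplus, Cmult, RtoC; simpl; f_equal; ring).
  eapply Rle_trans; [apply Cmod_triangle|].
  rewrite Cmod_mult, Cmod_Ci, !Cmod_R; lra.
Qed.

Lemma im_le_Cmod (z : C) : (Rabs (Im z) <= Cmod z)%R.
Proof. eapply Rle_trans; [apply Rmax_r | apply Rmax_Cmod]. Qed.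

(** Goursat's argument ends with a bound by every positive multiple of a fixed [B]. Since [B = 0] is
    allowed, the test value of [eps] has [B + 1] in its denominator. *)
Lemma Cmod_arbitrarily_small (z : C) (B : R) :
  (0 <= B)%R -> (forall eps, 0 < eps -> Cmod z <= eps * B)%R -> z = 0.
Proof.
  intros HB H; apply Cmod_eq_0.
  destruct (Rle_lt_or_eq_dec 0 (Cmod z) (Cmod_ge_0 z)) as [Hz|Hz]; [|now rewrite <- Hz].
  assert (Hp : (0 < Cmod z / (2 * (B + 1)))%R) by (apply Rdiv_lt_0_compat; lra).
  specialize (H _ Hp).
  assert (Cmod z / (2 * (B + 1)) * B <= Cmod z / 2)%R.
  { replace (Cmod z / 2)%R with (Cmod z / (2 * (B + 1)) * (B + 1))%R by (field; lra).
    apply Rmult_le_compat_l; lra. }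
  lra.
Qed.

(** An epsilon-delta form in terms of [Cmod] only, which matches [is_derive] for both uniform
    structures on C. The weak inequality makes the case [w = z] harmless. *)
Definition has_cderiv (f : C -> C) (z d : C) : Prop :=
  forall eps : R, (0 < eps)%R -> exists delta : R, (0 < delta)%R /\
    forall w, Cmod (w - z) < delta -> Cmod (f w - f z - d * (w - z)) <= eps * Cmod (w - z).

Definition ccontinuous (f : C -> C) (z : C) : Prop :=
  forall eps : R, (0 < eps)%R -> exists delta : R, (0 < delta)%R /\
    forall w, Cmod (w - z) < delta -> Cmod (f w - f z) < eps.

Lemma open_Cmod (U : C -> Prop) :
  @open C_UniformSpace U <->
  forall z, U z -> exists delta : R, (0 < delta)%R /\ forall w, Cmod (w - z) < delta -> U w.
Proof.
  split; intros H z Hz.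
  - destruct (H z Hz) as [e He]; exists e; split; [apply cond_pos|].
    intros w Hw; apply He, C_NormedModule_mixin_compat1, Hw.
  - destruct (H z Hz) as [d [Hd Hw]].
    (* A ball of the uniform structure is a box: one of radius e is only contained in the disc of
       radius [sqrt 2] times e, so the radius is halved. *)
    assert (Hd2 : (0 < d / 2)%R) by lra.
    exists (mkposreal _ Hd2); intros w Hb; apply Hw.
    apply C_NormedModule_mixin_compat2 in Hb; simpl in Hb.
    eapply Rlt_trans; [exact Hb|].
    assert (sqrt 2 < 2)%R.
    { rewrite <- (sqrt_pow2 2) at 2 by lra; apply sqrt_lt_1; lra. }
    nra.
Qed.

Lemma is_derive_has_cderiv (f : C -> C) (z d : C) :
  @is_derive C_AbsRing C_NormedModule f z d <-> has_cderiv f z d.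
Proof.
  split.
  - intros [_ H] eps Heps.
    destruct (H z (fun P HP => HP) (mkposreal eps Heps)) as [delta Hd].
    exists delta; split; [apply cond_pos|].
    intros w Hw; specialize (Hd w Hw).
    change (Cmod (f w - f z - (w - z) * d) <= eps * Cmod (w - z))%R in Hd.
    now replace (d * (w - z)) with ((w - z) * d) by ring.
  - intros H; split.
    + apply is_linear_scal_l.
    + intros x Hx eps.
      rewrite <- (is_filter_lim_locally_unique _ _ Hx).
      destruct (H eps (cond_pos eps)) as [delta [Hd Hw]].
      exists (mkposreal _ Hd); intros w Hb.
      change (Cmod (f w - f z - (w - z) * d) <= eps * Cmod (w - z))%R.
      replace ((w - z) * d) with (d * (w - z)) by ring.
      now apply Hw.
Qed.

(* Coquelicot puts two different uniform structures on C; its product and composition rules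
   are stated for this one. *)
Lemma is_derive_absring_has_cderiv (f : C -> C) (z d : C) :
  @is_derive C_AbsRing (AbsRing_NormedModule C_AbsRing) f z d <-> has_cderiv f z d.
Proof.
  split.
  - intros [_ H] eps Heps.
    destruct (H z (fun P HP => HP) (mkposreal eps Heps)) as [delta Hd].
    exists delta; split; [apply cond_pos|].
    intros w Hw; specialize (Hd w Hw).
    change (Cmod (f w - f z - (w - z) * d) <= eps * Cmod (w - z))%R in Hd.
    now replace (d * (w - z)) with ((w - z) * d) by ring.
  - intros H; split.
    + apply is_linear_scal_l.
    + intros x Hx eps.
      rewrite <- (is_filter_lim_locally_unique _ _ Hx).
      destruct (H eps (cond_pos eps)) as [delta [Hd Hw]].
      exists (mkposreal _ Hd); intros w Hb.
      change (Cmod (f w - f z - (w - z) * d) <= eps * Cmod (w - z))%R.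
      replace ((w - z) * d) with (d * (w - z)) by ring.
      now apply Hw.
Qed.

Lemma has_cderiv_C_derive (f : C -> C) (z d : C) : has_cderiv f z d -> C_derive f z = d.
Proof. intros H; apply is_C_derive_unique, is_derive_has_cderiv, H. Qed.

Lemma has_cderiv_continuous (f : C -> C) (z d : C) : has_cderiv f z d -> ccontinuous f z.
Proof.
  intros H eps Heps.
  destruct (H 1%R Rlt_0_1) as [delta [Hd Hw]].
  assert (Hp := Cmod_ge_0 d).
  assert (He : (0 < eps / (2 + Cmod d))%R) by (apply Rdiv_lt_0_compat; lra).
  exists (Rmin delta (eps / (2 + Cmod d))); split; [now apply Rmin_pos|].
  intros w Hwz.
  assert (H1 := Rlt_le_trans _ _ _ Hwz (Rmin_l _ _)).
  assert (H2 := Rlt_le_trans _ _ _ Hwz (Rmin_r _ _)).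
  specialize (Hw w H1).
  replace (f w - f z) with ((f w - f z - d * (w - z)) + d * (w - z)) by ring.
  eapply Rle_lt_trans; [apply Cmod_triangle|]; rewrite Cmod_mult.
  assert ((2 + Cmod d) * Cmod (w - z) < eps)%R.
  { replace eps with ((2 + Cmod d) * (eps / (2 + Cmod d)))%R by (field; lra).
    apply Rmult_lt_compat_l; lra. }
  assert (H3 := Cmod_ge_0 (w - z)); lra.
Qed.

Lemma has_cderiv_ext_loc (f g : C -> C) (z d : C) (r : R) :
  (0 < r)%R -> (forall w, Cmod (w - z) < r -> f w = g w) -> has_cderiv f z d -> has_cderiv g z d.
Proof.
  intros Hr He H eps Heps.
  destruct (H eps Heps) as [delta [Hd Hw]].
  exists (Rmin delta r); split; [now apply Rmin_pos|].
  intros w Hwz.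
  assert (H1 := Rlt_le_trans _ _ _ Hwz (Rmin_l _ _)).
  assert (H2 := Rlt_le_trans _ _ _ Hwz (Rmin_r _ _)).
  rewrite <- !He; [now apply Hw| |exact H2].
  replace (z - z) with (RtoC 0) by ring; now rewrite Cmod_0.
Qed.

Lemma has_cderiv_const (c z : C) : has_cderiv (fun _ => c) z 0.
Proof. apply is_derive_has_cderiv, @is_derive_const. Qed.

Lemma has_cderiv_id (z : C) : has_cderiv (fun w => w) z 1.
Proof.
  intros eps Heps; exists 1%R; split; [lra|]; intros w _.
  replace (w - z - 1 * (w - z)) with (RtoC 0) by ring; rewrite Cmod_0.
  apply Rmult_le_pos; [lra|apply Cmod_ge_0].
Qed.

Lemma has_cderiv_plus (f g : C -> C) (z d e : C) :
  has_cderiv f z d -> has_cderiv g z e -> has_cderiv (fun w => f w + g w) z (d + e).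
Proof.
  rewrite <- !is_derive_has_cderiv; intros Hf Hg.
  now apply (@is_derive_plus C_AbsRing C_NormedModule f g z d e).
Qed.

Lemma has_cderiv_scal (f : C -> C) (c z d : C) :
  has_cderiv f z d -> has_cderiv (fun w => c * f w) z (c * d).
Proof.
  intros H eps Heps.
  assert (Hp := Cmod_ge_0 c).
  assert (He : (0 < eps / (1 + Cmod c))%R) by (apply Rdiv_lt_0_compat; lra).
  destruct (H _ He) as [delta [Hd Hw]]; exists delta; split; [exact Hd|].
  intros w Hwz; specialize (Hw w Hwz).
  replace (c * f w - c * f z - c * d * (w - z)) with (c * (f w - f z - d * (w - z))) by ring.
  rewrite Cmod_mult.
  assert (H3 := Cmod_ge_0 (w - z)).
  eapply Rle_trans; [apply Rmult_le_compat_l; [exact Hp|exact Hw]|].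
  rewrite <- Rmult_assoc; apply Rmult_le_compat_r; [exact H3|].
  replace eps with ((1 + Cmod c) * (eps / (1 + Cmod c)))%R at 2 by (field; lra).
  apply Rmult_le_compat_r; lra.
Qed.

Lemma has_cderiv_mult (f g : C -> C) (z d e : C) :
  has_cderiv f z d -> has_cderiv g z e ->
  has_cderiv (fun w => f w * g w) z (d * g z + f z * e).
Proof.
  rewrite <- !is_derive_absring_has_cderiv; intros Hf Hg.
  apply (@is_derive_mult C_AbsRing f g z d e Hf Hg Cmult_comm).
Qed.

Lemma has_cderiv_inv (z : C) : z <> 0 -> has_cderiv (fun w => / w) z (- / (z * z)).
Proof.
  intros Hz eps Heps.
  assert (Hp : (0 < Cmod z)%R) by now apply Cmod_gt_0.
  set (m := Cmod z) in *.
  (* The error is (w - z)^2 / (z^2 w). The first entry keeps |w| above m/2, the second then bounds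
     the error by [eps] times |w - z|. *)
  exists (Rmin (m / 2) (eps * (m * m * m) / 2)); split.
  { apply Rmin_pos; [lra|]. repeat apply Rmult_lt_0_compat; lra. }
  intros w Hwz.
  assert (H1 := Rlt_le_trans _ _ _ Hwz (Rmin_l _ _)).
  assert (H2 := Rlt_le_trans _ _ _ Hwz (Rmin_r _ _)).
  assert (Hm : (m / 2 < Cmod w)%R).
  { generalize (Cmod_triangle_inv z w); rewrite Cmod_sym; fold m; lra. }
  assert (Hw : w <> 0) by (apply Cmod_gt_0; lra).
  replace (/ w - / z - - / (z * z) * (w - z)) with ((w - z) * (w - z) / (z * z * w))
    by (field; auto).
  assert (Hn : z * z * w <> 0) by (repeat apply Cmult_neq_0; auto).
  rewrite Cmod_div, !Cmod_mult by exact Hn; fold m.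
  assert (H3 := Cmod_ge_0 (w - z)).
  assert (Hpos : (0 < m * m * Cmod w)%R) by (repeat apply Rmult_lt_0_compat; lra).
  apply (Rmult_le_reg_r (m * m * Cmod w)%R); [exact Hpos|].
  unfold Rdiv; rewrite (Rmult_assoc _ (/ _)), Rinv_l, Rmult_1_r by lra.
  rewrite (Rmult_comm eps), Rmult_assoc; apply Rmult_le_compat_l; [exact H3|].
  eapply Rle_trans; [apply Rlt_le, H2|].
  replace (eps * (m * m * m) / 2)%R with (eps * (m * m * (m / 2)))%R by field.
  apply Rmult_le_compat_l; [lra|]; apply Rmult_le_compat_l; nra.
Qed.

Lemma has_cderiv_inv_comp (f : C -> C) (z d : C) :
  f z <> 0 -> has_cderiv f z d -> has_cderiv (fun w => / f w) z (- d / (f z * f z)).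
Proof.
  intros Hz Hf.
  assert (Hi := has_cderiv_inv _ Hz).
  rewrite <- is_derive_absring_has_cderiv in Hf; rewrite <- is_derive_has_cderiv in Hi |- *.
  replace (- d / (f z * f z)) with (d * (- / (f z * f z))) by (field; auto).
  apply (@is_derive_comp C_AbsRing C_NormedModule (fun w => / w) f z); assumption.
Qed.

Lemma has_cderiv_shift_inv (a z : C) : z <> a -> has_cderiv (fun w => / (w - a)) z (- / ((z - a) * (z - a))).
Proof.
  intros Hz.
  assert (Hn : z - a <> 0) by now apply Cminus_eq_contra.
  replace (- / ((z - a) * (z - a))) with (- (1 + 0) / ((z - a) * (z - a))) by (field; auto).
  apply (has_cderiv_inv_comp (fun w => w - a)); [exact Hn|].
  apply has_cderiv_plus; [apply has_cderiv_id|apply has_cderiv_const].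
Qed.

Lemma has_cderiv_pow (f : C -> C) (z d : C) (n : nat) :
  has_cderiv f z d ->
  has_cderiv (fun w => f w ^ S n) z (RtoC (INR (S n)) * f z ^ n * d).
Proof.
  intros Hf; induction n as [|n IH].
  - apply (has_cderiv_ext_loc f _ z _ 1 Rlt_0_1); [intros; simpl; ring|].
    now replace (RtoC (INR 1) * f z ^ 0 * d) with d by (simpl; ring).
  - replace (RtoC (INR (S (S n))) * f z ^ S n * d)
      with (d * f z ^ S n + f z * (RtoC (INR (S n)) * f z ^ n * d)).
    + exact (has_cderiv_mult _ _ _ _ _ Hf IH).
    + rewrite (S_INR (S n)), RtoC_plus; simpl; ring.
Qed.

(** * Squares and path integrals *)

(** The supremum of the left endpoints works: every left endpoint lies below every right
    endpoint. *)
Lemma nested_intervals (a : nat -> R) (s : R) :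
  (forall n, a n <= a (S n) /\ a (S n) + s / 2 ^ S n <= a n + s / 2 ^ n)%R ->
  (0 < s)%R ->
  exists u, forall n, (a n <= u <= a n + s / 2 ^ n)%R.
Proof.
  intros H Hs.
  assert (Hp : forall n, (0 < s / 2 ^ n)%R).
  { intros n; apply Rdiv_lt_0_compat; [exact Hs|apply pow_lt; lra]. }
  assert (Hup : forall n m, (a n <= a (n + m)%nat)%R).
  { intros n m; induction m as [|m IH]; [rewrite Nat.add_0_r; lra|].
    rewrite Nat.add_succ_r; destruct (H (n + m)%nat); lra. }
  assert (Hdown : forall n m, (a (n + m)%nat + s / 2 ^ (n + m) <= a n + s / 2 ^ n)%R).
  { intros n m; induction m as [|m IH]; [rewrite Nat.add_0_r; lra|].
    rewrite Nat.add_succ_r; destruct (H (n + m)%nat); lra. }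
  assert (Hb : forall n m, (a m <= a n + s / 2 ^ n)%R).
  { intros n m; destruct (Nat.le_ge_cases n m) as [Hnm|Hnm].
    - replace m with (n + (m - n))%nat by lia.
      generalize (Hdown n (m - n)%nat) (Hp (n + (m - n))%nat); lra.
    - generalize (Hup m (n - m)%nat) (Hp n); replace (m + (n - m))%nat with n by lia; lra. }
  destruct (completeness (fun x => exists n, x = a n)) as [u [Hu1 Hu2]].
  - exists (a O + s / 2 ^ 0)%R; intros x [n ->]; apply Hb.
  - exists (a O); now exists O.
  - exists u; intros n; split; [apply Hu1; now exists n|].
    apply Hu2; intros x [m ->]; apply Hb.
Qed.

Lemma div_pow2_small (s d : R) : (0 < d)%R -> exists n, (s / 2 ^ n < d)%R.
Proof.
  intros Hd.
  destruct (INR_unbounded (s / d)) as [n Hn]; exists n.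
  assert (H2 : (INR n < 2 ^ n)%R).
  { clear; induction n as [|n IH]; [simpl; lra|].
    rewrite S_INR; simpl. assert (1 <= 2 ^ n)%R by (apply pow_R1_Rle; lra). lra. }
  apply (Rmult_lt_reg_r (2 ^ n)); [apply pow_lt; lra|].
  unfold Rdiv; rewrite Rmult_assoc, Rinv_l, Rmult_1_r by (apply pow_nonzero; lra).
  replace s with (s / d * d)%R by (field; lra).
  rewrite (Rmult_comm d); apply Rmult_lt_compat_r; lra.
Qed.

(* Cousin's lemma in dimension two. *)
Lemma square_induction (P : R -> R -> R -> Prop) (x0 y0 s0 : R) :
  (0 < s0)%R ->
  (forall x y s, 0 < s -> P x y (s / 2) -> P (x + s / 2) y (s / 2) ->
     P x (y + s / 2) (s / 2) -> P (x + s / 2) (y + s / 2) (s / 2) -> P x y s)%R ->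
  (forall u v, x0 <= u <= x0 + s0 -> y0 <= v <= y0 + s0 ->
     exists delta, 0 < delta /\ forall x y s, 0 < s < delta ->
       x <= u <= x + s -> y <= v <= y + s -> P x y s)%R ->
  P x0 y0 s0.
Proof.
  intros Hs0 Hquad Hloc; apply NNPP; intros Hnot.
  set (w := fun n => (s0 / 2 ^ n)%R).
  assert (Hw : forall n, (0 < w n)%R).
  { intros n; apply Rdiv_lt_0_compat; [exact Hs0|apply pow_lt; lra]. }
  assert (HwS : forall n, (w (S n) = w n / 2)%R).
  { intros n; unfold w; simpl; field; apply pow_nonzero; lra. }
  (* Badness of the square is placed under the existential, so that the chosen successor is a total
     function of the corner and the sequence can be defined before badness is proved. If three
     quarters are good, the fourth must be bad. *)
  assert (Hstep : forall (p : R * R) n, exists q : R * R, ~ P (fst p) (snd p) (w n) ->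
     (~ P (fst q) (snd q) (w (S n)) /\ fst p <= fst q <= fst p + w (S n)
      /\ snd p <= snd q <= snd p + w (S n))%R).
  { intros [x y] n; simpl; generalize (Hw n) (HwS n); intros H1 H2.
    destruct (classic (P x y (w (S n)))) as [Q1|Q1].
    2: exists (x, y); simpl; intros _; repeat split; try lra; exact Q1.
    destruct (classic (P (x + w (S n)) y (w (S n)))%R) as [Q2|Q2].
    2: exists (x + w (S n), y)%R; simpl; intros _; repeat split; try lra; exact Q2.
    destruct (classic (P x (y + w (S n)) (w (S n)))%R) as [Q3|Q3].
    2: exists (x, y + w (S n))%R; simpl; intros _; repeat split; try lra; exact Q3.
    exists (x + w (S n), y + w (S n))%R; simpl; intros Hn.
    repeat split; try lra; intros Q4; apply Hn; rewrite H2 in Q1, Q2, Q3, Q4.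
    now apply Hquad. }
  set (next := fun p n => proj1_sig (constructive_indefinite_description _ (Hstep p n))).
  assert (Hnext : forall p n, _) by
    exact (fun p n => proj2_sig (constructive_indefinite_description _ (Hstep p n))).
  fold (next) in Hnext; simpl in Hnext.
  set (p := fix p n := match n with O => (x0, y0) | S m => next (p m) m end).
  assert (Hbad : forall n, ~ P (fst (p n)) (snd (p n)) (w n)).
  { induction n as [|n IH].
    - unfold w; simpl; rewrite Rdiv_1_r; exact Hnot.
    - simpl; apply (Hnext (p n) n IH). }
  assert (Hmv : forall n, (fst (p n) <= fst (p (S n)) <= fst (p n) + w (S n))%R /\
     (snd (p n) <= snd (p (S n)) <= snd (p n) + w (S n))%R).
  { intros n; apply (Hnext (p n) n (Hbad n)). }
  destruct (nested_intervals (fun n => fst (p n)) s0) as [u Hu]; [|exact Hs0|].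
  { intros n; fold (w n) (w (S n)); generalize (Hmv n) (HwS n); lra. }
  destruct (nested_intervals (fun n => snd (p n)) s0) as [v Hv]; [|exact Hs0|].
  { intros n; fold (w n) (w (S n)); generalize (Hmv n) (HwS n); lra. }
  destruct (Hloc u v) as [delta [Hd HP]].
  { generalize (Hu O); simpl; rewrite Rdiv_1_r; auto. }
  { generalize (Hv O); simpl; rewrite Rdiv_1_r; auto. }
  destruct (div_pow2_small s0 delta Hd) as [n Hn].
  apply (Hbad n), HP; [split; [apply Hw|exact Hn]|apply Hu|apply Hv].
Qed.

(** * Integrals of continuous complex functions of a real variable *)

Definition path_continuous (h : R -> C) (t : R) : Prop :=
  forall eps : R, (0 < eps)%R -> exists delta : R, (0 < delta)%R /\
    forall t', Rabs (t' - t) < delta -> Cmod (h t' - h t) < eps.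

Definition CInt (h : R -> C) (a b : R) : C := RInt (V := C_R_CompleteNormedModule) h a b.

Lemma C_R_norm (z : C) : @norm R_AbsRing C_R_NormedModule z = Cmod z.
Proof.
  change (sqrt (Rabs (fst z) ^ 2 + Rabs (snd z) ^ 2) = sqrt (fst z ^ 2 + snd z ^ 2)).
  now rewrite !pow2_abs.
Qed.

Lemma path_continuous_continuous (h : R -> C) (t : R) :
  path_continuous h t -> @continuous R_UniformSpace C_UniformSpace h t.
Proof.
  intros H P [e He].
  destruct (H e (cond_pos e)) as [d [Hd Hw]].
  exists (mkposreal _ Hd); intros t' Ht; apply He, C_NormedModule_mixin_compat1, Hw, Ht.
Qed.

Lemma ex_CInt (h : R -> C) (a b : R) :
  (a <= b)%R -> (forall t, (a <= t <= b)%R -> path_continuous h t) ->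
  ex_RInt (V := C_R_CompleteNormedModule) h a b.
Proof.
  intros Hab H; apply (ex_RInt_continuous (V := C_R_CompleteNormedModule)).
  rewrite Rmin_left, Rmax_right by exact Hab.
  intros t Ht; apply path_continuous_continuous, H, Ht.
Qed.

Lemma CInt_ext (h k : R -> C) (a b : R) :
  (a <= b)%R -> (forall t, (a <= t <= b)%R -> h t = k t) -> CInt h a b = CInt k a b.
Proof.
  intros Hab H; apply (RInt_ext (V := C_R_CompleteNormedModule)).
  rewrite Rmin_left, Rmax_right by exact Hab; intros t Ht; apply H; lra.
Qed.

Lemma CInt_plus (h k : R -> C) (a b : R) :
  (a <= b)%R -> (forall t, (a <= t <= b)%R -> path_continuous h t) ->
  (forall t, (a <= t <= b)%R -> path_continuous k t) ->
  CInt (fun t => h t + k t) a b = CInt h a b + CInt k a b.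
Proof.
  intros Hab H1 H2; apply (RInt_plus (V := C_R_CompleteNormedModule)); now apply ex_CInt.
Qed.

(** [RInt] sees C as a real normed module, so only real scalars come out for free; a complex factor
    is treated through real and imaginary parts. *)
Lemma CInt_scal (h : R -> C) (c : C) (a b : R) :
  (a <= b)%R -> (forall t, (a <= t <= b)%R -> path_continuous h t) ->
  CInt (fun t => c * h t) a b = c * CInt h a b.
Proof.
  intros Hab H.
  assert (Hh := RInt_correct (V := C_R_CompleteNormedModule) h a b (ex_CInt h a b Hab H)).
  fold (CInt h a b) in Hh; set (l := CInt h a b) in *.
  apply (is_RInt_unique (V := C_R_CompleteNormedModule)).
  assert (H1 := is_RInt_fct_extend_fst (U := R_NormedModule) (V := R_NormedModule) h a b l Hh).
  assert (H2 := is_RInt_fct_extend_snd (U := R_NormedModule) (V := R_NormedModule) h a b l Hh).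
  apply (is_RInt_fct_extend_pair (U := R_NormedModule) (V := R_NormedModule)).
  - exact (is_RInt_minus _ _ _ _ _ _ (is_RInt_scal _ _ _ (fst c) _ H1) (is_RInt_scal _ _ _ (snd c) _ H2)).
  - exact (is_RInt_plus _ _ _ _ _ _ (is_RInt_scal _ _ _ (fst c) _ H2) (is_RInt_scal _ _ _ (snd c) _ H1)).
Qed.

Lemma CInt_bound (h : R -> C) (a b M : R) :
  (a <= b)%R -> (forall t, (a <= t <= b)%R -> path_continuous h t) ->
  (forall t, (a <= t <= b)%R -> Cmod (h t) <= M) -> Cmod (CInt h a b) <= (b - a) * M.
Proof.
  intros Hab H HM.
  rewrite <- C_R_norm.
  apply (norm_RInt_le_const (V := C_R_NormedModule) h a b); [exact Hab| |].
  - intros t Ht; rewrite C_R_norm; now apply HM.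
  - apply (RInt_correct (V := C_R_CompleteNormedModule)), ex_CInt; assumption.
Qed.

Lemma CInt_Chasles (h : R -> C) (a b c : R) :
  (a <= b <= c)%R -> (forall t, (a <= t <= c)%R -> path_continuous h t) ->
  CInt h a c = CInt h a b + CInt h b c.
Proof.
  intros Hab H; symmetry; apply (RInt_Chasles (V := C_R_CompleteNormedModule));
    apply ex_CInt; try lra; intros t Ht; apply H; lra.
Qed.

Lemma CInt_shift (h : R -> C) (a b v : R) :
  (a <= b)%R -> (forall t, (a + v <= t <= b + v)%R -> path_continuous h t) ->
  CInt (fun t => h (t + v)%R) a b = CInt h (a + v) (b + v).
Proof.
  intros Hab H.
  assert (E := RInt_comp_lin (V := C_R_CompleteNormedModule) h 1 v a b).
  rewrite !Rmult_1_l in E; unfold CInt; rewrite <- E.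
  - apply (RInt_ext (V := C_R_CompleteNormedModule)); intros t _.
    rewrite Rmult_1_l; symmetry; apply (scal_one (h (t + v)%R : C_R_CompleteNormedModule)).
  - apply ex_CInt; [lra|exact H].
Qed.

(** * Goursat's lemma *)

Lemma path_continuous_plus (h k : R -> C) (t : R) :
  path_continuous h t -> path_continuous k t -> path_continuous (fun t => h t + k t) t.
Proof.
  intros H1 H2 eps Heps.
  destruct (H1 (eps / 2)%R) as [d1 [Hd1 W1]]; [lra|].
  destruct (H2 (eps / 2)%R) as [d2 [Hd2 W2]]; [lra|].
  exists (Rmin d1 d2); split; [now apply Rmin_pos|]; intros t' Ht.
  specialize (W1 t' (Rlt_le_trans _ _ _ Ht (Rmin_l _ _))).
  specialize (W2 t' (Rlt_le_trans _ _ _ Ht (Rmin_r _ _))).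
  replace (h t' + k t' - (h t + k t)) with ((h t' - h t) + (k t' - k t)) by ring.
  eapply Rle_lt_trans; [apply Cmod_triangle|lra].
Qed.

Lemma path_continuous_scal (h : R -> C) (c : C) (t : R) :
  path_continuous h t -> path_continuous (fun t => c * h t) t.
Proof.
  intros H eps Heps.
  assert (Hc := Cmod_ge_0 c).
  destruct (H (eps / (1 + Cmod c))%R) as [d [Hd W]]; [apply Rdiv_lt_0_compat; lra|].
  exists d; split; [exact Hd|]; intros t' Ht; specialize (W t' Ht).
  replace (c * h t' - c * h t) with (c * (h t' - h t)) by ring; rewrite Cmod_mult.
  assert (H0 := Cmod_ge_0 (h t' - h t)).
  assert ((1 + Cmod c) * Cmod (h t' - h t) < eps)%R; [|nra].
  replace eps with ((1 + Cmod c) * (eps / (1 + Cmod c)))%R by (field; lra).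
  apply Rmult_lt_compat_l; lra.
Qed.

Lemma path_continuous_comp (g : C -> C) (e : R -> C) (t : R) :
  (forall t', Cmod (e t' - e t) <= Rabs (t' - t)) ->
  ccontinuous g (e t) -> path_continuous (fun t => g (e t)) t.
Proof.
  intros He Hg eps Heps; destruct (Hg eps Heps) as [d [Hd W]].
  exists d; split; [exact Hd|]; intros t' Ht; apply W.
  eapply Rle_lt_trans; [apply He|exact Ht].
Qed.

(** * Contour integrals over squares *)

Definition bottom_edge (x y s t : R) : C := ((x + t)%R, y).
Definition right_edge (x y s t : R) : C := ((x + s)%R, (y + t)%R).
Definition top_edge (x y s t : R) : C := ((x + t)%R, (y + s)%R).
Definition left_edge (x y s t : R) : C := (x, (y + t)%R).

(* The four sides of a square contour are traversed simultaneously, so that the contour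
   integral is one integral over [0, s] and edges common to two squares cancel pointwise. *)
Definition contour (g : C -> C) (x y s t : R) : C :=
  g (bottom_edge x y s t) + Ci * g (right_edge x y s t)
  + (- (1)) * g (top_edge x y s t) + (- Ci) * g (left_edge x y s t).

Definition square_integral (g : C -> C) (x y s : R) : C := CInt (contour g x y s) 0 s.

Definition on_square (x y s : R) (w : C) : Prop :=
  exists t, (0 <= t <= s)%R /\
    (w = bottom_edge x y s t \/ w = right_edge x y s t \/
     w = top_edge x y s t \/ w = left_edge x y s t).

Definition in_square (x y s : R) (w : C) : Prop :=
  (x <= Re w <= x + s /\ y <= Im w <= y + s)%R.

Lemma on_square_in (x y s : R) (w : C) : on_square x y s w -> in_square x y s w.
Proof.
  intros [t [Ht H]]; unfold in_square, Re, Im.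
  destruct H as [->|[->|[->| ->]]]; simpl; lra.
Qed.

Lemma in_square_sub (x y s x' y' s' : R) (w : C) :
  (x <= x' /\ x' + s' <= x + s /\ y <= y' /\ y' + s' <= y + s)%R ->
  in_square x' y' s' w -> in_square x y s w.
Proof. unfold in_square; lra. Qed.

Lemma edge_isometry (x y s t t' : R) :
  (Cmod (bottom_edge x y s t' - bottom_edge x y s t) <= Rabs (t' - t) /\
   Cmod (right_edge x y s t' - right_edge x y s t) <= Rabs (t' - t) /\
   Cmod (top_edge x y s t' - top_edge x y s t) <= Rabs (t' - t) /\
   Cmod (left_edge x y s t' - left_edge x y s t) <= Rabs (t' - t))%R.
Proof.
  assert (A : forall u : C, Re u = (t' - t)%R -> Im u = 0%R -> (Cmod u <= Rabs (t' - t))%R).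
  { intros u H1 H2; eapply Rle_trans; [apply Cmod_le_abs|]; rewrite H1, H2, Rabs_R0; lra. }
  assert (B : forall u : C, Re u = 0%R -> Im u = (t' - t)%R -> (Cmod u <= Rabs (t' - t))%R).
  { intros u H1 H2; eapply Rle_trans; [apply Cmod_le_abs|]; rewrite H1, H2, Rabs_R0; lra. }
  repeat split; [apply A|apply B|apply A|apply B]; unfold Re, Im; simpl; ring.
Qed.

Lemma contour_continuous (g : C -> C) (x y s : R) :
  (forall w, on_square x y s w -> ccontinuous g w) ->
  forall t, (0 <= t <= s)%R -> path_continuous (contour g x y s) t.
Proof.
  intros H t Ht; unfold contour.
  repeat apply path_continuous_plus; try apply path_continuous_scal;
    apply path_continuous_comp; try (intros t'; apply edge_isometry);
    apply H; exists t; tauto.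
Qed.

Lemma square_integral_ext (g h : C -> C) (x y s : R) :
  (0 <= s)%R -> (forall w, on_square x y s w -> g w = h w) ->
  square_integral g x y s = square_integral h x y s.
Proof.
  intros Hs H; apply CInt_ext; [exact Hs|]; intros t Ht; unfold contour.
  rewrite !H; [reflexivity|..]; exists t; tauto.
Qed.

Lemma square_integral_plus (g h : C -> C) (x y s : R) :
  (0 <= s)%R -> (forall w, on_square x y s w -> ccontinuous g w) ->
  (forall w, on_square x y s w -> ccontinuous h w) ->
  square_integral (fun w => g w + h w) x y s = square_integral g x y s + square_integral h x y s.
Proof.
  intros Hs Hg Hh; unfold square_integral; rewrite <- CInt_plus; try apply contour_continuous; auto.
  apply CInt_ext; [exact Hs|]; intros t Ht; unfold contour; ring.
Qed.

Lemma square_integral_scal (g : C -> C) (c : C) (x y s : R) :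
  (0 <= s)%R -> (forall w, on_square x y s w -> ccontinuous g w) ->
  square_integral (fun w => c * g w) x y s = c * square_integral g x y s.
Proof.
  intros Hs Hg; unfold square_integral; rewrite <- CInt_scal; try apply contour_continuous; auto.
  apply CInt_ext; [exact Hs|]; intros t Ht; unfold contour; ring.
Qed.

Lemma square_integral_bound (g : C -> C) (x y s M : R) :
  (0 <= s)%R -> (forall w, on_square x y s w -> ccontinuous g w) ->
  (forall w, on_square x y s w -> Cmod (g w) <= M) ->
  Cmod (square_integral g x y s) <= s * (4 * M).
Proof.
  intros Hs Hg HM.
  replace (s * (4 * M))%R with ((s - 0) * (4 * M))%R by ring.
  apply CInt_bound; [exact Hs|now apply contour_continuous|].
  intros t Ht; unfold contour.
  assert (H1 : (Cmod (g (bottom_edge x y s t)) <= M)%R) by (apply HM; exists t; tauto).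
  assert (H2 : (Cmod (g (right_edge x y s t)) <= M)%R) by (apply HM; exists t; tauto).
  assert (H3 : (Cmod (g (top_edge x y s t)) <= M)%R) by (apply HM; exists t; tauto).
  assert (H4 : (Cmod (g (left_edge x y s t)) <= M)%R) by (apply HM; exists t; tauto).
  eapply Rle_trans; [apply Cmod_triangle|]; rewrite Cmod_mult, Cmod_opp, Cmod_Ci.
  eapply Rle_trans; [apply Rplus_le_compat_r, Cmod_triangle|]; rewrite Cmod_mult, Cmod_opp, Cmod_1.
  eapply Rle_trans; [apply Rplus_le_compat_r, Rplus_le_compat_r, Cmod_triangle|].
  rewrite Cmod_mult, Cmod_Ci; lra.
Qed.

(** Right and left points differ by s, top and bottom points by i s, so the two pairs of sides
    contribute i d s and - i d s: the integrand already vanishes pointwise. *)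
Lemma contour_affine (a d : C) (x y s t : R) : contour (fun w => a + d * w) x y s t = 0.
Proof.
  unfold contour, bottom_edge, right_edge, top_edge, left_edge.
  destruct a as [a1 a2], d as [d1 d2].
  unfold Ci, Cplus, Cmult, Copp, RtoC; simpl; f_equal; ring.
Qed.

Lemma square_integral_affine (a d : C) (x y s : R) :
  (0 <= s)%R -> square_integral (fun w => a + d * w) x y s = 0.
Proof.
  intros Hs; apply Cmod_arbitrarily_small with 0%R; [lra|]; intros eps Heps.
  replace (eps * 0)%R with ((s - 0) * 0)%R by ring.
  apply CInt_bound; [exact Hs| |].
  - apply contour_continuous; intros w _.
    apply has_cderiv_continuous with (0 + d * 1).
    apply has_cderiv_plus; [apply has_cderiv_const|apply has_cderiv_scal, has_cderiv_id].
  - intros t _; rewrite contour_affine, Cmod_0; lra.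
Qed.

Lemma square_integral_split (g : C -> C) (x y s : R) :
  (0 < s)%R -> (forall w, in_square x y s w -> ccontinuous g w) ->
  square_integral g x y s =
    square_integral g x y (s / 2) + square_integral g (x + s / 2) y (s / 2)
    + (square_integral g x (y + s / 2) (s / 2) + square_integral g (x + s / 2) (y + s / 2) (s / 2)).
Proof.
  intros Hs Hg.
  assert (Hsub : forall x' y', (x <= x' /\ x' + s / 2 <= x + s /\ y <= y' /\ y' + s / 2 <= y + s)%R ->
    forall t, (0 <= t <= s / 2)%R -> path_continuous (contour g x' y' (s / 2)) t).
  { intros x' y' H; apply contour_continuous; intros w Hw.
    apply Hg, in_square_sub with x' y' (s / 2)%R; [exact H|]; now apply on_square_in. }
  assert (Hall : forall t, (0 <= t <= s)%R -> path_continuous (contour g x y s) t).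
  { apply contour_continuous; intros w Hw; apply Hg; now apply on_square_in. }
  unfold square_integral.
  rewrite (CInt_Chasles (contour g x y s) 0 (s / 2) s) by (try lra; exact Hall).
  (* The second half of the parameter interval is moved back to [0, s/2]. All integrals then share
     one interval and the identity becomes pointwise. *)
  replace (CInt (contour g x y s) (s / 2) s)
    with (CInt (fun t => contour g x y s (t + s / 2)%R) 0 (s / 2)).
  2: { rewrite CInt_shift; [f_equal; lra|lra|]. intros t Ht; apply Hall; lra. }
  rewrite <- !CInt_plus; try lra; try (apply Hsub; lra).
  2: { intros t Ht; apply path_continuous_plus; apply Hsub; lra. }
  2: { intros t Ht; apply path_continuous_plus; apply Hsub; lra. }
  2: { intros t Ht; apply Hall; lra. }
  2: { intros t Ht e He; destruct (Hall (t + s / 2)%R) with (eps := e) as [d [Hd W]]; try lra.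
       exists d; split; [exact Hd|]; intros t' Ht'; apply W.
       now replace (t' + s / 2 - (t + s / 2))%R with (t' - t)%R by ring. }
  apply CInt_ext; [lra|]; intros t _.
  unfold contour, bottom_edge, right_edge, top_edge, left_edge.
  replace (x + s / 2 + s / 2)%R with (x + s)%R by field.
  replace (y + s / 2 + s / 2)%R with (y + s)%R by field.
  replace (x + s / 2 + t)%R with (x + (t + s / 2))%R by ring.
  replace (y + s / 2 + t)%R with (y + (t + s / 2))%R by ring.
  ring.
Qed.

(** The odd extension of the square root, since [sqrt] is zero on negative numbers. Its infinite
    slope at 0 makes an interval of length s around 0 weigh at least [sqrt s], so that the product
    over two coordinates weighs at least s. *)
Definition signed_sqrt (t : R) : R := (sqrt t - sqrt (- t))%R.

Lemma signed_sqrt_le (a b : R) : (a <= b)%R -> (signed_sqrt a <= signed_sqrt b)%R.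
Proof.
  intros H; unfold signed_sqrt.
  assert (sqrt a <= sqrt b)%R by now apply sqrt_le_1_alt.
  assert (sqrt (- b) <= sqrt (- a))%R by (apply sqrt_le_1_alt; lra).
  lra.
Qed.

(** The increment equals [sqrt (a + s) + sqrt (- a)], and a sum of square roots dominates the square
    root of the sum, which is s. *)
Lemma signed_sqrt_diff (a s : R) :
  (a <= 0 <= a + s)%R -> (sqrt s <= signed_sqrt (a + s) - signed_sqrt a)%R.
Proof.
  intros H; unfold signed_sqrt.
  rewrite (sqrt_neg_0 a), (sqrt_neg_0 (- (a + s))) by lra.
  assert (H1 := sqrt_pos (a + s)); assert (H2 := sqrt_pos (- a)).
  replace (sqrt (a + s) - 0 - (0 - sqrt (- a)))%R with (sqrt (a + s) + sqrt (- a))%R by ring.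
  rewrite <- (sqrt_pow2 (sqrt (a + s) + sqrt (- a))) by lra.
  apply sqrt_le_1_alt.
  assert (E1 := sqrt_sqrt (a + s)); assert (E2 := sqrt_sqrt (- a)); nra.
Qed.

(* A measure on squares that gives mass at least [s] to every square of side [s] containing [p]:
   it absorbs the contribution of the exceptional point in Goursat's lemma. *)
Definition point_mass (p : C) (x y s : R) : R :=
  ((signed_sqrt (x - Re p + s) - signed_sqrt (x - Re p))
   * (signed_sqrt (y - Im p + s) - signed_sqrt (y - Im p)))%R.

Lemma point_mass_pos (p : C) (x y s : R) : (0 <= s)%R -> (0 <= point_mass p x y s)%R.
Proof.
  intros Hs; apply Rmult_le_pos.
  - assert (signed_sqrt (x - Re p) <= signed_sqrt (x - Re p + s))%R by (apply signed_sqrt_le; lra).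
    lra.
  - assert (signed_sqrt (y - Im p) <= signed_sqrt (y - Im p + s))%R by (apply signed_sqrt_le; lra).
    lra.
Qed.

Lemma point_mass_ge (p : C) (x y s : R) :
  (0 <= s)%R -> in_square x y s p -> (s <= point_mass p x y s)%R.
Proof.
  intros Hs [H1 H2]; unfold point_mass.
  assert (A := signed_sqrt_diff (x - Re p) s ltac:(lra)).
  assert (B := signed_sqrt_diff (y - Im p) s ltac:(lra)).
  rewrite <- (sqrt_sqrt s Hs) at 1.
  apply Rmult_le_compat; try apply sqrt_pos; assumption.
Qed.

(** As a product of increments of one function per coordinate, the mass is additive under
    subdivision, like a Stieltjes product measure. *)
Lemma point_mass_split (p : C) (x y s : R) :
  (point_mass p x y s =
    point_mass p x y (s / 2) + point_mass p (x + s / 2) y (s / 2)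
    + (point_mass p x (y + s / 2) (s / 2) + point_mass p (x + s / 2) (y + s / 2) (s / 2)))%R.
Proof.
  unfold point_mass.
  replace (x + s / 2 - Re p + s / 2)%R with (x - Re p + s)%R by field.
  replace (y + s / 2 - Im p + s / 2)%R with (y - Im p + s)%R by field.
  replace (x + s / 2 - Re p)%R with (x - Re p + s / 2)%R by ring.
  replace (y + s / 2 - Im p)%R with (y - Im p + s / 2)%R by ring.
  ring.
Qed.

Lemma in_square_dist (x y s : R) (u v : C) :
  in_square x y s u -> in_square x y s v -> (Cmod (u - v) <= 2 * s)%R.
Proof.
  intros Hu Hv; eapply Rle_trans; [apply Cmod_le_abs|].
  destruct u, v; unfold in_square, Re, Im in *; simpl in *.
  apply Rle_trans with (s + s)%R; [|lra].
  apply Rplus_le_compat; apply Rabs_le; lra.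
Qed.

(** By subdivision, the integral over each subsquare is at most [eps] times area plus point mass.
    Away from [p] the tangent affine function is subtracted and the area absorbs the error; at [p]
    only continuity is at hand and the point mass takes over. The exceptional point is there for
    difference quotients. *)
Lemma goursat (g : C -> C) (p : C) (x0 y0 s0 : R) :
  (0 < s0)%R -> g p = 0 ->
  (forall w, in_square x0 y0 s0 w -> ccontinuous g w) ->
  (forall w, in_square x0 y0 s0 w -> w <> p -> exists d, has_cderiv g w d) ->
  square_integral g x0 y0 s0 = 0.
Proof.
  intros Hs0 Hp Hcont Hder.
  apply Cmod_arbitrarily_small with (s0 * s0 + point_mass p x0 y0 s0)%R.
  { assert (H := point_mass_pos p x0 y0 s0 ltac:(lra)); nra. }
  intros eps Heps.
  (* The induction visits arbitrary squares, also ones sticking out of the initial square, hence the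
     containment premises. *)
  set (P := fun x y s => (x0 <= x -> x + s <= x0 + s0 -> y0 <= y -> y + s <= y0 + s0 ->
    Cmod (square_integral g x y s) <= eps * (s * s + point_mass p x y s))%R).
  enough (H : P x0 y0 s0) by (apply H; lra).
  apply square_induction; [exact Hs0| |]; unfold P.
  - intros x y s Hs P1 P2 P3 P4 Hx1 Hx2 Hy1 Hy2.
    rewrite square_integral_split, point_mass_split; [|exact Hs|].
    2: { intros w Hw; apply Hcont, in_square_sub with x y s; [lra|exact Hw]. }
    specialize (P1 ltac:(lra) ltac:(lra) ltac:(lra) ltac:(lra)).
    specialize (P2 ltac:(lra) ltac:(lra) ltac:(lra) ltac:(lra)).
    specialize (P3 ltac:(lra) ltac:(lra) ltac:(lra) ltac:(lra)).
    specialize (P4 ltac:(lra) ltac:(lra) ltac:(lra) ltac:(lra)).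
    eapply Rle_trans; [apply Cmod_triangle|].
    eapply Rle_trans; [apply Rplus_le_compat; apply Cmod_triangle|]; lra.
  - intros u v Hu Hv.
    set (c := (u, v) : C).
    assert (Hc : in_square x0 y0 s0 c) by (split; assumption).
    destruct (Ceq_dec c p) as [Ecp|Ncp].
    (* Four sides of length s with |g| at most eps/4 give at most eps * s, which the mass of a
       square containing [p] dominates. *)
    + destruct (Hcont c Hc (eps / 4)%R) as [d [Hd W]]; [lra|].
      exists (d / 2)%R; split; [lra|]; intros x y s Hs Hxu Hyv Hx1 Hx2 Hy1 Hy2.
      assert (Hin : in_square x y s c) by (split; assumption).
      assert (Hm := point_mass_ge p x y s ltac:(lra)); rewrite <- Ecp in Hm at 1.
      specialize (Hm Hin).
      apply Rle_trans with (s * (4 * (eps / 4)))%R; [|nra].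
      apply square_integral_bound; [lra| |].
      * intros w Hw; apply Hcont, in_square_sub with x y s; [lra|]; now apply on_square_in.
      * intros w Hw; apply on_square_in in Hw.
        assert (D := in_square_dist _ _ _ _ _ Hw Hin).
        specialize (W w ltac:(lra)); rewrite Ecp, Hp in W.
        replace (g w - 0) with (g w) in W by ring; lra.
    + destruct (Hder c Hc Ncp) as [d Hd].
      (* Points of the square are within 2 s of [c], so the remainder is at most (eps/4) s on the
         contour and contributes at most eps * s^2. *)
      destruct (Hd (eps / 8)%R) as [r [Hr W]]; [lra|].
      exists (r / 2)%R; split; [lra|]; intros x y s Hs Hxu Hyv Hx1 Hx2 Hy1 Hy2.
      assert (Hin : in_square x y s c) by (split; assumption).
      assert (Hgc : forall w, on_square x y s w -> ccontinuous g w).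
      { intros w Hw; apply Hcont, in_square_sub with x y s; [lra|]; now apply on_square_in. }
      assert (Hac : forall w, ccontinuous (fun w => - (g c - d * c) + - d * w) w).
      { intros w; apply has_cderiv_continuous with (0 + - d * 1).
        apply has_cderiv_plus; [apply has_cderiv_const|apply has_cderiv_scal, has_cderiv_id]. }
      replace (square_integral g x y s) with
        (square_integral (fun w => g w + (- (g c - d * c) + - d * w)) x y s).
      2: { rewrite square_integral_plus, square_integral_affine; [ring|lra|lra|exact Hgc|].
           intros w _; apply Hac. }
      apply Rle_trans with (s * (4 * (eps / 4 * s)))%R.
      2: { assert (Hm := point_mass_pos p x y s ltac:(lra)); nra. }
      apply square_integral_bound; [lra| |].
      * intros w Hw e He.
        destruct (Hgc w Hw (e / 2)%R) as [d1 [Hd1 W1]]; [lra|].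
        destruct (Hac w (e / 2)%R) as [d2 [Hd2 W2]]; [lra|].
        exists (Rmin d1 d2); split; [now apply Rmin_pos|]; intros w' Hw'.
        specialize (W1 w' (Rlt_le_trans _ _ _ Hw' (Rmin_l _ _))).
        specialize (W2 w' (Rlt_le_trans _ _ _ Hw' (Rmin_r _ _))).
        match goal with |- Cmod ((?a + ?b) - (?a' + ?b')) < _ =>
          replace ((a + b) - (a' + b')) with ((a - a') + (b - b')) by ring end.
        eapply Rle_lt_trans; [apply Cmod_triangle|lra].
      * intros w Hw; apply on_square_in in Hw.
        assert (D := in_square_dist _ _ _ _ _ Hw Hin).
        specialize (W w ltac:(lra)).
        replace (g w + (- (g c - d * c) + - d * w)) with (g w - g c - d * (w - c)) by ring.
        eapply Rle_trans; [exact W|].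
        apply Rle_trans with (eps / 8 * (2 * s))%R; [apply Rmult_le_compat_l; lra|lra].
Qed.

(** * Complex sequences and primitives *)

(** Reducing convergence to a real limit makes the theory of real sequences applicable. *)
Definition Ccv (u : nat -> C) (l : C) : Prop := is_lim_seq (fun n => Cmod (u n - l)) 0%R.

Lemma Ccv_squeeze (u : nat -> C) (l : C) (v : nat -> R) :
  (forall n, Cmod (u n - l) <= v n)%R -> is_lim_seq v 0%R -> Ccv u l.
Proof.
  intros H Hv; apply is_lim_seq_le_le with (fun _ => 0%R) v; [|apply is_lim_seq_const|exact Hv].
  intros n; split; [apply Cmod_ge_0|apply H].
Qed.

Lemma Ccv_ext (u v : nat -> C) (l : C) : (forall n, u n = v n) -> Ccv u l -> Ccv v l.
Proof. intros H; apply is_lim_seq_ext; intros n; now rewrite H. Qed.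

Lemma Ccv_const (c : C) : Ccv (fun _ => c) c.
Proof.
  apply Ccv_squeeze with (fun _ => 0%R); [|apply is_lim_seq_const].
  intros n; replace (c - c) with (RtoC 0) by ring; rewrite Cmod_0; lra.
Qed.

Lemma Ccv_plus (u v : nat -> C) (l m : C) :
  Ccv u l -> Ccv v m -> Ccv (fun n => u n + v n) (l + m).
Proof.
  intros Hu Hv; apply Ccv_squeeze with (fun n => Cmod (u n - l) + Cmod (v n - m))%R.
  - intros n; replace (u n + v n - (l + m)) with ((u n - l) + (v n - m)) by ring.
    apply Cmod_triangle.
  - replace 0%R with (0 + 0)%R by ring; now apply is_lim_seq_plus'.
Qed.

Lemma Ccv_scal (u : nat -> C) (c l : C) : Ccv u l -> Ccv (fun n => c * u n) (c * l).
Proof.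
  intros Hu; apply Ccv_squeeze with (fun n => Cmod c * Cmod (u n - l))%R.
  - intros n; replace (c * u n - c * l) with (c * (u n - l)) by ring; rewrite Cmod_mult; lra.
  - replace 0%R with (Cmod c * 0)%R by ring; apply (is_lim_seq_scal_l _ (Cmod c) 0%R Hu).
Qed.

Lemma Ccv_minus (u v : nat -> C) (l m : C) :
  Ccv u l -> Ccv v m -> Ccv (fun n => u n - v n) (l - m).
Proof.
  intros Hu Hv; apply Ccv_ext with (fun n => u n + (- (1)) * v n); [intros n; ring|].
  replace (l - m) with (l + (- (1)) * m) by ring; now apply Ccv_plus, Ccv_scal.
Qed.

Lemma Ccv_incr (u : nat -> C) (l : C) : Ccv u l <-> Ccv (fun n => u (S n)) l.
Proof. split; apply (is_lim_seq_incr_1 (fun n => Cmod (u n - l))). Qed.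

Lemma Ccv_bound (u : nat -> C) (l c : C) (M : R) :
  Ccv u l -> (forall n, Cmod (u n - c) <= M)%R -> (Cmod (l - c) <= M)%R.
Proof.
  intros Hu HM.
  apply (is_lim_seq_le (fun _ => Cmod (l - c)) (fun n => Cmod (u n - l) + M)%R (Cmod (l - c)) M).
  - intros n; specialize (HM n).
    generalize (Cmod_triangle_mid (u n) l c) (Cmod_sym (u n) l); lra.
  - apply is_lim_seq_const.
  - replace (Finite M) with (Finite (0 + M)%R) by (f_equal; ring).
    apply is_lim_seq_plus'; [exact Hu|apply is_lim_seq_const].
Qed.

Lemma Ccv_norm_le (u : nat -> C) (l : C) (M : R) :
  Ccv u l -> (forall n, Cmod (u n) <= M)%R -> (Cmod l <= M)%R.
Proof.
  intros Hu HM; replace l with (l - 0) by ring; apply Ccv_bound with u; [exact Hu|].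
  intros n; replace (u n - 0) with (u n) by ring; apply HM.
Qed.

Lemma Ccv_unique (u : nat -> C) (l m : C) : Ccv u l -> Ccv u m -> l = m.
Proof.
  intros Hl Hm; apply Ceq_minus, Cmod_eq_0, Rle_antisym; [|apply Cmod_ge_0].
  apply (Ccv_norm_le (fun n => u n - u n)).
  - now apply Ccv_minus.
  - intros n; replace (u n - u n) with (RtoC 0) by ring; rewrite Cmod_0; lra.
Qed.

(** Only indices below [n] are summed, unlike in [sum_n], which includes [n]; this accounts for the
    shifts by one further on. *)
Fixpoint csum (f : nat -> C) (n : nat) : C :=
  match n with O => RtoC 0 | S m => csum f m + f m end.

Lemma csum_ext (f g : nat -> C) (n : nat) : (forall k, f k = g k) -> csum f n = csum g n.
Proof. intros H; induction n as [|n IH]; simpl; [reflexivity|now rewrite IH, H]. Qed.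

Lemma csum_zero (f : nat -> C) (n : nat) : (forall k, f k = 0) -> csum f n = 0.
Proof. intros H; induction n as [|n IH]; simpl; [reflexivity|rewrite IH, H; ring]. Qed.

Lemma csum_plus (f g : nat -> C) (n : nat) : csum (fun k => f k + g k) n = csum f n + csum g n.
Proof. induction n as [|n IH]; simpl; [ring|rewrite IH; ring]. Qed.

Lemma csum_scal (f : nat -> C) (c : C) (n : nat) : csum (fun k => c * f k) n = c * csum f n.
Proof. induction n as [|n IH]; simpl; [ring|rewrite IH; ring]. Qed.

Lemma csum_first (f : nat -> C) (n : nat) : csum f (S n) = f O + csum (fun k => f (S k)) n.
Proof.
  induction n as [|n IH]; [simpl; ring|].
  change (csum f (S (S n))) with (csum f (S n) + f (S n)); rewrite IH; simpl; ring.
Qed.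

Definition is_pser (a : nat -> C) (z l : C) : Prop := Ccv (csum (fun k => a k * z ^ k)) l.

Definition path_deriv (h : R -> C) (t : R) (d : C) : Prop :=
  forall eps : R, (0 < eps)%R -> exists delta : R, (0 < delta)%R /\
    forall t', Rabs (t' - t) < delta ->
      Cmod (h t' - h t - RtoC (t' - t) * d) <= eps * Rabs (t' - t).

Lemma path_deriv_is_derive (h : R -> C) (t : R) (d : C) :
  path_deriv h t d -> @is_derive R_AbsRing C_R_NormedModule h t d.
Proof.
  intros H; split; [apply (is_linear_scal_l (V := C_R_NormedModule))|].
  intros x Hx eps; rewrite <- (is_filter_lim_locally_unique _ _ Hx).
  destruct (H eps (cond_pos eps)) as [delta [Hd W]].
  exists (mkposreal _ Hd); intros t' Ht'; specialize (W t' Ht').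
  rewrite C_R_norm.
  assert (E : scal (minus t' t) d = RtoC (t' - t) * d :> C) by apply scal_R_Cmult.
  change (Cmod (h t' - h t - scal (minus t' t) d) <= eps * Rabs (t' - t))%R.
  rewrite E; exact W.
Qed.

Lemma path_deriv_plus (h k : R -> C) (t : R) (d e : C) :
  path_deriv h t d -> path_deriv k t e -> path_deriv (fun t => h t + k t) t (d + e).
Proof.
  intros H1 H2 eps Heps.
  destruct (H1 (eps / 2)%R) as [d1 [Hd1 W1]]; [lra|].
  destruct (H2 (eps / 2)%R) as [d2 [Hd2 W2]]; [lra|].
  exists (Rmin d1 d2); split; [now apply Rmin_pos|]; intros t' Ht.
  specialize (W1 t' (Rlt_le_trans _ _ _ Ht (Rmin_l _ _))).
  specialize (W2 t' (Rlt_le_trans _ _ _ Ht (Rmin_r _ _))).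
  match goal with |- Cmod ?u <= _ => replace u with
    ((h t' - h t - RtoC (t' - t) * d) + (k t' - k t - RtoC (t' - t) * e)) by ring end.
  eapply Rle_trans; [apply Cmod_triangle|lra].
Qed.

Lemma path_deriv_comp (G : C -> C) (e : R -> C) (t : R) (v d : C) :
  Cmod v = 1%R -> (forall t', e t' - e t = RtoC (t' - t) * v) ->
  has_cderiv G (e t) d -> path_deriv (fun t => G (e t)) t (v * d).
Proof.
  intros Hv He HG eps Heps.
  destruct (HG eps Heps) as [delta [Hd W]]; exists delta; split; [exact Hd|]; intros t' Ht'.
  assert (E : Cmod (e t' - e t) = Rabs (t' - t)) by (rewrite He, Cmod_mult, Hv, Cmod_R; ring).
  specialize (W (e t')); rewrite E in W; specialize (W Ht'); rewrite He in W.
  now replace (RtoC (t' - t) * (v * d)) with (d * (RtoC (t' - t) * v)) by ring.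
Qed.

(** The four sides run simultaneously, so the primitive along the contour is one function [Psi] of
    the parameter; at both ends of the interval it equals the value at the bottom right corner minus
    the value at the top left one. *)
Lemma square_integral_primitive (g G : C -> C) (x y s : R) :
  (0 <= s)%R -> (forall w, on_square x y s w -> has_cderiv G w (g w)) ->
  (forall w, on_square x y s w -> ccontinuous g w) ->
  square_integral g x y s = 0.
Proof.
  intros Hs HG Hg.
  set (Psi := fun t => G (bottom_edge x y s t) + G (right_edge x y s t)
    + ((- (1)) * G (top_edge x y s t) + (- (1)) * G (left_edge x y s t))).
  assert (H : is_RInt (V := C_R_CompleteNormedModule) (contour g x y s) 0 s
    (minus (Psi s : C_R_CompleteNormedModule) (Psi 0%R))).
  { apply (is_RInt_derive (V := C_R_CompleteNormedModule) Psi); rewrite Rmin_left, Rmax_right by exact Hs.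
    - intros t Ht.
      apply path_deriv_is_derive.
      assert (F : forall v, on_square x y s v -> has_cderiv (fun w => (- (1)) * G w) v (- (1) * g v))
        by (intros v Hv; now apply has_cderiv_scal, HG).
      replace (contour g x y s t) with
        (1 * g (bottom_edge x y s t) + Ci * g (right_edge x y s t)
         + (1 * (- (1) * g (top_edge x y s t)) + Ci * (- (1) * g (left_edge x y s t))))
        by (unfold contour; ring).
      repeat apply path_deriv_plus.
      + apply path_deriv_comp; [apply Cmod_1| |apply HG; exists t; tauto].
        intros t'; unfold bottom_edge, RtoC, Cminus, Cplus, Copp, Cmult; simpl; f_equal; ring.
      + apply path_deriv_comp; [apply Cmod_Ci| |apply HG; exists t; tauto].
        intros t'; unfold right_edge, Ci, RtoC, Cminus, Cplus, Copp, Cmult; simpl; f_equal; ring.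
      + apply (path_deriv_comp (fun w => (- (1)) * G w)); [apply Cmod_1| |apply F; exists t; tauto].
        intros t'; unfold top_edge, RtoC, Cminus, Cplus, Copp, Cmult; simpl; f_equal; ring.
      + apply (path_deriv_comp (fun w => (- (1)) * G w)); [apply Cmod_Ci| |apply F; exists t; tauto].
        intros t'; unfold left_edge, Ci, RtoC, Cminus, Cplus, Copp, Cmult; simpl; f_equal; ring.
    - intros t Ht; apply path_continuous_continuous, contour_continuous; assumption. }
  unfold square_integral, CInt; rewrite (is_RInt_unique (V := C_R_CompleteNormedModule) _ _ _ _ H).
  change (Psi s - Psi 0%R = 0).
  unfold Psi, bottom_edge, right_edge, top_edge, left_edge; rewrite !Rplus_0_r; ring.
Qed.

(** * Cauchy expansion *)

(** Compactness by the same subdivision principle: bounds on four quarters add up to a bound on the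
    whole, and continuity bounds the function on small squares. *)
Lemma ccontinuous_bounded_square (g : C -> C) (x0 y0 s0 : R) :
  (0 < s0)%R -> (forall w, in_square x0 y0 s0 w -> ccontinuous g w) ->
  exists M, (0 <= M)%R /\ forall w, in_square x0 y0 s0 w -> (Cmod (g w) <= M)%R.
Proof.
  intros Hs0 Hg.
  set (P := fun x y s => exists M, (0 <= M)%R /\
    forall w, in_square x0 y0 s0 w -> in_square x y s w -> (Cmod (g w) <= M)%R).
  enough (H : P x0 y0 s0) by (destruct H as [M [HM H]]; exists M; auto).
  apply square_induction; [exact Hs0| |]; unfold P.
  - intros x y s Hs [M1 [P1 H1]] [M2 [P2 H2]] [M3 [P3 H3]] [M4 [P4 H4]].
    exists (M1 + M2 + M3 + M4)%R; split; [lra|]; intros w Hw Hin.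
    destruct (Rle_dec (Re w) (x + s / 2)) as [A|A], (Rle_dec (Im w) (y + s / 2)) as [B|B];
      unfold in_square in Hin.
    + specialize (H1 w Hw ltac:(split; lra)); lra.
    + specialize (H3 w Hw ltac:(split; lra)); lra.
    + specialize (H2 w Hw ltac:(split; lra)); lra.
    + specialize (H4 w Hw ltac:(split; lra)); lra.
  - intros u v Hu Hv; set (c := (u, v) : C).
    destruct (Hg c (conj Hu Hv) 1%R Rlt_0_1) as [d [Hd W]].
    exists (d / 2)%R; split; [lra|]; intros x y s Hs Hxu Hyv.
    exists (Cmod (g c) + 1)%R; split; [generalize (Cmod_ge_0 (g c)); lra|].
    intros w _ Hin.
    assert (D := in_square_dist x y s w c Hin (conj Hxu Hyv)).
    specialize (W w ltac:(lra)).
    generalize (Cmod_triangle_inv (g w) (g c)); lra.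
Qed.

Lemma Cmod_re_im_lower (w : C) (h : R) :
  (Rabs (Re w) = h \/ Rabs (Im w) = h)%R -> (h <= Cmod w)%R.
Proof. intros [<-|<-]; [apply re_le_Cmod|apply im_le_Cmod]. Qed.

Section CauchySquare.
Context (z0 : C) (h : R) (Hh : (0 < h)%R).

Let x := (Re z0 - h)%R.
Let y := (Im z0 - h)%R.
Let s := (2 * h)%R.
Let SI (g : C -> C) : C := square_integral g x y s.

Lemma centered_on_square_ge (w : C) : on_square x y s w -> (h <= Cmod (w - z0))%R.
Proof using Hh.
  intros [t [Ht Hw]]; apply Cmod_re_im_lower.
  destruct Hw as [->|[->|[->| ->]]]; unfold Re, Im, x, y, s; simpl.
  - right; rewrite Rabs_left; unfold Im; lra.
  - left; rewrite Rabs_right; unfold Re; lra.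
  - right; rewrite Rabs_right; unfold Im; lra.
  - left; rewrite Rabs_left; unfold Re; lra.
Qed.

Lemma centered_in_square_le (w : C) : in_square x y s w -> (Cmod (w - z0) <= 2 * h)%R.
Proof.
  unfold in_square, x, y, s; intros Hw; eapply Rle_trans; [apply Cmod_le_abs|].
  destruct w as [w1 w2], z0 as [u1 u2]; unfold Re, Im in *; simpl in *.
  apply Rle_trans with (h + h)%R; [|lra].
  apply Rplus_le_compat; apply Rabs_le; lra.
Qed.

Lemma centered_in_square (w : C) : (Cmod (w - z0) < h)%R -> in_square x y s w.
Proof.
  intros Hw.
  assert (H1 := Rle_lt_trans _ _ _ (re_le_Cmod _) Hw).
  assert (H2 := Rle_lt_trans _ _ _ (im_le_Cmod _) Hw).
  apply Rabs_def2 in H1; apply Rabs_def2 in H2.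
  destruct w as [w1 w2], z0 as [u1 u2]; unfold in_square, x, y, s, Re, Im in *; simpl in *; lra.
Qed.

Lemma on_square_neq (z w : C) : (Cmod (z - z0) < h)%R -> on_square x y s w -> w <> z.
Proof using Hh. intros Hz Hw ->; apply centered_on_square_ge in Hw; lra. Qed.

Lemma center_close : (Cmod (z0 - z0) < h)%R.
Proof. replace (z0 - z0) with (RtoC 0) by ring; now rewrite Cmod_0. Qed.

Lemma has_cderiv_cauchy_kernel (f : C -> C) (z w : C) (n : nat) :
  (Cmod (z - z0) < h)%R -> on_square x y s w -> (exists d, has_cderiv f w d) ->
  exists d, has_cderiv (fun v => f v * (/ (v - z0)) ^ n * / (v - z)) w d.
Proof using Hh.
  intros Hz Hw [d Hd].
  assert (Hpow : exists e, has_cderiv (fun v => (/ (v - z0)) ^ n) w e).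
  { destruct n as [|n]; [exists (RtoC 0); exact (has_cderiv_const 1 w)|].
    eexists; apply (has_cderiv_pow (fun v => / (v - z0))), has_cderiv_shift_inv.
    exact (on_square_neq _ _ center_close Hw). }
  destruct Hpow as [e He].
  eexists; apply has_cderiv_mult.
  - exact (has_cderiv_mult _ _ _ _ _ Hd He).
  - apply has_cderiv_shift_inv, (on_square_neq z); assumption.
Qed.

Lemma has_cderiv_laurent_kernel (f : C -> C) (w : C) (n : nat) :
  on_square x y s w -> (exists d, has_cderiv f w d) ->
  exists d, has_cderiv (fun v => f v * (/ (v - z0)) ^ n) w d.
Proof using Hh.
  intros Hw [d Hd]; destruct n as [|n].
  - eexists; apply has_cderiv_mult; [exact Hd|exact (has_cderiv_const 1 w)].
  - eexists; apply has_cderiv_mult; [exact Hd|].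
    apply (has_cderiv_pow (fun v => / (v - z0))), has_cderiv_shift_inv.
    exact (on_square_neq _ _ center_close Hw).
Qed.

(** Iterating 1/(w - z) = 1/(w - z0) + u / ((w - z0)(w - z)), where u = z - z0, gives each partial
    sum with an exact remainder integral, so no limit is exchanged with an integral. The remainder
    decays like (|u|/h)^n because the contour stays at distance at least h from z0. *)
Lemma cauchy_integral_series (f : C -> C) (z : C) :
  (forall w, in_square x y s w -> exists d, has_cderiv f w d) ->
  (Cmod (z - z0) < h)%R ->
  is_pser (fun k => SI (fun w => f w * (/ (w - z0)) ^ S k)) (z - z0) (SI (fun w => f w * / (w - z))).
Proof using Hh.
  intros Hf Hz.
  set (u := z - z0); set (r := Cmod u).
  assert (Hs : (0 < s)%R) by (unfold s; lra).
  assert (Hr : (0 <= r)%R) by apply Cmod_ge_0.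
  set (rem := fun n => SI (fun w => f w * (/ (w - z0)) ^ n * / (w - z))).
  assert (Hfon : forall w, on_square x y s w -> exists d, has_cderiv f w d)
    by (intros w Hw; now apply Hf, on_square_in).
  assert (Hrem_cont : forall n w, on_square x y s w ->
    ccontinuous (fun v => f v * (/ (v - z0)) ^ n * / (v - z)) w).
  { intros n w Hw; destruct (has_cderiv_cauchy_kernel f z w n Hz Hw (Hfon w Hw)) as [d Hd].
    exact (has_cderiv_continuous _ _ _ Hd). }
  assert (Hco_cont : forall n w, on_square x y s w ->
    ccontinuous (fun v => f v * (/ (v - z0)) ^ n) w).
  { intros n w Hw; destruct (has_cderiv_laurent_kernel f w n Hw (Hfon w Hw)) as [d Hd].
    exact (has_cderiv_continuous _ _ _ Hd). }
  assert (Hstep : forall n, rem n = SI (fun w => f w * (/ (w - z0)) ^ S n) + u * rem (S n)).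
  { intros n; unfold rem, SI.
    rewrite <- (square_integral_scal _ u) by (try lra; apply (Hrem_cont (S n))).
    rewrite <- square_integral_plus; [|lra|apply (Hco_cont (S n))|].
    - apply square_integral_ext; [lra|]; intros w Hw.
      assert (N1 : w - z0 <> 0) by exact (Cminus_eq_contra _ _ (on_square_neq _ _ center_close Hw)).
      assert (N2 : w - z <> 0) by exact (Cminus_eq_contra _ _ (on_square_neq _ _ Hz Hw)).
      rewrite Cpow_S; unfold u; set (p := (/ (w - z0)) ^ n); field; auto.
    - intros w Hw.
      destruct (has_cderiv_cauchy_kernel f z w (S n) Hz Hw (Hfon w Hw)) as [d Hd].
      exact (has_cderiv_continuous _ _ _ (has_cderiv_scal _ u _ _ Hd)). }
  assert (Hpart : forall n, rem O = csum (fun k => SI (fun w => f w * (/ (w - z0)) ^ S k) * u ^ k) n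
     + u ^ n * rem n).
  { induction n as [|n IH]; [simpl; ring|].
    rewrite IH, Hstep, Cpow_S; simpl csum.
    set (q := SI _); ring. }
  replace (SI (fun w => f w * / (w - z))) with (rem O).
  2: { unfold rem, SI; apply square_integral_ext; [lra|]; intros w _; simpl; ring. }
  destruct (ccontinuous_bounded_square f x y s Hs) as [M [HM HfM]].
  { intros w Hw; destruct (Hf w Hw) as [d Hd]; exact (has_cderiv_continuous _ _ _ Hd). }
  assert (Hhr : (0 < h - r)%R) by (unfold r, u; lra).
  apply Ccv_squeeze with (fun n => s * (4 * (M * / (h - r))) * (r / h) ^ n)%R.
  - intros n; rewrite (Hpart n).
    match goal with |- (Cmod ?e <= _)%R => replace e with (- (u ^ n * rem n)) by ring end.
    rewrite Cmod_opp, Cmod_mult, Cmod_pow; fold r.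
    apply Rle_trans with (r ^ n * (s * (4 * (M * (/ h) ^ n * / (h - r)))))%R.
    2: { unfold Rdiv; rewrite Rpow_mult_distr; apply Req_le; ring. }
    apply Rmult_le_compat_l; [now apply pow_le|].
    apply square_integral_bound; [lra|apply Hrem_cont|].
    intros w Hw.
    assert (N1 : w - z0 <> 0) by exact (Cminus_eq_contra _ _ (on_square_neq _ _ center_close Hw)).
    assert (N2 : w - z <> 0) by exact (Cminus_eq_contra _ _ (on_square_neq _ _ Hz Hw)).
    assert (B1 := centered_on_square_ge w Hw).
    assert (B2 : (h - r <= Cmod (w - z))%R).
    { generalize (Cmod_triangle_inv (w - z0) (z - z0)).
      replace (w - z0 - (z - z0)) with (w - z) by ring; unfold r, u; lra. }
    rewrite !Cmod_mult, Cmod_pow, !Cmod_inv by assumption.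
    apply Rmult_le_compat.
    + apply Rmult_le_pos; [apply Cmod_ge_0|apply pow_le, Rlt_le, Rinv_0_lt_compat; lra].
    + apply Rlt_le, Rinv_0_lt_compat; lra.
    + apply Rmult_le_compat; [apply Cmod_ge_0|apply pow_le, Rlt_le, Rinv_0_lt_compat; lra| |].
      * now apply HfM, on_square_in.
      * apply pow_incr; split; [apply Rlt_le, Rinv_0_lt_compat; lra|apply Rinv_le_contravar; lra].
    + apply Rinv_le_contravar; lra.
  - replace (Finite 0) with (Rbar_mult (s * (4 * (M * / (h - r))))%R 0%R)
      by (simpl; f_equal; ring).
    apply is_lim_seq_scal_l, is_lim_seq_geom.
    rewrite Rabs_right.
    + apply (Rmult_lt_reg_r h); [exact Hh|]; unfold Rdiv; rewrite Rmult_assoc, Rinv_l by lra; lra.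
    + apply Rle_ge, Rmult_le_pos; [exact Hr|apply Rlt_le, Rinv_0_lt_compat, Hh].
Qed.

(** Goursat's lemma is applied to the difference quotient of [f] at [z]. The integral of 1/(w - z)
    stays as an unevaluated factor. *)
Lemma cauchy_difference_quotient (f : C -> C) (z : C) :
  (forall w, in_square x y s w -> exists d, has_cderiv f w d) ->
  (Cmod (z - z0) < h)%R ->
  SI (fun w => f w * / (w - z)) = f z * SI (fun w => 1 * / (w - z)).
Proof using Hh.
  intros Hf Hz.
  assert (Hs : (0 < s)%R) by (unfold s; lra).
  destruct (Hf z (centered_in_square z Hz)) as [d Hd].
  (* Subtracting [d] makes the continuous extension take the value 0 at [z], as required at the
     exceptional point; the constant [d] itself integrates to 0. *)
  set (q := fun w => if Ceq_dec w z then RtoC 0 else (f w - f z) * / (w - z) - d).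
  assert (Hqz : q z = 0) by (unfold q; destruct (Ceq_dec z z); [reflexivity|congruence]).
  assert (Hqd : forall w, in_square x y s w -> w <> z -> exists e, has_cderiv q w e).
  { intros w Hw Hne; destruct (Hf w Hw) as [e He].
    eexists; apply has_cderiv_ext_loc with
      (f := fun w => (f w + (- f z)) * / (w - z) + - d) (r := Cmod (w - z)).
    - apply Cmod_gt_0; now apply Cminus_eq_contra.
    - intros v Hv; unfold q; destruct (Ceq_dec v z) as [->|Hvz]; [|unfold Cminus; ring].
      rewrite Cmod_sym in Hv; lra.
    - apply has_cderiv_plus; [|apply has_cderiv_const].
      apply (has_cderiv_mult (fun w => f w + (- f z))).
      + apply has_cderiv_plus; [exact He|apply has_cderiv_const].
      + now apply has_cderiv_shift_inv. }
  assert (Hqc : forall w, in_square x y s w -> ccontinuous q w).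
  { intros w Hw; destruct (Ceq_dec w z) as [->|Hne].
    - intros eps Heps; destruct (Hd (eps / 2)%R) as [r [Hr W]]; [lra|].
      exists r; split; [exact Hr|]; intros v Hv; rewrite Hqz; unfold q.
      destruct (Ceq_dec v z) as [->|Hvz].
      + replace (RtoC 0 - 0) with (RtoC 0) by ring; now rewrite Cmod_0.
      + assert (Hnz : v - z <> 0) by now apply Cminus_eq_contra.
        assert (Hpos : (0 < Cmod (v - z))%R) by now apply Cmod_gt_0.
        replace ((f v - f z) * / (v - z) - d - 0) with ((f v - f z - d * (v - z)) / (v - z))
          by (field; exact Hnz).
        rewrite Cmod_div by exact Hnz; specialize (W v Hv).
        apply Rle_lt_trans with (eps / 2)%R; [|lra].
        apply (Rmult_le_reg_r (Cmod (v - z))); [exact Hpos|].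
        unfold Rdiv at 1; rewrite Rmult_assoc, Rinv_l, Rmult_1_r by lra; exact W.
    - destruct (Hqd w Hw Hne) as [e He]; exact (has_cderiv_continuous _ _ _ He). }
  assert (HG := goursat q z x y s Hs Hqz Hqc Hqd).
  assert (K1 : forall w, on_square x y s w -> exists e, has_cderiv (fun w => 1 * / (w - z)) w e).
  { intros w Hw; eexists; apply has_cderiv_scal, has_cderiv_shift_inv; now apply (on_square_neq z). }
  assert (K2 : forall w, on_square x y s w -> exists e, has_cderiv (fun w => f w * / (w - z)) w e).
  { intros w Hw; destruct (Hf w (on_square_in _ _ _ _ Hw)) as [e He].
    eexists; apply has_cderiv_mult; [exact He|apply has_cderiv_shift_inv; now apply (on_square_neq z)]. }
  assert (K3 : forall w, exists e, has_cderiv (fun w => - d + 0 * w) w e).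
  { intros w; eexists; apply has_cderiv_plus; [apply has_cderiv_const|apply has_cderiv_scal, has_cderiv_id]. }
  assert (E : square_integral q x y s = SI (fun w => f w * / (w - z))
     + ((- f z) * SI (fun w => 1 * / (w - z)) + square_integral (fun w => - d + 0 * w) x y s)).
  { unfold SI; rewrite <- square_integral_scal.
    2: lra.
    2: { intros w Hw; destruct (K1 w Hw) as [e He]; exact (has_cderiv_continuous _ _ _ He). }
    rewrite <- square_integral_plus.
    2: lra.
    2: { intros w Hw; destruct (K1 w Hw) as [e He].
         exact (has_cderiv_continuous _ _ _ (has_cderiv_scal _ _ _ _ He)). }
    2: { intros w Hw; destruct (K3 w) as [e He]; exact (has_cderiv_continuous _ _ _ He). }
    rewrite <- square_integral_plus.
    2: lra.
    2: { intros w Hw; destruct (K2 w Hw) as [e He]; exact (has_cderiv_continuous _ _ _ He). }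
    2: { intros w Hw; destruct (K1 w Hw) as [e He]; destruct (K3 w) as [e' He'].
         exact (has_cderiv_continuous _ _ _ (has_cderiv_plus _ _ _ _ _ (has_cderiv_scal _ _ _ _ He) He')). }
    apply square_integral_ext; [lra|]; intros w Hw; unfold q.
    destruct (Ceq_dec w z) as [Ewz|_]; [exfalso; exact (on_square_neq z w Hz Hw Ewz)|ring]. }
  rewrite HG, square_integral_affine in E by lra.
  apply Ceq_minus.
  transitivity (SI (fun w => f w * / (w - z)) + ((- f z) * SI (fun w => 1 * / (w - z)) + 0)); [ring|].
  now rewrite <- E.
Qed.

(** Powers with exponent at most -2 have a primitive off z0. *)
Lemma winding_coefficient (k : nat) :
  SI (fun w => 1 * (/ (w - z0)) ^ S (S k)) = 0.
Proof using Hh.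
  assert (Hs : (0 < s)%R) by (unfold s; lra).
  apply square_integral_primitive with
    (G := fun w => (- / RtoC (INR (S k))) * (/ (w - z0)) ^ S k); [lra| |].
  - intros w Hw.
    assert (N : w - z0 <> 0) by exact (Cminus_eq_contra _ _ (on_square_neq _ _ center_close Hw)).
    assert (Hk : RtoC (INR (S k)) <> 0).
    { intros E; apply RtoC_inj in E; revert E; apply not_0_INR; lia. }
    replace (1 * (/ (w - z0)) ^ S (S k)) with
      ((- / RtoC (INR (S k))) * (RtoC (INR (S k)) * (/ (w - z0)) ^ k * (- / ((w - z0) * (w - z0)))))
      by (rewrite !Cpow_S; set (p := (/ (w - z0)) ^ k); field; auto).
    apply has_cderiv_scal, (has_cderiv_pow (fun w => / (w - z0))), has_cderiv_shift_inv.
    exact (on_square_neq _ _ center_close Hw).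
  - intros w Hw.
    destruct (has_cderiv_laurent_kernel (fun _ => 1) w (S (S k)) Hw) as [e He].
    + exists (RtoC 0); apply has_cderiv_const.
    + exact (has_cderiv_continuous _ _ _ He).
Qed.

(** With v = t - h the four sides add up to 4 i h / (v^2 + h^2), whose imaginary part is at least
    2/h since |v| <= h. Over an interval of length 2 h this yields an imaginary part of at least
    4. *)
Lemma winding_nonzero : SI (fun w => 1 * (/ (w - z0)) ^ 1) <> 0.
Proof using Hh.
  assert (Hs : (0 < s)%R) by (unfold s; lra).
  assert (Hc : forall t, (0 <= t <= s)%R ->
    path_continuous (contour (fun w => 1 * (/ (w - z0)) ^ 1) x y s) t).
  { apply contour_continuous; intros w Hw.
    destruct (has_cderiv_laurent_kernel (fun _ => 1) w 1 Hw) as [e He].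
    - exists (RtoC 0); apply has_cderiv_const.
    - exact (has_cderiv_continuous _ _ _ He). }
  assert (HI := RInt_correct (V := C_R_CompleteNormedModule) _ _ _ (ex_CInt _ _ _ (Rlt_le _ _ Hs) Hc)).
  assert (H2 := is_RInt_fct_extend_snd (U := R_NormedModule) (V := R_NormedModule) _ _ _ _ HI).
  assert (H3 : (s * (2 / h) <= snd (SI (fun w => (1 * (/ (w - z0)) ^ 1)%C)))%R).
  { replace (s * (2 / h))%R with ((s - 0) * (2 / h))%R by ring.
    apply (is_RInt_le (fun _ => 2 / h)%R (fun t => snd (contour (fun w => (1 * (/ (w - z0)) ^ 1)%C) x y s t))
      0 s); [lra|apply (is_RInt_const (V := R_NormedModule))|exact H2|].
    intros t Ht.
    set (v := (t - h)%R).
    assert (Hv : (v * v <= h * h)%R) by (unfold v, s in *; nra).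
    assert (Hpos : (0 < v * v + h * h)%R) by nra.
    replace (contour (fun w => 1 * (/ (w - z0)) ^ 1) x y s t)
      with ((0%R, (4 * h / (v * v + h * h))%R) : C).
    - simpl; apply (Rmult_le_reg_r (h * (v * v + h * h))); [nra|].
      replace (2 / h * (h * (v * v + h * h)))%R with (2 * (v * v + h * h))%R by (field; lra).
      replace (4 * h / (v * v + h * h) * (h * (v * v + h * h)))%R with (4 * (h * h))%R by (field; lra).
      lra.
    - unfold contour, bottom_edge, right_edge, top_edge, left_edge, x, y, s, v.
      destruct z0 as [u1 u2]; unfold Re, Im, Ci, Cinv, Cminus, Cplus, Cmult, Copp, RtoC; simpl.
      f_equal; field; unfold v in *; repeat split; intros E; simpl in E; nra. }
  intros E; rewrite E in H3; simpl in H3.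
  unfold s in H3; assert (2 * h * (2 / h) = 4)%R by (field; lra); lra.
Qed.

(** The coefficients are the Laurent-type integrals divided by the winding integral [w0], and the
    bound on them comes from the maximum of [f] on the square. *)
Lemma cauchy_expansion_square (f : C -> C) :
  (forall w, in_square x y s w -> exists d, has_cderiv f w d) ->
  exists (a : nat -> C) (M : R), (forall k, (Cmod (a k) <= M * (/ h) ^ k)%R) /\
    forall z, (Cmod (z - z0) < h)%R -> is_pser a (z - z0) (f z).
Proof using Hh.
  intros Hf.
  assert (Hs : (0 < s)%R) by (unfold s; lra).
  set (w0 := SI (fun w => 1 * (/ (w - z0)) ^ 1)).
  set (c := fun k => SI (fun w => f w * (/ (w - z0)) ^ S k)).
  assert (Hw0 : w0 <> 0) by exact winding_nonzero.
  destruct (ccontinuous_bounded_square f x y s Hs) as [M [HM HfM]].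
  { intros w Hw; destruct (Hf w Hw) as [d Hd]; exact (has_cderiv_continuous _ _ _ Hd). }
  exists (fun k => / w0 * c k), (/ Cmod w0 * (s * (4 * (M * / h))))%R; split.
  - intros k; rewrite Cmod_mult, Cmod_inv, Rmult_assoc by exact Hw0.
    apply Rmult_le_compat_l; [apply Rlt_le, Rinv_0_lt_compat; now apply Cmod_gt_0|].
    replace (s * (4 * (M * / h)) * (/ h) ^ k)%R with (s * (4 * (M * (/ h) ^ S k)))%R by (simpl; ring).
    apply square_integral_bound; [lra| |].
    + intros w Hw.
      destruct (has_cderiv_laurent_kernel f w (S k) Hw (Hf w (on_square_in _ _ _ _ Hw))) as [e He].
      exact (has_cderiv_continuous _ _ _ He).
    + intros w Hw.
      assert (N1 : w - z0 <> 0) by exact (Cminus_eq_contra _ _ (on_square_neq _ _ center_close Hw)).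
      assert (B1 := centered_on_square_ge w Hw).
      rewrite Cmod_mult, Cmod_pow, Cmod_inv by exact N1.
      apply Rmult_le_compat; [apply Cmod_ge_0|apply pow_le, Rlt_le, Rinv_0_lt_compat; lra| |].
      * now apply HfM, on_square_in.
      * apply pow_incr; split; [apply Rlt_le, Rinv_0_lt_compat; lra|apply Rinv_le_contravar; lra].
  - intros z Hz.
    (* Independence of the winding integral from [z] follows from expanding the constant function 1:
       all coefficients except the first have a primitive and vanish. *)
    assert (HW : SI (fun w => 1 * / (w - z)) = w0).
    { assert (P1 := cauchy_integral_series (fun _ => 1) z
        (fun w _ => ex_intro _ _ (has_cderiv_const 1 w)) Hz).
      eapply Ccv_unique; [exact P1|].
      apply Ccv_incr, Ccv_ext with (fun _ => w0); [|apply Ccv_const].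
      intros n; rewrite csum_first.
      rewrite (csum_zero _ n); [unfold w0; simpl; ring|].
      intros k; rewrite winding_coefficient; ring. }
    assert (P2 := cauchy_integral_series f z Hf Hz).
    rewrite (cauchy_difference_quotient f z Hf Hz), HW in P2.
    replace (f z) with (/ w0 * (f z * w0)) by (field; exact Hw0).
    apply Ccv_ext with (fun n => / w0 * csum (fun k => c k * (z - z0) ^ k) n).
    + intros n; rewrite <- csum_scal; apply csum_ext; intros k; ring.
    + now apply Ccv_scal.
Qed.

End CauchySquare.

Lemma cauchy_expansion (f : C -> C) (z0 : C) (r : R) :
  (0 < r)%R -> (forall w, (Cmod (w - z0) < r)%R -> exists d, has_cderiv f w d) ->
  exists (a : nat -> C) (M rho : R), (0 < rho)%R /\ (forall k, (Cmod (a k) <= M * rho ^ k)%R) /\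
    forall z, (Cmod (z - z0) * rho < 1)%R -> is_pser a (z - z0) (f z).
Proof.
  intros Hr Hf.
  (* The square of half side r/4 lies in the disc of radius r/2, hence inside the disc of
     differentiability. *)
  destruct (cauchy_expansion_square z0 (r / 4) ltac:(lra) f) as [a [M [Ha Hs]]].
  - intros w Hw; apply Hf; apply centered_in_square_le in Hw; lra.
  - exists a, M, (/ (r / 4))%R; split; [apply Rinv_0_lt_compat; lra|]; split; [exact Ha|].
    intros z Hz; apply Hs.
    apply (Rmult_lt_reg_r (/ (r / 4))); [apply Rinv_0_lt_compat; lra|].
    rewrite Rinv_r by lra; exact Hz.
Qed.

(** * Power series *)

Lemma Ccv_incr_n (u : nat -> C) (l : C) (m : nat) : Ccv u l -> Ccv (fun n => u (n + m)%nat) l.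
Proof. exact (proj1 (is_lim_seq_incr_n (fun n => Cmod (u n - l)) m 0%R)). Qed.

Lemma Ccv_summable (u : nat -> C) (c : nat -> R) :
  ex_series c -> (forall n, Cmod (u (S n) - u n) <= c n)%R -> exists l, Ccv u l.
Proof.
  intros Hc Hu.
  destruct (ex_series_le (V := C_CompleteNormedModule) (fun n => u (S n) - u n) c Hu Hc) as [l Hl].
  exists (l + u O); apply Ccv_incr; apply is_lim_seq_spec; intros eps.
  destruct (proj1 (filterlim_locally_ball_norm (K := C_AbsRing) (U := C_NormedModule) _ _) Hl eps)
    as [N HN].
  exists N; intros n Hn; specialize (HN n Hn).
  assert (E : sum_n (G := C_NormedModule) (fun n => u (S n) - u n) n = u (S n) - u O :> C).
  { clear; induction n as [|n IH].
    - apply (sum_O (G := C_NormedModule)).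
    - rewrite (sum_Sn (G := C_NormedModule)), IH.
      change (u (S n) - u O + (u (S (S n)) - u (S n)) = u (S (S n)) - u O); ring. }
  change (Cmod ((sum_n (G := C_NormedModule) (fun n => (u (S n) - u n)%C) n : C) - l)%C < eps)%R in HN.
  rewrite E in HN.
  rewrite Rminus_0_r, Rabs_right by (apply Rle_ge, Cmod_ge_0).
  now replace (u (S n) - (l + u O)) with (u (S n) - u O - l) by ring.
Qed.

Lemma is_pser_ext (a b : nat -> C) (z l : C) :
  (forall k, a k = b k) -> is_pser a z l -> is_pser b z l.
Proof. intros H; apply Ccv_ext; intros n; apply csum_ext; intros k; now rewrite H. Qed.

Lemma is_pser_plus (a b : nat -> C) (z l m : C) :
  is_pser a z l -> is_pser b z m -> is_pser (fun k => a k + b k) z (l + m).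
Proof.
  intros Ha Hb; eapply Ccv_ext; [|exact (Ccv_plus _ _ _ _ Ha Hb)].
  intros n; simpl; rewrite <- csum_plus; apply csum_ext; intros k; ring.
Qed.

Lemma is_pser_scal (a : nat -> C) (c z l : C) :
  is_pser a z l -> is_pser (fun k => c * a k) z (c * l).
Proof.
  intros Ha; eapply Ccv_ext; [|exact (Ccv_scal _ c _ Ha)].
  intros n; simpl; rewrite <- csum_scal; apply csum_ext; intros k; ring.
Qed.

Definition pser_shift (a : nat -> C) (k : nat) : C := match k with O => RtoC 0 | S j => a j end.

Lemma is_pser_shift (a : nat -> C) (z l : C) : is_pser a z l -> is_pser (pser_shift a) z (z * l).
Proof.
  intros Ha; apply Ccv_incr.
  eapply Ccv_ext; [|exact (Ccv_scal _ z _ Ha)].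
  intros n; rewrite csum_first, <- csum_scal; simpl; rewrite Cmult_0_l, Cplus_0_l.
  apply csum_ext; intros k; ring.
Qed.

Definition pser_derive (a : nat -> C) (k : nat) : C := RtoC (INR (S k)) * a (S k).

Lemma INR_S_le_pow2 (k : nat) : (INR (S k) <= 2 ^ k)%R.
Proof.
  induction k as [|k IH]; [simpl; lra|].
  rewrite S_INR; simpl pow. assert (1 <= 2 ^ k)%R by (apply pow_R1_Rle; lra). lra.
Qed.

(** The factor k + 1 is at most 2^k. Doubling the rate keeps the bound geometric, so that
    differentiation can be repeated. *)
Lemma pser_derive_bound (a : nat -> C) (M rho : R) :
  (0 <= rho)%R -> (forall k, Cmod (a k) <= M * rho ^ k)%R ->
  forall k, (Cmod (pser_derive a k) <= M * rho * (2 * rho) ^ k)%R.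
Proof.
  intros Hr Ha k; unfold pser_derive; rewrite Cmod_mult, Cmod_R, Rabs_right by (apply Rle_ge, pos_INR).
  rewrite Rpow_mult_distr.
  replace (M * rho * (2 ^ k * rho ^ k))%R with (2 ^ k * (M * rho ^ S k))%R by (simpl; ring).
  apply Rmult_le_compat; [apply pos_INR|apply Cmod_ge_0|apply INR_S_le_pow2|apply Ha].
Qed.

Lemma coeff_bound_nonneg (a : nat -> C) (M rho : R) :
  (forall k, Cmod (a k) <= M * rho ^ k)%R -> (0 <= M)%R.
Proof. intros H; generalize (H O) (Cmod_ge_0 (a O)); simpl; lra. Qed.

Lemma pser_term_bound (a : nat -> C) (M rho : R) (z : C) (k : nat) :
  (0 <= rho)%R -> (forall k, Cmod (a k) <= M * rho ^ k)%R ->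
  (Cmod (a k * z ^ k) <= M * (Cmod z * rho) ^ k)%R.
Proof.
  intros Hr Ha; rewrite Cmod_mult, Cmod_pow, Rpow_mult_distr.
  replace (M * (Cmod z ^ k * rho ^ k))%R with (M * rho ^ k * Cmod z ^ k)%R by ring.
  apply Rmult_le_compat_r; [apply pow_le, Cmod_ge_0|apply Ha].
Qed.

Lemma is_pser_ex (a : nat -> C) (M rho : R) (z : C) :
  (0 <= rho)%R -> (forall k, Cmod (a k) <= M * rho ^ k)%R -> (Cmod z * rho < 1)%R ->
  exists l, is_pser a z l.
Proof.
  intros Hr Ha Hz.
  apply Ccv_summable with (fun k => M * (Cmod z * rho) ^ k)%R.
  - apply (ex_series_scal (V := R_NormedModule) M), ex_series_geom.
    rewrite Rabs_right; [exact Hz|apply Rle_ge, Rmult_le_pos; [apply Cmod_ge_0|exact Hr]].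
  - intros n; simpl.
    match goal with |- (Cmod ?e <= _)%R => replace e with (a n * z ^ n) by ring end.
    now apply pser_term_bound.
Qed.

Lemma pser_leading_term (a : nat -> C) (M rho : R) (z l : C) (m : nat) :
  (0 <= rho)%R -> (forall k, Cmod (a k) <= M * rho ^ k)%R -> (Cmod z * rho <= 1 / 2)%R ->
  (forall k, (k < m)%nat -> a k = 0) -> is_pser a z l ->
  (Cmod (l - a m * z ^ m) <= 2 * M * (Cmod z * rho) ^ S m)%R.
Proof.
  intros Hr Ha Hz Hm Hl.
  set (q := (Cmod z * rho)%R) in *.
  assert (Hq : (0 <= q)%R) by (apply Rmult_le_pos; [apply Cmod_ge_0|exact Hr]).
  assert (HM := coeff_bound_nonneg a M rho Ha).
  apply (Ccv_incr_n _ _ (S m)) in Hl.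
  apply Ccv_bound with (1 := Hl); intros n.
  assert (Hz0 : forall j, (j <= m)%nat -> csum (fun k => a k * z ^ k) j = 0).
  { induction j as [|j IH]; intros Hj; [reflexivity|]; simpl.
    rewrite IH, Hm by lia; ring. }
  set (u := csum (fun k => a k * z ^ k)) in *.
  (* The sharper bound with a subtracted power makes the induction work: M q^j <= 2 M (q^j -
     q^(j+1)) because q <= 1/2. *)
  assert (H : (Cmod (u (n + S m)%nat - a m * z ^ m)
    <= 2 * M * (q ^ S m - q ^ (n + S m)))%R).
  { induction n as [|n IH].
    - change (u (0 + S m)%nat) with (u m + a m * z ^ m); rewrite Hz0 by lia.
      replace (0 + a m * z ^ m - a m * z ^ m) with (RtoC 0) by ring; rewrite Cmod_0.
      simpl; lra.
    - change (u (S n + S m)%nat) with (u (n + S m)%nat + a (n + S m)%nat * z ^ (n + S m)).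
      match goal with |- (Cmod (?u + ?v - ?w) <= _)%R =>
        replace (u + v - w) with ((u - w) + v) by ring end.
      eapply Rle_trans; [apply Cmod_triangle|].
      assert (T := pser_term_bound a M rho z (n + S m) Hr Ha); fold q in T.
      change (q ^ (S n + S m))%R with (q * q ^ (n + S m))%R.
      assert (P : (0 <= q ^ (n + S m))%R) by now apply pow_le.
      assert (M * q ^ (n + S m) >= 2 * (M * (q * q ^ (n + S m))))%R; [|lra].
      apply Rle_ge; rewrite <- (Rmult_assoc 2), (Rmult_comm 2), Rmult_assoc.
      apply Rmult_le_compat_l; [exact HM|]; nra. }
  eapply Rle_trans; [exact H|].
  assert (P : (0 <= q ^ (n + S m))%R) by now apply pow_le.
  apply Rmult_le_compat_l; lra.
Qed.

(** Near 0 the first nonzero term beats the tail, which is of the order of one more power of z. *)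
Lemma pser_isolated_zero (a : nat -> C) (M rho : R) (m : nat) :
  (0 < rho)%R -> (forall k, Cmod (a k) <= M * rho ^ k)%R ->
  (forall k, (k < m)%nat -> a k = 0) -> a m <> 0 ->
  exists delta, (0 < delta)%R /\ forall z l : C,
    z <> 0 -> (Cmod z < delta)%R -> is_pser a z l -> l <> 0.
Proof.
  intros Hr Ha Hm Hne.
  assert (HM := coeff_bound_nonneg a M rho Ha).
  assert (Ham : (0 < Cmod (a m))%R) by now apply Cmod_gt_0.
  assert (HP : (0 <= 2 * M * rho ^ S m)%R) by (apply Rmult_le_pos; [lra|apply pow_le; lra]).
  set (K := (2 * M * rho ^ S m + 1)%R).
  assert (HK : (0 < K)%R) by (unfold K; lra).
  exists (Rmin (/ (2 * rho)) (Cmod (a m) / K)); split.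
  { apply Rmin_pos; [apply Rinv_0_lt_compat; lra|apply Rdiv_lt_0_compat; assumption]. }
  intros z l Hz Hd Hl E; subst l.
  assert (H1 := Rlt_le_trans _ _ _ Hd (Rmin_l _ _)).
  assert (H2 := Rlt_le_trans _ _ _ Hd (Rmin_r _ _)).
  assert (Hzp : (0 < Cmod z)%R) by (apply Cmod_gt_0; exact Hz).
  assert (L := pser_leading_term a M rho z 0 m ltac:(lra) Ha).
  assert (Hz2 : (Cmod z * rho <= 1 / 2)%R).
  { replace (1 / 2)%R with (/ (2 * rho) * rho)%R by (field; lra).
    apply Rmult_le_compat_r; lra. }
  specialize (L Hz2 Hm Hl).
  replace (0 - a m * z ^ m) with (- (a m * z ^ m)) in L by ring.
  rewrite Cmod_opp, Cmod_mult, Cmod_pow, Rpow_mult_distr in L.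
  assert (Hzm : (0 < Cmod z ^ m)%R) by now apply pow_lt.
  assert (L2 : (Cmod (a m) <= 2 * M * rho ^ S m * Cmod z)%R).
  { apply (Rmult_le_reg_r (Cmod z ^ m)); [exact Hzm|].
    replace (2 * M * rho ^ S m * Cmod z * Cmod z ^ m)%R
      with (2 * M * (Cmod z ^ S m * rho ^ S m))%R by (simpl; ring); exact L. }
  apply Rmult_lt_compat_l with (r := K) in H2; [|exact HK].
  replace (K * (Cmod (a m) / K))%R with (Cmod (a m)) in H2 by (field; lra).
  unfold K in H2; lra.
Qed.

Lemma first_nonzero (a : nat -> C) (k : nat) :
  a k <> 0 -> exists m, a m <> 0 /\ forall j, (j < m)%nat -> a j = 0.
Proof.
  induction k as [k IH] using (well_founded_induction Wf_nat.lt_wf); intros Hk.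
  destruct (classic (exists j, (j < k)%nat /\ a j <> 0)) as [[j [Hj Hne]]|Hno].
  - exact (IH j Hj Hne).
  - exists k; split; [exact Hk|]; intros j Hj; apply NNPP; intros Hne; apply Hno; now exists j.
Qed.

Lemma is_pser_coeff_bound (a : nat -> C) (z l : C) :
  z <> 0 -> is_pser a z l -> exists M, forall k, (Cmod (a k) <= M * (/ Cmod z) ^ k)%R.
Proof.
  intros Hz Hl.
  destruct (filterlim_bounded (K := R_AbsRing) (V := R_NormedModule) _ (ex_intro _ 0%R Hl)) as [K HK].
  assert (Hp : (0 < Cmod z)%R) by now apply Cmod_gt_0.
  set (u := csum (fun k => a k * z ^ k)) in *.
  assert (Hu : forall n, (Cmod (u n - l) <= K)%R).
  { intros n; specialize (HK n).
    change (Rabs (Cmod (u n - l)) <= K)%R in HK.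
    now rewrite Rabs_right in HK by (apply Rle_ge, Cmod_ge_0). }
  exists (2 * K)%R; intros k.
  assert (T : (Cmod (a k) * Cmod z ^ k <= 2 * K)%R).
  { rewrite <- Cmod_pow, <- Cmod_mult.
    replace (a k * z ^ k) with ((u (S k) - l) - (u k - l)) by (unfold u; simpl; ring).
    eapply Rle_trans; [apply Cmod_minus_le|]; generalize (Hu k) (Hu (S k)); lra. }
  apply (Rmult_le_reg_r (Cmod z ^ k)); [now apply pow_lt|].
  rewrite Rmult_assoc, <- Rpow_mult_distr, Rinv_l, pow1, Rmult_1_r by lra; exact T.
Qed.

(** A first nonzero coefficient would make the sum nonzero at all small nonzero points; a small
    positive real is used as test point. *)
Lemma pser_zero_coeffs (a : nat -> C) (r : R) :
  (0 < r)%R -> (forall z, (Cmod z < r)%R -> is_pser a z 0) -> forall k, a k = 0.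
Proof.
  intros Hr0 Hz.
  assert (Hsmall : forall t, (0 < t)%R -> Cmod (RtoC t) = t /\ RtoC t <> 0).
  { intros t Ht; assert (E : Cmod (RtoC t) = t) by (rewrite Cmod_R, Rabs_right; lra).
    split; [exact E|]; apply Cmod_gt_0; lra. }
  destruct (Hsmall (r / 2)%R ltac:(lra)) as [E1 N1].
  destruct (is_pser_coeff_bound a (RtoC (r / 2)) 0 N1) as [M Ha]; [apply Hz; lra|].
  rewrite E1 in Ha.
  intros k; apply NNPP; intros Hne.
  destruct (first_nonzero a k Hne) as [m [Hm Hj]].
  destruct (pser_isolated_zero a M (/ (r / 2)) m ltac:(apply Rinv_0_lt_compat; lra) Ha Hj Hm)
    as [d [Hd W]].
  assert (Ht : (0 < Rmin d r)%R) by now apply Rmin_pos.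
  assert (Ht1 := Rmin_l d r); assert (Ht2 := Rmin_r d r).
  destruct (Hsmall (Rmin d r / 2)%R ltac:(lra)) as [E2 N2].
  apply (W (RtoC (Rmin d r / 2)) 0); [exact N2|lra|apply Hz; lra|reflexivity].
Qed.

(** The error satisfies e_(k+1) = w e_k + (k+1) z^k (w - z)^2, and N^2 + N <= (N+1)^2 closes the
    induction. The factor [r * r] on the left avoids a negative exponent of [r] on the right. *)
Lemma pow_second_order (r : R) (z w : C) (k : nat) :
  (0 < r)%R -> (Cmod z <= r)%R -> (Cmod w <= r)%R ->
  (r * r * Cmod (w ^ S k - z ^ S k - RtoC (INR (S k)) * z ^ k * (w - z))
    <= INR (S k) * INR (S k) * r ^ S k * (Cmod (w - z) * Cmod (w - z)))%R.
Proof.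
  intros Hr Hz Hw; induction k as [|k IH].
  - replace (w ^ 1 - z ^ 1 - RtoC (INR 1) * z ^ 0 * (w - z)) with (RtoC 0) by (simpl; ring).
    rewrite Cmod_0; simpl; generalize (Cmod_ge_0 (w - z)); nra.
  - replace (w ^ S (S k) - z ^ S (S k) - RtoC (INR (S (S k))) * z ^ S k * (w - z))
      with (w * (w ^ S k - z ^ S k - RtoC (INR (S k)) * z ^ k * (w - z))
            + RtoC (INR (S k)) * (z ^ k * ((w - z) * (w - z))))
      by (rewrite (S_INR (S k)), RtoC_plus; simpl; ring).
    set (e := w ^ S k - z ^ S k - RtoC (INR (S k)) * z ^ k * (w - z)) in *.
    set (d := Cmod (w - z)) in *.
    assert (Hd : (0 <= d)%R) by apply Cmod_ge_0.
    assert (He := Cmod_ge_0 e).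
    assert (T : (Cmod (w * e + RtoC (INR (S k)) * (z ^ k * ((w - z) * (w - z))))
      <= r * Cmod e + INR (S k) * (r ^ k * (d * d)))%R).
    { eapply Rle_trans; [apply Cmod_triangle|].
      rewrite !Cmod_mult, Cmod_pow, Cmod_R, Rabs_right by (apply Rle_ge, pos_INR); fold d.
      apply Rplus_le_compat; [apply Rmult_le_compat_r; assumption|].
      apply Rmult_le_compat_l; [apply pos_INR|].
      apply Rmult_le_compat_r; [nra|]; apply pow_incr; split; [apply Cmod_ge_0|exact Hz]. }
    eapply Rle_trans; [apply Rmult_le_compat_l; [nra|exact T]|].
    assert (IH2 := Rmult_le_compat_l r _ _ ltac:(lra) IH).
    rewrite (S_INR (S k)); set (N := INR (S k)) in *.
    assert (HN : (0 <= N)%R) by apply pos_INR.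
    assert (Hrk : (0 <= r ^ k)%R) by (apply pow_le; lra).
    change (r ^ S (S k))%R with (r * (r * r ^ k))%R; change (r ^ S k)%R with (r * r ^ k)%R in IH2.
    apply Rle_trans with (N * N * (r * (r * r ^ k)) * (d * d) + N * ((r * (r * r ^ k)) * (d * d)))%R.
    { replace (r * r * (r * Cmod e + N * (r ^ k * (d * d))))%R with
        (r * (r * r * Cmod e) + N * (r * (r * r ^ k) * (d * d)))%R by ring.
      replace (N * N * (r * (r * r ^ k)) * (d * d))%R with
        (r * (N * N * (r * r ^ k) * (d * d)))%R by ring; lra. }
    assert (Q : (0 <= r * (r * r ^ k) * (d * d))%R)
      by (apply Rmult_le_pos; [apply Rmult_le_pos; [lra|apply Rmult_le_pos; lra]|nra]).
    replace (N * N * (r * (r * r ^ k)) * (d * d))%R with (N * N * (r * (r * r ^ k) * (d * d)))%R by ring.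
    replace ((N + 1) * (N + 1) * (r * (r * r ^ k)) * (d * d))%R
      with ((N + 1) * (N + 1) * (r * (r * r ^ k) * (d * d)))%R by ring.
    set (X := (r * (r * r ^ k) * (d * d))%R) in *; nra.
Qed.

(** Termwise second-order remainders sum to at most K |w - z|^2 on a smaller disc, so the derived
    series is the derivative. *)
Lemma is_pser_has_cderiv (a : nat -> C) (M rho : R) (f : C -> C) (z g : C) :
  (0 < rho)%R -> (forall k, Cmod (a k) <= M * rho ^ k)%R ->
  (forall w, (Cmod w * rho < 1)%R -> is_pser a w (f w)) ->
  (Cmod z * (8 * rho) < 1)%R -> is_pser (pser_derive a) z g -> has_cderiv f z g.
Proof.
  intros Hrho Ha Hf Hz Hg.
  assert (HM := coeff_bound_nonneg a M rho Ha).
  (* The squared factor (k+1)^2 is at most 4^k, and [rho * r] = 1/8 leaves a geometric series of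
     ratio 1/2. *)
  set (r := (/ (8 * rho))%R).
  assert (Hr : (0 < r)%R) by (apply Rinv_0_lt_compat; lra).
  assert (Err : (r * (8 * rho) = 1)%R) by (unfold r; field; lra).
  assert (Hzr : (Cmod z < r)%R) by (apply (Rmult_lt_reg_r (8 * rho)); lra).
  set (K := (2 * M / (r * r))%R).
  assert (HK : forall w, (Cmod w <= r)%R ->
    (Cmod (f w - f z - g * (w - z)) <= K * (Cmod (w - z) * Cmod (w - z)))%R).
  { intros w Hw.
    set (d := Cmod (w - z)).
    assert (Hd : (0 <= d)%R) by apply Cmod_ge_0.
    assert (Hin : forall v, (Cmod v <= r)%R -> (Cmod v * rho < 1)%R) by (intros v Hv; nra).
    assert (C1 := Ccv_minus _ _ _ _ (Hf w (Hin w Hw)) (Hf z (Hin z (Rlt_le _ _ Hzr)))).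
    (* The partial sums of [f] run one term further than those of the derived series, whose index is
       lower by one. *)
    apply Ccv_incr in C1.
    assert (C2 := Ccv_minus _ _ _ _ C1 (Ccv_scal _ (w - z) _ Hg)).
    rewrite (Cmult_comm g).
    apply Ccv_norm_le with (1 := C2); intros n.
    apply Rle_trans with (K * (d * d) * (1 - (1 / 2) ^ n))%R.
    2: { assert (0 <= (1 / 2) ^ n)%R by (apply pow_le; lra).
         assert (0 <= K * (d * d))%R.
         { apply Rmult_le_pos; [|nra]. unfold K; apply Rmult_le_pos; [lra|].
           apply Rlt_le, Rinv_0_lt_compat; nra. }
         nra. }
    induction n as [|n IH].
    - simpl csum.
      match goal with |- (Cmod ?e <= _)%R => replace e with (RtoC 0) by (simpl; ring) end.
      rewrite Cmod_0; simpl; lra.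
    - change (csum (fun k => a k * w ^ k) (S (S n))) with
        (csum (fun k => a k * w ^ k) (S n) + a (S n) * w ^ S n).
      change (csum (fun k => a k * z ^ k) (S (S n))) with
        (csum (fun k => a k * z ^ k) (S n) + a (S n) * z ^ S n).
      change (csum (fun k => pser_derive a k * z ^ k) (S n)) with
        (csum (fun k => pser_derive a k * z ^ k) n + pser_derive a n * z ^ n).
      match type of IH with (Cmod ?e <= _)%R => set (E := e) in * end.
      match goal with |- (Cmod ?e <= _)%R => replace e with
        (E + a (S n) * (w ^ S n - z ^ S n - RtoC (INR (S n)) * z ^ n * (w - z)))
        by (unfold E, pser_derive; ring) end.
      eapply Rle_trans; [apply Cmod_triangle|]; rewrite Cmod_mult.
      assert (P := pow_second_order r z w n Hr (Rlt_le _ _ Hzr) Hw); fold d in P.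
      set (p := Cmod (w ^ S n - _ - _)) in *.
      assert (Hp : (0 <= p)%R) by apply Cmod_ge_0.
      assert (T : (Cmod (a (S n)) * p <= K * (d * d) * ((1 / 2) ^ S n))%R).
      { apply (Rmult_le_reg_l (r * r)); [nra|].
        unfold K; replace (r * r * (2 * M / (r * r) * (d * d) * (1 / 2) ^ S n))%R
          with (M * (d * d) * (1 / 2) ^ n)%R by (simpl; field; lra).
        apply Rle_trans with (M * rho ^ S n * (INR (S n) * INR (S n) * r ^ S n * (d * d)))%R.
        { replace (r * r * (Cmod (a (S n)) * p))%R with (Cmod (a (S n)) * (r * r * p))%R by ring.
          apply Rmult_le_compat; [apply Cmod_ge_0|nra|apply Ha|exact P]. }
        assert (N2 := INR_S_le_pow2 n); assert (N0 := pos_INR (S n)).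
        assert (Q : (rho ^ S n * r ^ S n = 1 / 8 * (1 / 8) ^ n)%R).
        { rewrite <- Rpow_mult_distr.
          replace (rho * r)%R with (1 / 8)%R by lra; reflexivity. }
        replace (M * rho ^ S n * (INR (S n) * INR (S n) * r ^ S n * (d * d)))%R
          with (M * (d * d) * (INR (S n) * INR (S n) * (rho ^ S n * r ^ S n)))%R by ring.
        apply Rmult_le_compat_l; [apply Rmult_le_pos; [exact HM|nra]|].
        rewrite Q.
        apply Rle_trans with (2 ^ n * 2 ^ n * (1 / 8 * (1 / 8) ^ n))%R.
        { assert (0 <= (1 / 8) ^ n)%R by (apply pow_le; lra).
          apply Rmult_le_compat_r; [lra|]; apply Rmult_le_compat; assumption. }
        replace (2 ^ n * 2 ^ n * (1 / 8 * (1 / 8) ^ n))%R with (1 / 8 * ((2 * 2 * (1 / 8)) ^ n))%R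
          by (rewrite !Rpow_mult_distr; ring).
        replace (2 * 2 * (1 / 8))%R with (1 / 2)%R by lra.
        assert (0 <= (1 / 2) ^ n)%R by (apply pow_le; lra); lra. }
      change ((1 / 2) ^ S n)%R with (1 / 2 * (1 / 2) ^ n)%R in T |- *; lra. }
  assert (HKp : (0 <= K)%R).
  { unfold K; apply Rmult_le_pos; [lra|]; apply Rlt_le, Rinv_0_lt_compat; nra. }
  intros eps Heps.
  exists (Rmin (r - Cmod z) (eps / (K + 1))); split.
  { apply Rmin_pos; [lra|apply Rdiv_lt_0_compat; lra]. }
  intros w Hw.
  assert (H1 := Rlt_le_trans _ _ _ Hw (Rmin_l _ _)).
  assert (H2 := Rlt_le_trans _ _ _ Hw (Rmin_r _ _)).
  assert (Hwr : (Cmod w <= r)%R).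
  { generalize (Cmod_triangle_inv w z); lra. }
  eapply Rle_trans; [apply HK, Hwr|].
  rewrite <- Rmult_assoc; apply Rmult_le_compat_r; [apply Cmod_ge_0|].
  apply Rle_trans with ((K + 1) * (eps / (K + 1)))%R; [|apply Req_le; field; lra].
  assert (0 <= Cmod (w - z))%R by apply Cmod_ge_0; nra.
Qed.

(** * Identity theorem *)

Lemma holomorphic_on_has_cderiv (U : C -> Prop) (E : C -> C) (z : C) :
  holomorphic_on U E -> U z -> exists d, has_cderiv E z d.
Proof. intros H Hz; destruct (H z Hz) as [d Hd]; exists d; now apply is_derive_has_cderiv. Qed.

Lemma holomorphic_on_expansion (U : C -> Prop) (E : C -> C) (z0 : C) :
  @open C_UniformSpace U -> holomorphic_on U E -> U z0 ->
  exists (a : nat -> C) (M rho : R), (0 < rho)%R /\ (forall k, (Cmod (a k) <= M * rho ^ k)%R) /\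
    forall z, (Cmod (z - z0) * rho < 1)%R -> is_pser a (z - z0) (E z).
Proof.
  intros HU HE Hz0.
  destruct (proj1 (open_Cmod U) HU z0 Hz0) as [r [Hr Hin]].
  apply cauchy_expansion with r; [exact Hr|]; intros w Hw.
  apply (holomorphic_on_has_cderiv U); [exact HE|now apply Hin].
Qed.

(** Points of [U] near which the difference vanishes identically form an open set [A]. Its
    complement [B] in [U] is open because zeros of a nontrivial power series are isolated, and
    connectedness then leaves [B] empty. *)
Lemma identity_theorem (U : C -> Prop) (E F : C -> C) (z0 : C) (r : R) :
  @open C_UniformSpace U -> connected_set U -> U z0 ->
  holomorphic_on U E -> holomorphic_on U F -> (0 < r)%R ->
  (forall z, Cmod (z - z0) < r -> E z = F z)%R -> forall z, U z -> E z = F z.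
Proof.
  intros HU Hc Hz0 HE HF Hr Heq z Hz.
  set (G := fun w => E w + (- (1)) * F w).
  assert (HG : holomorphic_on U G).
  { intros w Hw.
    destruct (holomorphic_on_has_cderiv U E w HE Hw) as [d Hd].
    destruct (holomorphic_on_has_cderiv U F w HF Hw) as [e He].
    exists (d + (- (1)) * e); apply is_derive_has_cderiv.
    now apply has_cderiv_plus, has_cderiv_scal. }
  set (Z := fun w => exists delta, (0 < delta)%R /\ forall v, (Cmod (v - w) < delta)%R -> G v = 0).
  set (A := fun w => U w /\ Z w).
  set (B := fun w => U w /\ ~ Z w).
  assert (HA : @open C_UniformSpace A).
  { apply open_Cmod; intros w [Hw [d [Hd HGd]]].
    destruct (proj1 (open_Cmod U) HU w Hw) as [d' [Hd' Hin]].
    exists (Rmin (d / 2) d'); split; [apply Rmin_pos; lra|]; intros v Hv.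
    assert (H1 := Rlt_le_trans _ _ _ Hv (Rmin_l _ _)).
    assert (H2 := Rlt_le_trans _ _ _ Hv (Rmin_r _ _)).
    split; [now apply Hin|]; exists (d / 2)%R; split; [lra|]; intros u Hu; apply HGd.
    generalize (Cmod_triangle_mid v u w); lra. }
  assert (HB : @open C_UniformSpace B).
  { apply open_Cmod; intros w [Hw HnZ].
    destruct (holomorphic_on_expansion U G w HU HG Hw) as [a [M [rho [Hrho [Ha Hs]]]]].
    (* If all coefficients at [w] vanished, the difference would be zero near [w], against [w] being
       in [B]. *)
    assert (Hex : exists k, a k <> 0).
    { apply NNPP; intros Hno; apply HnZ.
      exists (/ rho)%R; split; [now apply Rinv_0_lt_compat|]; intros v Hv.
      assert (Hv1 : (Cmod (v - w) * rho < 1)%R).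
      { replace 1%R with (/ rho * rho)%R by (field; lra); now apply Rmult_lt_compat_r. }
      apply Ccv_unique with (1 := Hs v Hv1).
      apply Ccv_ext with (fun _ => RtoC 0); [|apply Ccv_const].
      intros n; symmetry; apply csum_zero; intros k.
      replace (a k) with (RtoC 0); [ring|].
      apply NNPP; intros Hne; apply Hno; exists k; congruence. }
    destruct Hex as [k Hk]; destruct (first_nonzero a k Hk) as [m [Hm Hj]].
    destruct (pser_isolated_zero a M rho m Hrho Ha Hj Hm) as [d [Hd W]].
    destruct (proj1 (open_Cmod U) HU w Hw) as [d' [Hd' Hin]].
    assert (Hi : (0 < / rho)%R) by now apply Rinv_0_lt_compat.
    exists (Rmin (Rmin d (/ rho)) d'); split; [repeat apply Rmin_pos; lra|]; intros v Hv.
    assert (H1 := Rlt_le_trans _ _ _ Hv (Rmin_l _ _)).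
    assert (H2 := Rlt_le_trans _ _ _ Hv (Rmin_r _ _)).
    assert (H3 := Rlt_le_trans _ _ _ H1 (Rmin_l _ _)).
    assert (H4 := Rlt_le_trans _ _ _ H1 (Rmin_r _ _)).
    split; [now apply Hin|].
    destruct (Ceq_dec v w) as [->|Hne]; [exact HnZ|].
    intros [e [He HGe]].
    assert (Hv1 : (Cmod (v - w) * rho < 1)%R).
    { replace 1%R with (/ rho * rho)%R by (field; lra); now apply Rmult_lt_compat_r. }
    apply (W (v - w) (G v)); [now apply Cminus_eq_contra|exact H3|now apply Hs|].
    apply HGe; replace (v - v) with (RtoC 0) by ring; now rewrite Cmod_0. }
  assert (Hzero : Z z).
  { apply NNPP; intros HnZ.
    destruct (Hc A B HA HB) as [w [_ [[_ H1] [_ H2]]]]; [| | |exact (H2 H1)].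
    - intros w Hw; destruct (classic (Z w)); [left|right]; now split.
    - exists z0; repeat split; try exact Hz0; exists r; split; [exact Hr|]; intros v Hv.
      unfold G; rewrite (Heq v Hv); ring.
    - exists z; repeat split; assumption. }
  destruct Hzero as [d [Hd W]].
  assert (E0 : G z = 0) by (apply W; replace (z - z) with (RtoC 0) by ring; now rewrite Cmod_0).
  apply Ceq_minus; rewrite <- E0; unfold G; ring.
Qed.

(** Connectedness is tested along a line: a separation would make the indicator [phi] locally
    constant, hence continuous, with values 0 and 1 only, against the intermediate value 1/2. *)
Lemma whole_plane_neighborhood : zero_neighborhood whole_plane.
Proof.
  split; [intros z _; now exists (mkposreal _ Rlt_0_1)|]; split; [|exact I].
  intros A B HA HB Hcov [a [_ Ha]] [b [_ Hb]].
  apply NNPP; intros Hno.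
  assert (Hdis : forall z, A z -> B z -> False) by (intros z H1 H2; apply Hno; exists z; repeat split; auto).
  set (line := fun t : R => a + RtoC t * (b - a)).
  set (phi := fun t : R => if excluded_middle_informative (A (line t)) then 0%R else 1%R).
  assert (Hpos : (0 < 1 + Cmod (b - a))%R) by (generalize (Cmod_ge_0 (b - a)); lra).
  assert (Hline : forall t d, (0 < d)%R -> exists e, (0 < e)%R /\
    forall t', (Rabs (t' - t) < e)%R -> (Cmod (line t' - line t) < d)%R).
  { intros t d Hd; exists (d / (1 + Cmod (b - a)))%R; split; [now apply Rdiv_lt_0_compat|].
    intros t' Ht'; unfold line.
    replace (a + RtoC t' * (b - a) - (a + RtoC t * (b - a))) with (RtoC (t' - t) * (b - a))
      by (rewrite RtoC_minus; ring).
    rewrite Cmod_mult, Cmod_R.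
    apply Rle_lt_trans with (Rabs (t' - t) * (1 + Cmod (b - a)))%R.
    { apply Rmult_le_compat_l; [apply Rabs_pos|lra]. }
    replace d with (d / (1 + Cmod (b - a)) * (1 + Cmod (b - a)))%R by (field; lra).
    now apply Rmult_lt_compat_r. }
  assert (Hloc : forall t, exists e, (0 < e)%R /\
    forall t', (Rabs (t' - t) < e)%R -> phi t' = phi t).
  { intros t; unfold phi; destruct (excluded_middle_informative (A (line t))) as [HAt|HAt].
    - destruct (proj1 (open_Cmod A) HA _ HAt) as [d [Hd Hin]].
      destruct (Hline t d Hd) as [e [He W]]; exists e; split; [exact He|]; intros t' Ht'.
      destruct (excluded_middle_informative (A (line t'))) as [_|HN]; [reflexivity|].
      exfalso; apply HN, Hin, W, Ht'.
    - assert (HBt : B (line t)) by (destruct (Hcov (line t) I); [contradiction|assumption]).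
      destruct (proj1 (open_Cmod B) HB _ HBt) as [d [Hd Hin]].
      destruct (Hline t d Hd) as [e [He W]]; exists e; split; [exact He|]; intros t' Ht'.
      destruct (excluded_middle_informative (A (line t'))) as [HY|_]; [|reflexivity].
      exfalso; apply (Hdis (line t') HY), Hin, W, Ht'. }
  assert (Hcont : continuity phi).
  { intros t eps Heps; destruct (Hloc t) as [e [He W]]; exists e; split; [exact He|].
    intros t' [_ Ht']; simpl in *; unfold R_dist in *.
    rewrite (W t' Ht'), Rminus_diag, Rabs_R0; exact Heps. }
  assert (Hphi0 : phi 0%R = 0%R).
  { unfold phi; destruct (excluded_middle_informative (A (line 0%R))) as [_|HN]; [reflexivity|].
    exfalso; apply HN; unfold line; now replace (a + 0 * (b - a)) with a by ring. }
  assert (Hphi1 : phi 1%R = 1%R).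
  { unfold phi; destruct (excluded_middle_informative (A (line 1%R))) as [HY|_]; [|reflexivity].
    exfalso; apply (Hdis _ HY); unfold line; now replace (a + 1 * (b - a)) with b by ring. }
  destruct (IVT_gen phi 0 1 (1 / 2) Hcont) as [t [_ Ht]].
  { rewrite Hphi0, Hphi1, Rmin_left, Rmax_right; lra. }
  revert Ht; unfold phi; destruct (excluded_middle_informative _); lra.
Qed.

(** * The differential operator on Taylor coefficients *)

(** This is the coefficient of z^k in L F for F with coefficients [a]. The case k = 0 is separate
    since no lower coefficient feeds into it, and it is the only one that the constant c affects. *)
Definition heun_coef (n lam mu : C) (a : nat -> C) (k : nat) : C :=
  match k with
  | O => mu * a 1%nat + lam * a O
  | S j => mu * RtoC (INR (S (S j))) * a (S (S j))
           + (RtoC (INR (S j)) * (RtoC (INR j) + n) + lam) * a (S j)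
           - mu * (RtoC (INR j) + n) * a j
  end.

Lemma heun_coef_ext (n lam mu : C) (a b : nat -> C) (k : nat) :
  (forall j, a j = b j) -> heun_coef n lam mu a k = heun_coef n lam mu b k.
Proof. intros H; destruct k; simpl; now rewrite !H. Qed.

(** Termwise differentiation applies to [F] with rate [rho] and again to the derived series [g] with
    rate [2 * rho]; the radius loss by 8 in the second application explains the 16. *)
Lemma heun_L_pser (n lam mu : C) (a : nat -> C) (M rho : R) (F : C -> C) (z : C) :
  (0 < rho)%R -> (forall k, Cmod (a k) <= M * rho ^ k)%R ->
  (forall w, (Cmod w * rho < 1)%R -> is_pser a w (F w)) ->
  (Cmod z * (16 * rho) < 1)%R ->
  is_pser (heun_coef n lam mu a) z (heun_L n lam mu F z) /\ exists d, has_cderiv F z d.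
Proof.
  intros Hrho Ha HF Hz.
  assert (Ha1 := pser_derive_bound a M rho ltac:(lra) Ha).
  assert (Ha2 := pser_derive_bound _ _ (2 * rho) ltac:(lra) Ha1).
  set (g := fun w => epsilon (inhabits (RtoC 0)) (is_pser (pser_derive a) w)).
  assert (Hg : forall w, (Cmod w * (2 * rho) < 1)%R -> is_pser (pser_derive a) w (g w)).
  { intros w Hw; apply epsilon_spec, is_pser_ex with (M * rho)%R (2 * rho)%R; [lra|exact Ha1|exact Hw]. }
  assert (HFd : forall w, (Cmod w * (8 * rho) < 1)%R -> has_cderiv F w (g w)).
  { intros w Hw; apply is_pser_has_cderiv with a M rho; try assumption.
    apply Hg; generalize (Cmod_ge_0 w); nra. }
  destruct (is_pser_ex _ _ (2 * (2 * rho)) z ltac:(lra) Ha2) as [g2 Hg2].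
  { generalize (Cmod_ge_0 z); nra. }
  assert (Hgd : has_cderiv g z g2).
  { apply is_pser_has_cderiv with (pser_derive a) (M * rho)%R (2 * rho)%R; try assumption; lra. }
  assert (Hz8 : (Cmod z * (8 * rho) < 1)%R) by (generalize (Cmod_ge_0 z); nra).
  assert (E1 : C_derive F z = g z) by (apply has_cderiv_C_derive; now apply HFd).
  (* The second derivative is taken of the function [C_derive F], which must be identified with [g]
     on a whole disc around [z], here up to radius 1/(8 rho) about 0. *)
  assert (E2 : C_derive (C_derive F) z = g2).
  { apply has_cderiv_C_derive, has_cderiv_ext_loc with g (/ (8 * rho) - Cmod z)%R; [| |exact Hgd].
    - apply Rlt_0_minus; apply (Rmult_lt_reg_r (8 * rho)); [lra|]; rewrite Rinv_l; lra.
    - intros w Hw; symmetry; apply has_cderiv_C_derive, HFd.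
      assert (Hw1 : (Cmod w < / (8 * rho))%R) by (generalize (Cmod_triangle_inv w z); lra).
      apply (Rmult_lt_compat_r (8 * rho)) in Hw1; [|lra]; rewrite Rinv_l in Hw1; lra. }
  split; [|exists (g z); now apply HFd].
  assert (P0 := HF z ltac:(generalize (Cmod_ge_0 z); nra)).
  assert (P1 := Hg z ltac:(generalize (Cmod_ge_0 z); nra)).
  unfold heun_L; rewrite E1, E2.
  replace (z ^ 2 * g2 + (n * z + mu * (1 - z ^ 2)) * g z + (lam - mu * n * z) * F z)
    with (z * (z * g2) + n * (z * g z) + mu * g z + (- mu) * (z * (z * g z)) + lam * F z
          + (- mu * n) * (z * F z)) by ring.
  eapply is_pser_ext; [|repeat apply is_pser_plus].
  2: apply is_pser_shift, is_pser_shift, Hg2.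
  2: apply is_pser_scal, is_pser_shift, P1.
  2: apply is_pser_scal, P1.
  2: apply is_pser_scal, is_pser_shift, is_pser_shift, P1.
  2: apply is_pser_scal, P0.
  2: apply is_pser_scal, is_pser_shift, P0.
  intros [|[|k]]; simpl pser_shift; unfold pser_derive, heun_coef.
  - simpl; ring.
  - simpl INR; rewrite RtoC_plus; ring.
  - rewrite !S_INR, !RtoC_plus; ring.
Qed.

(** * The minimal solution of the recurrence *)

(** The pair approximates (b_k, b_(k+1)) when the recursion starts from the value 1 at the indices k
    + m and k + m + 1. *)
Fixpoint backward (al be : nat -> C) (k m : nat) : C * C :=
  match m with
  | O => (RtoC 1, RtoC 1)
  | S m' => let p := backward al be (S k) m' in
            ((1 + al k) * fst p + be k * snd p, fst p)
  end.

(** A total limit with an unspecified value for divergent sequences, so that the solution is defined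
    for all parameters before convergence is discussed. *)
Definition Clim (u : nat -> C) : C := epsilon (inhabits (RtoC 0)) (Ccv u).

Lemma Clim_correct (u : nat -> C) : (exists l, Ccv u l) -> Ccv u (Clim u).
Proof. exact (epsilon_spec (inhabits (RtoC 0)) (Ccv u)). Qed.

Definition minimal_solution (al be : nat -> C) (k : nat) : C :=
  Clim (fun m => fst (backward al be k m)).

Lemma is_series_nonneg_partial (f : nat -> R) (l : R) :
  (forall k, 0 <= f k)%R -> is_series f l -> forall n, (sum_n f n <= l)%R.
Proof.
  intros Hf Hl n; apply (is_lim_seq_incr_compare (sum_n f) l Hl).
  intros m; rewrite sum_Sn; unfold plus; simpl; generalize (Hf (S m)); lra.
Qed.

Lemma ex_series_inv_sqr : ex_series (fun m => / (INR (S m) * INR (S m)))%R.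
Proof.
  apply (ex_series_le (V := R_CompleteNormedModule) _
    (fun m => 2 * (/ INR (S m) - / INR (S (S m))))%R).
  - intros m; change (Rabs (/ (INR (S m) * INR (S m))) <= 2 * (/ INR (S m) - / INR (S (S m))))%R.
    assert (Hm : (1 <= INR (S m))%R) by (rewrite S_INR; generalize (pos_INR m); lra).
    rewrite Rabs_right by (apply Rle_ge, Rlt_le, Rinv_0_lt_compat; nra).
    rewrite (S_INR (S m)); set (t := INR (S m)) in *.
    apply (Rmult_le_reg_r (t * t * (t + 1))); [repeat apply Rmult_lt_0_compat; lra|].
    replace (/ (t * t) * (t * t * (t + 1)))%R with (t + 1)%R by (field; lra).
    replace (2 * (/ t - / (t + 1)) * (t * t * (t + 1)))%R with (2 * t)%R by (field; lra); lra.
  - apply (ex_series_scal (V := R_NormedModule) 2%R); exists 1%R.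
    change (is_lim_seq (sum_n (fun m => / INR (S m) - / INR (S (S m)))%R) 1%R).
    apply is_lim_seq_ext with (fun n => (1 - / INR (S (S n)))%R).
    + intros n; induction n as [|n IH].
      * rewrite sum_O; simpl; field.
      * rewrite sum_Sn, <- IH; unfold plus; simpl AbelianMonoid.plus; simpl plus.
        change ((1 - / INR (S (S (S n)))) =
          (1 - / INR (S (S n))) + (/ INR (S (S n)) - / INR (S (S (S n)))))%R; ring.
    + replace (Finite 1) with (Finite (1 - 0)) by (f_equal; ring).
      apply is_lim_seq_minus'; [apply is_lim_seq_const|].
      apply (is_lim_seq_inv (fun n => INR (S (S n))) p_infty); [|discriminate].
      apply is_lim_seq_ext with (fun n => INR (n + 2)); [intros n; f_equal; lia|].
      apply -> (is_lim_seq_incr_n INR 2); exact is_lim_seq_INR.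
Qed.

Lemma exp_le_compat (x y : R) : (x <= y)%R -> (exp x <= exp y)%R.
Proof. intros [H| ->]; [now apply Rlt_le, exp_increasing|apply Rle_refl]. Qed.

Section Backward.
Context (al be : nat -> C) (c : R) (Hc : (0 <= c)%R).
Context (Hal : forall k, (Cmod (al k) <= c / (INR (S k) * INR (S k)))%R).
Context (Hbe : forall k, (Cmod (be k) <= c / (INR (S k) * INR (S k)))%R).

(** It is a supersolution of the recursion for moduli and tends to 1, so it bounds the iterates and
    [growth k - 1] bounds their distance to 1. *)
Let growth (k : nat) : R := exp (4 * c / INR (S k)).

Lemma INR_S_ge1 (k : nat) : (1 <= INR (S k))%R.
Proof. rewrite S_INR; generalize (pos_INR k); lra. Qed.

(* The telescoping bound 1/(k+1)^2 <= 2/(k+1) - 2/(k+2) makes [growth] absorb one step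
   of the recursion. *)
Lemma growth_step (k : nat) :
  ((1 + 2 * (c / (INR (S k) * INR (S k)))) * growth (S k) <= growth k)%R.
Proof using Hc.
  assert (Hk := INR_S_ge1 k).
  unfold growth; rewrite (S_INR (S k)); set (t := INR (S k)) in *.
  eapply Rle_trans.
  { apply Rmult_le_compat_r; [apply Rlt_le, exp_pos|apply exp_ineq1_le]. }
  rewrite <- exp_plus; apply exp_le_compat.
  apply (Rmult_le_reg_r (t * t * (t + 1))); [repeat apply Rmult_lt_0_compat; lra|].
  replace ((2 * (c / (t * t)) + 4 * c / (t + 1)) * (t * t * (t + 1)))%R
    with (c * (2 * (t + 1) + 4 * (t * t)))%R by (field; lra).
  replace (4 * c / t * (t * t * (t + 1)))%R with (c * (4 * t * (t + 1)))%R by (field; lra).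
  apply Rmult_le_compat_l; [exact Hc|nra].
Qed.

Lemma growth_ge1 (k : nat) : (1 <= growth k)%R.
Proof using Hc.
  unfold growth; rewrite <- exp_0 at 1; apply exp_le_compat.
  apply Rmult_le_pos; [lra|]; apply Rlt_le, Rinv_0_lt_compat; generalize (INR_S_ge1 k); lra.
Qed.

Lemma growth_mono (k : nat) : (growth (S k) <= growth k)%R.
Proof using Hc.
  eapply Rle_trans; [|apply growth_step].
  assert (H := growth_ge1 (S k)).
  assert (0 <= c / (INR (S k) * INR (S k)))%R; [|nra].
  apply Rmult_le_pos; [exact Hc|]; apply Rlt_le, Rinv_0_lt_compat; generalize (INR_S_ge1 k); nra.
Qed.

Lemma growth_le0 (k : nat) : (growth k <= growth 0)%R.
Proof using Hc. induction k as [|k IH]; [lra|generalize (growth_mono k); lra]. Qed.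

Lemma backward_step_bound (k : nat) (p q : C) (B : R) :
  (Cmod p <= B)%R -> (Cmod q <= B)%R ->
  (Cmod ((1 + al k) * p + be k * q) <= (1 + 2 * (c / (INR (S k) * INR (S k)))) * B)%R.
Proof using Hal Hbe.
  intros Hp Hq; set (e := (c / (INR (S k) * INR (S k)))%R).
  replace ((1 + al k) * p + be k * q) with (p + (al k * p + be k * q)) by ring.
  eapply Rle_trans; [apply Cmod_triangle|].
  eapply Rle_trans; [apply Rplus_le_compat_l, Cmod_triangle|]; rewrite !Cmod_mult.
  assert (H1 : (Cmod (al k) * Cmod p <= e * B)%R)
    by (apply Rmult_le_compat; auto; try apply Cmod_ge_0; apply Hal).
  assert (H2 : (Cmod (be k) * Cmod q <= e * B)%R)
    by (apply Rmult_le_compat; auto; try apply Cmod_ge_0; apply Hbe).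
  lra.
Qed.

Lemma backward_bound (m k : nat) :
  (Cmod (fst (backward al be k m)) <= growth k /\ Cmod (snd (backward al be k m)) <= growth k)%R.
Proof using Hal Hbe Hc.
  revert k; induction m as [|m IH]; intros k; simpl.
  - rewrite Cmod_1; generalize (growth_ge1 k); lra.
  - destruct (IH (S k)) as [H1 H2]; split; [|generalize (growth_mono k); lra].
    eapply Rle_trans; [|apply growth_step]; now apply backward_step_bound.
Qed.

(** Each step changes the value by at most 2 c/(k+1)^2 times [growth (S k)], which is within the
    drop of [growth] over that step. *)
Lemma backward_near_one (m k : nat) :
  (Cmod (fst (backward al be k m) - 1) <= growth k - 1 /\
   Cmod (snd (backward al be k m) - 1) <= growth k - 1)%R.
Proof using Hal Hbe Hc.
  revert k; induction m as [|m IH]; intros k; simpl.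
  - replace (RtoC 1 - 1) with (RtoC 0) by ring; rewrite Cmod_0; generalize (growth_ge1 k); lra.
  - destruct (IH (S k)) as [H1 _]; split; [|generalize (growth_mono k); lra].
    destruct (backward_bound m (S k)) as [H2 H3].
    set (p := fst _) in *; set (q := snd _) in *.
    replace ((1 + al k) * p + be k * q - 1) with ((p - 1) + (al k * p + be k * q)) by ring.
    set (e := (c / (INR (S k) * INR (S k)))%R).
    assert (G := growth_step k); fold e in G.
    eapply Rle_trans; [apply Cmod_triangle|].
    eapply Rle_trans; [apply Rplus_le_compat_l, Cmod_triangle|]; rewrite !Cmod_mult.
    assert (H4 : (Cmod (al k) * Cmod p <= e * growth (S k))%R)
      by (apply Rmult_le_compat; auto; try apply Cmod_ge_0; apply Hal).
    assert (H5 : (Cmod (be k) * Cmod q <= e * growth (S k))%R)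
      by (apply Rmult_le_compat; auto; try apply Cmod_ge_0; apply Hbe).
    lra.
Qed.

(** Starting one index later changes the starting data by O(1/(k+m+1)^2). By linearity this
    discrepancy obeys the same recursion and is amplified by at most [growth k]. *)
Lemma backward_increment (m k : nat) :
  let D := (2 * (c / (INR (S (k + m)) * INR (S (k + m)))) * growth k)%R in
  (Cmod (fst (backward al be k (S m)) - fst (backward al be k m)) <= D /\
   Cmod (snd (backward al be k (S m)) - snd (backward al be k m)) <= D)%R.
Proof using Hal Hbe Hc.
  assert (Hpos : forall j, (0 <= c / (INR (S j) * INR (S j)))%R).
  { intros j; apply Rmult_le_pos; [exact Hc|].
    apply Rlt_le, Rinv_0_lt_compat; generalize (INR_S_ge1 j); nra. }
  revert k; induction m as [|m IH]; intros k.
  - simpl backward; cbv zeta; unfold fst, snd; rewrite Nat.add_0_r.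
    set (e := (c / (INR (S k) * INR (S k)))%R).
    assert (He : (0 <= e)%R) by apply Hpos.
    assert (H := growth_ge1 k); split.
    + replace ((1 + al k) * 1 + be k * 1 - 1) with (al k + be k) by ring.
      eapply Rle_trans; [apply Cmod_triangle|].
      generalize (Hal k) (Hbe k); fold e; nra.
    + replace (RtoC 1 - 1) with (RtoC 0) by ring; rewrite Cmod_0; nra.
  - destruct (IH (S k)) as [H1 H2].
    replace (S k + m)%nat with (k + S m)%nat in H1, H2 by lia.
    set (e := (c / (INR (S (k + S m)) * INR (S (k + S m))))%R) in *.
    assert (He : (0 <= e)%R) by apply Hpos.
    cbv zeta in *.
    change (backward al be k (S (S m))) with
      ((1 + al k) * fst (backward al be (S k) (S m)) + be k * snd (backward al be (S k) (S m)),
       fst (backward al be (S k) (S m))).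
    change (backward al be k (S m)) with
      ((1 + al k) * fst (backward al be (S k) m) + be k * snd (backward al be (S k) m),
       fst (backward al be (S k) m)).
    unfold fst at 1 4, snd at 4 6.
    cbn [fst snd].
    set (p := fst (backward al be (S k) m)) in *; set (q := snd (backward al be (S k) m)) in *.
    set (p' := fst (backward al be (S k) (S m))) in *; set (q' := snd (backward al be (S k) (S m))) in *.
    assert (G1 := growth_step k); assert (G2 := growth_mono k).
    split; [|nra].
    replace ((1 + al k) * p' + be k * q' - ((1 + al k) * p + be k * q))
      with ((1 + al k) * (p' - p) + be k * (q' - q)) by ring.
    eapply Rle_trans; [apply backward_step_bound; [exact H1|exact H2]|]; nra.
Qed.

Lemma backward_cv (k : nat) :
  Ccv (fun m => fst (backward al be k m)) (minimal_solution al be k).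
Proof using Hal Hbe Hc.
  apply Clim_correct, Ccv_summable with
    (fun m => 2 * c * growth k * / (INR (S m) * INR (S m)))%R.
  - apply (ex_series_scal (V := R_NormedModule)), ex_series_inv_sqr.
  - intros m; eapply Rle_trans; [apply backward_increment|].
    replace (2 * (c / (INR (S (k + m)) * INR (S (k + m)))) * growth k)%R
      with (2 * c * growth k * / (INR (S (k + m)) * INR (S (k + m))))%R by (unfold Rdiv; ring).
    assert (G := growth_ge1 k); assert (K := INR_S_ge1 m).
    assert (L : (INR (S m) <= INR (S (k + m)))%R) by (apply le_INR; lia).
    apply Rmult_le_compat_l; [repeat apply Rmult_le_pos; lra|].
    apply Rinv_le_contravar; nra.
Qed.

Lemma minimal_solution_rec (k : nat) :
  minimal_solution al be k =
    (1 + al k) * minimal_solution al be (S k) + be k * minimal_solution al be (S (S k)).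
Proof using Hal Hbe Hc.
  (* A run of m + 2 steps ending at k contains the run of m + 1 steps ending at k + 1 and the run of
     m steps ending at k + 2, hence two shifts. *)
  assert (H := proj1 (Ccv_incr _ _) (proj1 (Ccv_incr _ _) (backward_cv k))).
  apply Ccv_unique with (1 := H).
  apply Ccv_ext with (fun m => (1 + al k) * fst (backward al be (S k) (S m))
    + be k * fst (backward al be (S (S k)) m)); [intros m; reflexivity|].
  apply Ccv_plus; apply Ccv_scal; [|apply backward_cv].
  exact (proj1 (Ccv_incr _ _) (backward_cv (S k))).
Qed.

Lemma minimal_solution_bound (k : nat) : (Cmod (minimal_solution al be k) <= exp (4 * c))%R.
Proof using Hal Hbe Hc.
  apply Ccv_norm_le with (1 := backward_cv k); intros m.
  eapply Rle_trans; [apply backward_bound|].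
  eapply Rle_trans; [apply growth_le0|].
  unfold growth; simpl; rewrite Rdiv_1_r; lra.
Qed.

(** Beyond index 8 c one has [growth k] < exp(1/2) < 2, since exp(1) <= 3 < 4, so the value is at
    distance less than 1 from 1. *)
Lemma minimal_solution_nonzero : exists k, minimal_solution al be k <> 0.
Proof using Hal Hbe Hc.
  destruct (INR_unbounded (8 * c)) as [k Hk]; exists k.
  assert (H : (Cmod (minimal_solution al be k - 1) <= growth k - 1)%R).
  { apply Ccv_bound with (1 := backward_cv k); intros m; apply backward_near_one. }
  intros E; rewrite E in H.
  replace (0 - 1) with (- (RtoC 1)) in H by ring; rewrite Cmod_opp, Cmod_1 in H.
  assert (Hs : (4 * c / INR (S k) < / 2)%R).
  { assert (Hk1 := INR_S_ge1 k); apply (Rmult_lt_reg_r (INR (S k))); [lra|].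
    unfold Rdiv; rewrite Rmult_assoc, Rinv_l, S_INR by lra; lra. }
  assert (G : (growth k < exp (/ 2))%R) by now apply exp_increasing.
  assert (E2 : (exp (/ 2) * exp (/ 2) = exp 1)%R) by (rewrite <- exp_plus; f_equal; field).
  assert (E3 := exp_le_3).
  assert (P := exp_pos (/ 2)); nra.
Qed.

End Backward.

Lemma pow_div_fact_le_exp (y : R) (n : nat) : (0 <= y)%R ->
  (sum_n (fun k => y ^ k / INR (Factorial.fact k)) n <= exp y)%R.
Proof.
  intros Hy; apply is_series_nonneg_partial.
  - intros k; apply Rmult_le_pos; [now apply pow_le|].
    apply Rlt_le, Rinv_0_lt_compat, INR_fact_lt_0.
  - eapply is_series_ext; [|exact (is_exp_Reals y)].
    intros k; rewrite pow_n_pow; reflexivity.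
Qed.

(** * Holomorphy of limits *)

(* First-order Taylor expansion with an explicit second-order remainder.  Unlike mere
   differentiability, a bound [A] uniform in a sequence survives pointwise limits. *)
Definition jet (V : NormedModule C_AbsRing) (x : V) (r A : R) (f : V -> C) : Prop :=
  exists l : V -> C,
    (forall h k, l (plus h k) = l h + l k) /\ (forall a h, l (scal a h) = a * l h) /\
    (Cmod (f x) <= A)%R /\ (forall h, Cmod (l h) <= A * norm h)%R /\
    (forall h, norm h <= r -> Cmod (f (plus x h) - f x - l h) <= A * (norm h * norm h))%R.
Arguments jet {V} x r A f.

Section Jets.
Context {V : NormedModule C_AbsRing} (x : V) (r : R) (Hr : (0 < r <= 1)%R).

Lemma jet_nonneg (A : R) (f : V -> C) : jet x r A f -> (0 <= A)%R.
Proof. intros [l [_ [_ [H _]]]]; generalize (Cmod_ge_0 (f x)); lra. Qed.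

Lemma jet_weaken (A B : R) (f : V -> C) : (A <= B)%R -> jet x r A f -> jet x r B f.
Proof.
  intros HAB [l [H1 [H2 [H3 [H4 H5]]]]]; exists l; repeat split; auto; [lra| |].
  - intros h; eapply Rle_trans; [apply H4|]; apply Rmult_le_compat_r; [apply norm_ge_0|exact HAB].
  - intros h Hh; eapply Rle_trans; [now apply H5|]; apply Rmult_le_compat_r; [|exact HAB].
    generalize (norm_ge_0 h); nra.
Qed.

Lemma jet_ext (A : R) (f g : V -> C) : (forall v, f v = g v) -> jet x r A f -> jet x r A g.
Proof.
  intros E [l [H1 [H2 [H3 [H4 H5]]]]]; exists l; repeat split; auto.
  - now rewrite <- E.
  - intros h Hh; rewrite <- !E; now apply H5.
Qed.

Lemma jet_const (c : C) : jet x r (Cmod c) (fun _ => c).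
Proof.
  exists (fun _ => RtoC 0); repeat split.
  - intros; ring.
  - intros; ring.
  - lra.
  - intros h; rewrite Cmod_0; apply Rmult_le_pos; [apply Cmod_ge_0|apply norm_ge_0].
  - intros h _; replace (c - c - 0) with (RtoC 0) by ring; rewrite Cmod_0.
    apply Rmult_le_pos; [apply Cmod_ge_0|]; generalize (norm_ge_0 h); nra.
Qed.

Lemma jet_plus (A B : R) (f g : V -> C) :
  jet x r A f -> jet x r B g -> jet x r (A + B) (fun v => f v + g v).
Proof.
  intros [l [H1 [H2 [H3 [H4 H5]]]]] [m [K1 [K2 [K3 [K4 K5]]]]].
  exists (fun h => l h + m h); repeat split.
  - intros h k; rewrite H1, K1; ring.
  - intros a h; rewrite H2, K2; ring.
  - eapply Rle_trans; [apply Cmod_triangle|lra].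
  - intros h; eapply Rle_trans; [apply Cmod_triangle|].
    generalize (H4 h) (K4 h); lra.
  - intros h Hh.
    replace (f (plus x h) + g (plus x h) - (f x + g x) - (l h + m h))
      with ((f (plus x h) - f x - l h) + (g (plus x h) - g x - m h)) by ring.
    eapply Rle_trans; [apply Cmod_triangle|].
    generalize (H5 h Hh) (K5 h Hh); lra.
Qed.

(** Expanding the product leaves six error terms, each at most A B |h|^2 because |h| <= r <= 1. *)
Lemma jet_mult (A B : R) (f g : V -> C) :
  jet x r A f -> jet x r B g -> jet x r (6 * A * B) (fun v => f v * g v).
Proof using Hr.
  intros Jf Jg; assert (HA := jet_nonneg _ _ Jf); assert (HB := jet_nonneg _ _ Jg).
  destruct Jf as [l [H1 [H2 [H3 [H4 H5]]]]], Jg as [m [K1 [K2 [K3 [K4 K5]]]]].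
  assert (HAB : (0 <= A * B)%R) by now apply Rmult_le_pos.
  exists (fun h => l h * g x + f x * m h); repeat split.
  - intros h k; rewrite H1, K1; ring.
  - intros a h; rewrite H2, K2; ring.
  - rewrite Cmod_mult; apply Rle_trans with (A * B)%R; [|lra].
    apply Rmult_le_compat; try apply Cmod_ge_0; assumption.
  - intros h; eapply Rle_trans; [apply Cmod_triangle|]; rewrite !Cmod_mult.
    assert (N := norm_ge_0 h).
    assert (T1 : (Cmod (l h) * Cmod (g x) <= A * norm h * B)%R)
      by (apply Rmult_le_compat; try apply Cmod_ge_0; auto).
    assert (T2 : (Cmod (f x) * Cmod (m h) <= A * (B * norm h))%R)
      by (apply Rmult_le_compat; try apply Cmod_ge_0; auto).
    nra.
  - intros h Hh.
    set (e := f (plus x h) - f x - l h); set (d := g (plus x h) - g x - m h).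
    assert (N := norm_ge_0 h); set (t := norm h) in *.
    assert (He : (Cmod e <= A * (t * t))%R) by now apply H5.
    assert (Hd : (Cmod d <= B * (t * t))%R) by now apply K5.
    assert (Hl : (Cmod (l h) <= A * t)%R) by apply H4.
    assert (Hm : (Cmod (m h) <= B * t)%R) by apply K4.
    replace (f (plus x h) * g (plus x h) - f x * g x - (l h * g x + f x * m h))
      with (e * g x + f x * d + (l h * m h + (l h * d + (e * m h + e * d))))
      by (unfold e, d; ring).
    assert (Ht : (0 <= t * t)%R) by nra.
    assert (Ht2 : (t * t <= 1)%R) by nra.
    assert (X : (0 <= A * B * (t * t))%R) by (apply Rmult_le_pos; assumption).
    assert (T1 : (Cmod (e * g x) <= A * B * (t * t))%R).
    { rewrite Cmod_mult; replace (A * B * (t * t))%R with (A * (t * t) * B)%R by ring.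
      apply Rmult_le_compat; try apply Cmod_ge_0; assumption. }
    assert (T2 : (Cmod (f x * d) <= A * B * (t * t))%R).
    { rewrite Cmod_mult; replace (A * B * (t * t))%R with (A * (B * (t * t)))%R by ring.
      apply Rmult_le_compat; try apply Cmod_ge_0; assumption. }
    assert (T3 : (Cmod (l h * m h) <= A * B * (t * t))%R).
    { rewrite Cmod_mult; replace (A * B * (t * t))%R with (A * t * (B * t))%R by ring.
      apply Rmult_le_compat; try apply Cmod_ge_0; assumption. }
    assert (T4 : (Cmod (l h * d) <= A * B * (t * t) * t)%R).
    { rewrite Cmod_mult; replace (A * B * (t * t) * t)%R with (A * t * (B * (t * t)))%R by ring.
      apply Rmult_le_compat; try apply Cmod_ge_0; assumption. }
    assert (T5 : (Cmod (e * m h) <= A * B * (t * t) * t)%R).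
    { rewrite Cmod_mult; replace (A * B * (t * t) * t)%R with (A * (t * t) * (B * t))%R by ring.
      apply Rmult_le_compat; try apply Cmod_ge_0; assumption. }
    assert (T6 : (Cmod (e * d) <= A * B * (t * t) * (t * t))%R).
    { rewrite Cmod_mult.
      replace (A * B * (t * t) * (t * t))%R with (A * (t * t) * (B * (t * t)))%R by ring.
      apply Rmult_le_compat; try apply Cmod_ge_0; assumption. }
    set (Y := (A * B * (t * t))%R) in *.
    replace (6 * A * B * (t * t))%R with (6 * Y)%R by (unfold Y; ring).
    assert (Y * t <= Y)%R by nra. assert (Y * (t * t) <= Y)%R by nra.
    eapply Rle_trans; [apply Cmod_triangle|].
    eapply Rle_trans; [apply Rplus_le_compat_r, Cmod_triangle|].
    eapply Rle_trans; [apply Rplus_le_compat_l, Cmod_triangle|].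
    eapply Rle_trans; [apply Rplus_le_compat_l, Rplus_le_compat_l, Cmod_triangle|].
    eapply Rle_trans; [apply Rplus_le_compat_l, Rplus_le_compat_l, Rplus_le_compat_l, Cmod_triangle|].
    lra.
Qed.

Lemma norm_scal_C (a : C) (h : V) : (norm (scal a h) <= Cmod a * norm h)%R.
Proof. exact (norm_scal (K := C_AbsRing) a h). Qed.

(* The difference of the linear parts of two members of the sequence is controlled by the
   difference of their values at x + t h, up to an error of order t: hence they converge. *)
Lemma jet_lim (A : R) (u : nat -> V -> C) (f : V -> C) :
  (forall n, jet x r A (u n)) ->
  (forall h, norm h <= r -> Ccv (fun n => u n (plus x h)) (f (plus x h)))%R -> jet x r A f.
Proof using Hr.
  intros Hu Hcv.
  assert (HA := jet_nonneg _ _ (Hu O)).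
  assert (Hx : Ccv (fun n => u n x) (f x)).
  { rewrite <- (plus_zero_r x); apply Hcv; rewrite norm_zero; lra. }
  set (l := fun n => proj1_sig (constructive_indefinite_description _ (Hu n))).
  assert (Hl : forall n, _) by
    exact (fun n => proj2_sig (constructive_indefinite_description _ (Hu n))).
  fold l in Hl; change (forall n, (forall h k, l n (plus h k) = l n h + l n k) /\
    (forall a h, l n (scal a h) = a * l n h) /\
    (Cmod (u n x) <= A)%R /\ (forall h, Cmod (l n h) <= A * norm h)%R /\
    (forall h, norm h <= r -> Cmod (u n (plus x h) - u n x - l n h) <= A * (norm h * norm h))%R) in Hl.
  assert (Hlim : forall h, exists L, Ccv (fun n => l n h) L).
  { intros h.
    assert (Hcauchy : forall eps, (0 < eps)%R -> exists N, forall n m, (N <= n)%nat -> (N <= m)%nat ->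
      (Cmod (l n h - l m h) < eps)%R).
    { intros eps Heps.
      assert (Nh := norm_ge_0 h).
      (* [D] dominates [norm h] and both remainders: [t * D <= r] brings x + t h into range, and
         [t * D <= eps / 2] controls the remainders after division by [t]. *)
      set (D := (2 * A * (norm h * norm h) + norm h + 1)%R).
      assert (HD : (0 < D)%R).
      { assert (0 <= A * (norm h * norm h))%R by (apply Rmult_le_pos; nra); unfold D; lra. }
      set (t := Rmin (r / D) (eps / (2 * D))).
      assert (Ht : (0 < t)%R) by (apply Rmin_pos; apply Rdiv_lt_0_compat; lra).
      assert (Ht1 : (t * D <= r)%R).
      { replace r with (r / D * D)%R at 1 by (field; lra).
        apply Rmult_le_compat_r; [lra|apply Rmin_l]. }
      assert (Ht2 : (t * D <= eps / 2)%R).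
      { replace (eps / 2)%R with (eps / (2 * D) * D)%R by (field; lra).
        apply Rmult_le_compat_r; [lra|apply Rmin_r]. }
      set (k := scal (RtoC t : C_AbsRing) h).
      assert (Hk : (norm k <= t * norm h)%R).
      { eapply Rle_trans; [apply norm_scal_C|].
        rewrite Cmod_R, Rabs_right by lra; lra. }
      assert (Nk := norm_ge_0 k).
      assert (HAh : (0 <= A * (norm h * norm h))%R) by (apply Rmult_le_pos; nra).
      assert (Hkr : (norm k <= r)%R).
      { eapply Rle_trans; [exact Hk|]; eapply Rle_trans; [|exact Ht1].
        apply Rmult_le_compat_l; unfold D; lra. }
      assert (Hc := Ccv_minus _ _ _ _ (Hcv k Hkr) Hx).
      apply is_lim_seq_spec in Hc.
      assert (He : (0 < t * (eps / 8))%R) by (apply Rmult_lt_0_compat; lra).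
      destruct (Hc (mkposreal _ He)) as [N HN]; exists N; simpl in HN.
      (* Every late linear part is compared with one and the same increment of the limit function,
         so two of them are close to each other. *)
      assert (Hone : forall n, (N <= n)%nat ->
        (Cmod (RtoC t * l n h - (f (plus x k) - f x)) < t * (eps / 8) + A * (norm k * norm k))%R).
      { intros n Hn; specialize (HN n Hn); rewrite Rminus_0_r, Rabs_right in HN
          by (apply Rle_ge, Cmod_ge_0).
        destruct (Hl n) as [_ [L2 [_ [_ L5]]]]; specialize (L5 k Hkr).
        unfold k in L5 at 2; rewrite L2 in L5.
        rewrite Cmod_sym in L5.
        generalize (Cmod_triangle_mid (u n (plus x k) - u n x) (RtoC t * l n h) (f (plus x k) - f x)).
        lra. }
      intros n m Hn Hm.
      assert (Hn1 := Hone n Hn); assert (Hm1 := Hone m Hm).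
      assert (Hsum : (t * Cmod (l n h - l m h) < t * eps)%R).
      { replace (t * Cmod (l n h - l m h))%R with (Cmod (RtoC t * l n h - RtoC t * l m h)).
        2: { replace (RtoC t * l n h - RtoC t * l m h) with (RtoC t * (l n h - l m h)) by ring.
             rewrite Cmod_mult, Cmod_R, Rabs_right by lra; reflexivity. }
        eapply Rle_lt_trans; [apply (Cmod_triangle_mid (f (plus x k) - f x))|].
        rewrite (Cmod_sym (f (plus x k) - f x)).
        assert (Hkk : (A * (norm k * norm k) <= t * (t * (A * (norm h * norm h))))%R).
        { replace (t * (t * (A * (norm h * norm h))))%R
            with (A * ((t * norm h) * (t * norm h)))%R by ring.
          apply Rmult_le_compat_l; [exact HA|]; apply Rmult_le_compat; assumption. }
        assert (HtA : (t * (2 * (A * (norm h * norm h))) <= eps / 2)%R).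
        { eapply Rle_trans; [|exact Ht2]; apply Rmult_le_compat_l; unfold D; lra. }
        assert (t * (t * (2 * (A * (norm h * norm h)))) <= t * (eps / 2))%R
          by (apply Rmult_le_compat_l; lra).
        lra. }
      apply Rmult_lt_reg_l in Hsum; assumption. }
    assert (Hre : ex_finite_lim_seq (fun n => Re (l n h))).
    { apply ex_lim_seq_cauchy_corr; intros eps.
      destruct (Hcauchy eps (cond_pos eps)) as [N HN]; exists N; intros n m Hn Hm.
      eapply Rle_lt_trans; [|exact (HN n m Hn Hm)].
      replace (Re (l n h) - Re (l m h))%R with (Re (l n h - l m h)) by (unfold Re; simpl; ring).
      apply re_le_Cmod. }
    assert (Him : ex_finite_lim_seq (fun n => Im (l n h))).
    { apply ex_lim_seq_cauchy_corr; intros eps.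
      destruct (Hcauchy eps (cond_pos eps)) as [N HN]; exists N; intros n m Hn Hm.
      eapply Rle_lt_trans; [|exact (HN n m Hn Hm)].
      replace (Im (l n h) - Im (l m h))%R with (Im (l n h - l m h)) by (unfold Im; simpl; ring).
      apply im_le_Cmod. }
    destruct Hre as [a Ha], Him as [b Hb]; exists ((a, b) : C).
    apply Ccv_squeeze with (fun n => (Rabs (Re (l n h) - a) + Rabs (Im (l n h) - b))%R).
    - intros n; eapply Rle_trans; [apply Cmod_le_abs|]; apply Req_le; reflexivity.
    - replace 0%R with (Rabs (a - a) + Rabs (b - b))%R by (rewrite !Rminus_diag, Rabs_R0; ring).
      apply is_lim_seq_plus'; apply (is_lim_seq_abs _ (Finite (_ - _)));
        apply is_lim_seq_minus'; try assumption; apply is_lim_seq_const. }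
  set (L := fun h => Clim (fun n => l n h)).
  assert (HL : forall h, Ccv (fun n => l n h) (L h)) by (intros h; apply Clim_correct, Hlim).
  exists L; repeat split.
  - intros h k; apply Ccv_unique with (1 := HL (plus h k)).
    apply Ccv_ext with (fun n => l n h + l n k); [intros n; symmetry; apply (Hl n)|].
    now apply Ccv_plus.
  - intros a h; apply Ccv_unique with (1 := HL (scal a h)).
    apply Ccv_ext with (fun n => a * l n h); [intros n; symmetry; apply (Hl n)|].
    now apply Ccv_scal.
  - apply Ccv_norm_le with (1 := Hx); intros n; apply (Hl n).
  - intros h; apply Ccv_norm_le with (1 := HL h); intros n; apply (Hl n).
  - intros h Hh.
    apply Ccv_norm_le with (1 := Ccv_minus _ _ _ _ (Ccv_minus _ _ _ _ (Hcv h Hh) Hx) (HL h)).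
    intros n; now apply (Hl n).
Qed.

Lemma plus_minus_cancel (v : V) : plus x (minus v x) = v.
Proof.
  transitivity (plus (plus x (opp x)) v).
  - rewrite <- plus_assoc; unfold minus; f_equal; apply plus_comm.
  - transitivity (plus zero v); [f_equal; apply (@plus_opp_r (NormedModule.AbelianGroup C_AbsRing V))|apply plus_zero_l].
Qed.

Lemma jet_ex_filterdiff (A : R) (f : V -> C) :
  jet x r A f -> @ex_filterdiff C_AbsRing V C_NormedModule f (locally x).
Proof using Hr.
  intros J; assert (HA := jet_nonneg _ _ J).
  destruct J as [l [H1 [H2 [H3 [H4 H5]]]]].
  exists l; split.
  - apply Build_is_linear; [exact H1|exact H2|].
    exists (A + 1)%R; split; [lra|]; intros h.
    change (Cmod (l h) <= (A + 1) * norm h)%R; generalize (H4 h) (norm_ge_0 h); nra.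
  - intros y Hy eps.
    rewrite <- (is_filter_lim_locally_unique _ _ Hy).
    apply locally_le_locally_norm.
    assert (He : (0 < Rmin r (eps / (A + 1)))%R).
    { apply Rmin_pos; [lra|apply Rdiv_lt_0_compat; [apply cond_pos|lra]]. }
    exists (mkposreal _ He); intros v Hv; unfold ball_norm in Hv; simpl in Hv.
    assert (Hv1 := Rlt_le_trans _ _ _ Hv (Rmin_l _ _)).
    assert (Hv2 := Rlt_le_trans _ _ _ Hv (Rmin_r _ _)).
    specialize (H5 (minus v x) (Rlt_le _ _ Hv1)).
    replace (plus x (minus v x)) with v in H5.
    2: symmetry; apply (plus_minus_cancel v).
    change (Cmod (f v - f x - l (minus v x)) <= eps * norm (minus v x))%R.
    eapply Rle_trans; [exact H5|].
    rewrite <- Rmult_assoc; apply Rmult_le_compat_r; [apply norm_ge_0|].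
    apply Rle_trans with ((A + 1) * (eps / (A + 1)))%R; [|apply Req_le; field; lra].
    assert (N := norm_ge_0 (minus v x)); nra.
Qed.

Lemma jet_pow (A : R) (f : V -> C) (k : nat) :
  (1 <= A)%R -> jet x r A f -> jet x r ((6 * A) ^ k) (fun v => f v ^ k).
Proof using Hr.
  intros HA Jf; induction k as [|k IH]; simpl.
  - rewrite <- Cmod_1 at 1; apply jet_const.
  - apply (jet_mult A ((6 * A) ^ k)); assumption.
Qed.

(** A C-linear functional of norm at most 1. Parameters enter only through such functionals, so one
    argument serves [C3] and [C4] alike. *)
Definition coordinate (p : V -> C) : Prop :=
  (forall h k, p (plus h k) = p h + p k) /\ (forall a h, p (scal a h) = a * p h) /\
  (forall h, Cmod (p h) <= norm h)%R.

Lemma jet_coordinate (p : V -> C) : coordinate p -> jet x r (1 + Cmod (p x)) p.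
Proof.
  intros [P1 [P2 P3]]; assert (H := Cmod_ge_0 (p x)); exists p; repeat split; auto.
  - lra.
  - intros h; generalize (P3 h) (norm_ge_0 h); nra.
  - intros h _; rewrite P1; replace (p x + p h - p x - p h) with (RtoC 0) by ring.
    rewrite Cmod_0; generalize (norm_ge_0 h); nra.
Qed.

(** With q = p x + c the linear part is - p h / q^2 and the remainder is (p h)^2 / (q^2 (q + p h)).
    Lower bounds by d t give inverse powers of d t up to the third, all at most a constant over t
    since t >= 1; later t = k + 1. *)
Lemma jet_inv_coordinate (p : V -> C) (c : C) (d t : R) :
  coordinate p -> (0 < d)%R -> (1 <= t)%R ->
  (forall w, Cmod w <= r -> d * t <= Cmod (p x + w + c))%R ->
  jet x r ((/ d + / (d * d) + / (d * d * d)) / t) (fun v => / (p v + c)).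
Proof using Hr.
  intros [P1 [P2 P3]] Hd Ht Hlow.
  assert (Hdt : (0 < d * t)%R) by (apply Rmult_lt_0_compat; lra).
  assert (Hit : (/ t <= 1)%R) by (rewrite <- Rinv_1; apply Rinv_le_contravar; lra).
  assert (Hit0 : (0 < / t)%R) by (apply Rinv_0_lt_compat; lra).
  assert (I1 : (0 < / d)%R) by now apply Rinv_0_lt_compat.
  assert (I2 : (0 < / (d * d))%R) by (apply Rinv_0_lt_compat; nra).
  assert (I3 : (0 < / (d * d * d))%R)
    by (apply Rinv_0_lt_compat; repeat apply Rmult_lt_0_compat; lra).
  set (A := ((/ d + / (d * d) + / (d * d * d)) / t)%R).
  assert (A1 : (/ (d * t) <= A)%R).
  { unfold A, Rdiv; rewrite Rinv_mult; apply Rmult_le_compat_r; lra. }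
  assert (A2 : (/ (d * t * (d * t)) <= A)%R).
  { unfold A, Rdiv. replace (/ (d * t * (d * t)))%R with (/ (d * d) * / t * / t)%R by (field; lra).
    rewrite <- (Rmult_1_r ((_ + _ + _) * / t)).
    apply Rmult_le_compat; [|lra| |lra]; [nra|].
    apply Rmult_le_compat_r; lra. }
  assert (A3 : (/ (d * t * (d * t) * (d * t)) <= A)%R).
  { unfold A, Rdiv.
    replace (/ (d * t * (d * t) * (d * t)))%R with (/ (d * d * d) * / t * (/ t * / t))%R by (field; lra).
    rewrite <- (Rmult_1_r ((_ + _ + _) * / t)).
    apply Rmult_le_compat; [nra|nra| |nra].
    apply Rmult_le_compat_r; lra. }
  assert (Hnz : forall w, (Cmod w <= r)%R -> p x + w + c <> 0).
  { intros w Hw; apply Cmod_gt_0; generalize (Hlow w Hw); lra. }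
  assert (H0r : (Cmod 0 <= r)%R) by (rewrite Cmod_0; lra).
  assert (Hx := Hlow 0 H0r); assert (Nx := Hnz 0 H0r).
  replace (p x + 0 + c) with (p x + c) in Hx, Nx by ring.
  set (q := p x + c) in *.
  exists (fun h => - (p h / (q * q))); repeat split.
  - intros h k; rewrite P1; field; exact Nx.
  - intros a h; rewrite P2; field; exact Nx.
  - fold q; rewrite Cmod_inv by exact Nx.
    eapply Rle_trans; [apply Rinv_le_contravar; [exact Hdt|exact Hx]|exact A1].
  - intros h; rewrite Cmod_opp, Cmod_div, Cmod_mult by now apply Cmult_neq_0.
    unfold Rdiv; rewrite Rmult_comm; apply Rmult_le_compat; [|apply Cmod_ge_0| |apply P3].
    + apply Rlt_le, Rinv_0_lt_compat; nra.
    + eapply Rle_trans; [apply Rinv_le_contravar|exact A2]; nra.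
  - intros h Hh; rewrite P1.
    assert (Hw : (Cmod (p h) <= r)%R) by (eapply Rle_trans; [apply P3|exact Hh]).
    assert (Hxh := Hlow _ Hw); assert (Nxh := Hnz _ Hw).
    fold q.
    replace (/ (p x + p h + c) - / q - - (p h / (q * q)))
      with (p h * p h / (q * q * (p x + p h + c))) by (unfold q in *; field; auto).
    rewrite Cmod_div, !Cmod_mult by (repeat apply Cmult_neq_0; assumption).
    unfold Rdiv; rewrite Rmult_comm.
    assert (Hq2 : (d * t * (d * t) <= Cmod q * Cmod q)%R) by (apply Rmult_le_compat; lra).
    assert (Hdt2 : (0 < d * t * (d * t))%R) by nra.
    assert (Hq3 : (d * t * (d * t) * (d * t) <= Cmod q * Cmod q * Cmod (p x + p h + c))%R)
      by (apply Rmult_le_compat; lra).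
    assert (Hdt3 : (0 < d * t * (d * t) * (d * t))%R) by (apply Rmult_lt_0_compat; assumption).
    apply Rmult_le_compat.
    + apply Rlt_le, Rinv_0_lt_compat; lra.
    + generalize (Cmod_ge_0 (p h)); nra.
    + eapply Rle_trans; [apply Rinv_le_contravar|exact A3]; assumption.
    + apply Rmult_le_compat; try apply Cmod_ge_0; apply P3.
Qed.

End Jets.

(** * The entire solution and its uniqueness *)

(** A quantitative form of avoiding the non-positive integers, with linear growth in k, so that the
    coefficients of the recurrence are O(1/k^2) with one constant. *)
Definition separated (n : C) (d : R) : Prop :=
  (0 < d)%R /\ forall k, (d * INR (S k) <= Cmod (n + RtoC (INR k)))%R.

(** Finitely many k have a positive minimum [m], of which at most half is lost when n moves by at
    most m/2; for larger k the term k dominates. One [d] thus serves a whole disc of parameters. *)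
Lemma nonpos_integer_separated (n : C) : ~ nonpos_integer n ->
  exists d r : R, (0 < r <= 1)%R /\ forall w : C, (Cmod w <= r)%R -> separated (n + w) d.
Proof.
  intros Hn.
  assert (Hne : forall k, (0 < Cmod (n + RtoC (INR k)))%R).
  { intros k; apply Cmod_gt_0; intros E; apply Hn; exists k.
    replace n with (n + RtoC (INR k) - RtoC (INR k)) by ring; rewrite E; ring. }
  assert (Hfin : forall K, exists m, (0 < m)%R /\ forall k, (k < K)%nat -> (m <= Cmod (n + RtoC (INR k)))%R).
  { induction K as [|K [m [Hm HK]]]; [exists 1%R; split; [lra|lia]|].
    exists (Rmin m (Cmod (n + RtoC (INR K)))); split; [now apply Rmin_pos|].
    intros k Hk; destruct (Nat.eq_dec k K) as [->|Hkne]; [apply Rmin_r|].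
    eapply Rle_trans; [apply Rmin_l|apply HK; lia]. }
  (* For k >= K one has |n + w + k| >= k - |n| - 1 >= k/2, which exceeds (k + 1)/4. *)
  destruct (INR_unbounded (2 * (Cmod n + 3))) as [K HK].
  destruct (Hfin K) as [m [Hm Hlow]].
  assert (Hn0 := Cmod_ge_0 n).
  assert (Hmk : (0 < m / (2 * INR K))%R) by (apply Rdiv_lt_0_compat; lra).
  exists (Rmin (/ 4) (m / (2 * INR K))), (Rmin 1 (m / 2)).
  split; [split; [apply Rmin_pos; lra|apply Rmin_l]|].
  intros w Hw; split; [apply Rmin_pos; lra|]; intros k.
  assert (W1 := Rle_trans _ _ _ Hw (Rmin_l _ _)); assert (W2 := Rle_trans _ _ _ Hw (Rmin_r _ _)).
  assert (Hk := pos_INR k); rewrite S_INR.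
  destruct (Nat.lt_ge_cases k K) as [Hlt|Hge].
  - apply Rle_trans with (m / (2 * INR K) * INR K)%R.
    + apply Rmult_le_compat; [apply Rlt_le, Rmin_pos; lra|lra|apply Rmin_r|].
      rewrite <- S_INR; apply le_INR; lia.
    + replace (m / (2 * INR K) * INR K)%R with (m / 2)%R by (field; lra).
      generalize (Hlow k Hlt) (Cmod_triangle_inv (n + RtoC (INR k)) (- w)); rewrite Cmod_opp.
      replace (n + RtoC (INR k) - - w) with (n + w + RtoC (INR k)) by ring; lra.
  - apply le_INR in Hge.
    apply Rle_trans with (/ 4 * (INR k + 1))%R; [apply Rmult_le_compat_r; [lra|apply Rmin_l]|].
    generalize (Cmod_triangle_inv (RtoC (INR k)) (- (n + w))) (Cmod_triangle n w).
    rewrite Cmod_opp, Cmod_R, Rabs_right by lra.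
    replace (RtoC (INR k) - - (n + w)) with (n + w + RtoC (INR k)) by ring; lra.
Qed.

Definition heun_al (n lam : C) (k : nat) : C :=
  lam * (/ RtoC (INR (S k)) * / (n + RtoC (INR k))).

Definition heun_be (n mu : C) (k : nat) : C :=
  mu * mu * (/ RtoC (INR (S k)) * / (n + RtoC (INR k))).

Definition heun_b (n lam mu : C) : nat -> C := minimal_solution (heun_al n lam) (heun_be n mu).

Definition heun_a (n lam mu : C) (k : nat) : C :=
  heun_b n lam mu k * (mu ^ k * / RtoC (INR (Factorial.fact k))).

Definition heun_E (n lam mu z : C) : C := Clim (csum (fun k => heun_a n lam mu k * z ^ k)).

Definition heun_xi (n lam mu : C) : C := mu * mu * heun_b n lam mu 1 + lam * heun_b n lam mu 0.

Lemma RtoC_INR_S_neq (k : nat) : RtoC (INR (S k)) <> 0.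
Proof. intros E; apply RtoC_inj in E; revert E; apply not_0_INR; lia. Qed.

Lemma RtoC_fact_neq (k : nat) : RtoC (INR (Factorial.fact k)) <> 0.
Proof. intros E; apply RtoC_inj in E; revert E; apply INR_fact_neq_0. Qed.

Lemma separated_neq (n : C) (d : R) (k : nat) : separated n d -> n + RtoC (INR k) <> 0.
Proof.
  intros [Hd H]; apply Cmod_gt_0; specialize (H k).
  assert (Hk := INR_S_ge1 k); nra.
Qed.

Lemma RtoC_fact_S (k : nat) : RtoC (INR (Factorial.fact (S k))) = RtoC (INR (S k)) * RtoC (INR (Factorial.fact k)).
Proof. rewrite <- RtoC_mult, <- mult_INR; reflexivity. Qed.

Lemma pow_div_fact_term_le_exp (y : R) (k : nat) : (0 <= y)%R -> (y ^ k / INR (Factorial.fact k) <= exp y)%R.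
Proof.
  intros Hy; assert (Hpos : forall j, (0 <= y ^ j / INR (Factorial.fact j))%R).
  { intros j; apply Rmult_le_pos; [now apply pow_le|apply Rlt_le, Rinv_0_lt_compat, INR_fact_lt_0]. }
  eapply Rle_trans; [|exact (pow_div_fact_le_exp y k Hy)].
  destruct k as [|k]; [rewrite sum_O; lra|].
  rewrite sum_Sn; change (y ^ S k / INR (Factorial.fact (S k)) <=
    sum_n (fun k => y ^ k / INR (Factorial.fact k)) k + y ^ S k / INR (Factorial.fact (S k)))%R.
  assert (0 <= sum_n (fun k => y ^ k / INR (Factorial.fact k)) k)%R; [|lra].
  clear - Hpos; induction k as [|k IH]; [rewrite sum_O; apply Hpos|].
  rewrite sum_Sn; apply Rplus_le_le_0_compat; [exact IH|apply Hpos].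
Qed.

Section Heun.
Context (n lam mu : C) (d : R) (Hsep : separated n d).

Let c : R := ((Cmod lam + Cmod mu * Cmod mu) / d)%R.

Lemma heun_c_nonneg : (0 <= c)%R.
Proof using Hsep.
  destruct Hsep as [Hd _]; apply Rmult_le_pos; [|now apply Rlt_le, Rinv_0_lt_compat].
  generalize (Cmod_ge_0 lam) (Cmod_ge_0 mu); nra.
Qed.

Lemma heun_factor_bound (u : C) (k : nat) : (Cmod u <= Cmod lam + Cmod mu * Cmod mu)%R ->
  (Cmod (u * (/ RtoC (INR (S k)) * / (n + RtoC (INR k)))) <= c / (INR (S k) * INR (S k)))%R.
Proof using Hsep.
  intros Hu; destruct Hsep as [Hd H]; specialize (H k); assert (Hk := INR_S_ge1 k).
  rewrite !Cmod_mult, !Cmod_inv by (apply RtoC_INR_S_neq || exact (separated_neq n d k Hsep)).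
  rewrite Cmod_R, Rabs_right by (apply Rle_ge; lra).
  set (t := INR (S k)) in *.
  assert (Hdt : (0 < d * t)%R) by (apply Rmult_lt_0_compat; lra).
  replace (c / (t * t))%R with ((Cmod lam + Cmod mu * Cmod mu) * (/ t * / (d * t)))%R
    by (unfold c; field; lra).
  apply Rmult_le_compat; [apply Cmod_ge_0| |exact Hu|].
  - apply Rmult_le_pos; apply Rlt_le, Rinv_0_lt_compat; lra.
  - apply Rmult_le_compat_l; [apply Rlt_le, Rinv_0_lt_compat; lra|].
    apply Rinv_le_contravar; lra.
Qed.

Lemma heun_al_bound (k : nat) : (Cmod (heun_al n lam k) <= c / (INR (S k) * INR (S k)))%R.
Proof using Hsep.
  apply heun_factor_bound; generalize (Cmod_ge_0 mu); nra.
Qed.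

Lemma heun_be_bound (k : nat) : (Cmod (heun_be n mu k) <= c / (INR (S k) * INR (S k)))%R.
Proof using Hsep.
  apply heun_factor_bound; rewrite Cmod_mult; generalize (Cmod_ge_0 lam); lra.
Qed.

Lemma heun_b_cv (k : nat) :
  Ccv (fun m => fst (backward (heun_al n lam) (heun_be n mu) k m)) (heun_b n lam mu k).
Proof using Hsep.
  exact (backward_cv _ _ c heun_c_nonneg heun_al_bound heun_be_bound k).
Qed.

Lemma heun_b_rec (k : nat) :
  heun_b n lam mu k =
    (1 + heun_al n lam k) * heun_b n lam mu (S k) + heun_be n mu k * heun_b n lam mu (S (S k)).
Proof using Hsep.
  exact (minimal_solution_rec _ _ c heun_c_nonneg heun_al_bound heun_be_bound k).
Qed.

(** The sequence b is bounded, and (|mu|/rho)^k / k! <= exp(|mu|/rho) for every positive [rho]; the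
    freedom in [rho] is what makes the sum entire. *)
Lemma heun_a_bound (rho : R) : (0 < rho)%R ->
  exists M, forall k, (Cmod (heun_a n lam mu k) <= M * rho ^ k)%R.
Proof using Hsep.
  intros Hrho; exists (exp (4 * c) * exp (Cmod mu / rho))%R; intros k.
  assert (Hb := minimal_solution_bound _ _ c heun_c_nonneg heun_al_bound heun_be_bound k).
  fold (heun_b n lam mu k) in Hb.
  unfold heun_a; rewrite !Cmod_mult, Cmod_pow, Cmod_inv by apply RtoC_fact_neq.
  rewrite Cmod_R, Rabs_right by (apply Rle_ge, pos_INR).
  assert (Hf := INR_fact_lt_0 k).
  assert (Hy : (0 <= Cmod mu / rho)%R)
    by (apply Rmult_le_pos; [apply Cmod_ge_0|now apply Rlt_le, Rinv_0_lt_compat]).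
  rewrite Rmult_assoc; apply Rmult_le_compat; [apply Cmod_ge_0| |exact Hb|].
  - apply Rmult_le_pos; [apply pow_le, Cmod_ge_0|now apply Rlt_le, Rinv_0_lt_compat].
  - assert (Hp : (0 <= rho ^ k)%R) by (apply pow_le; lra).
    eapply Rle_trans; [|apply Rmult_le_compat_r; [exact Hp|exact (pow_div_fact_term_le_exp _ k Hy)]].
    apply Req_le; unfold Rdiv; rewrite Rpow_mult_distr, pow_inv; field.
    split; [lra|apply pow_nonzero; lra].
Qed.

Lemma heun_E_pser (z : C) : is_pser (heun_a n lam mu) z (heun_E n lam mu z).
Proof using Hsep.
  assert (Hz := Cmod_ge_0 z).
  destruct (heun_a_bound (/ (Cmod z + 1))) as [M HM]; [apply Rinv_0_lt_compat; lra|].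
  apply Clim_correct, is_pser_ex with (2 := HM).
  - apply Rlt_le, Rinv_0_lt_compat; lra.
  - apply (Rmult_lt_reg_r (Cmod z + 1)); [lra|].
    rewrite Rmult_assoc, Rinv_l by lra; lra.
Qed.

Lemma heun_coef_a_0 : heun_coef n lam mu (heun_a n lam mu) 0 = heun_xi n lam mu.
Proof using.
  unfold heun_coef, heun_a, heun_xi; simpl; field.
Qed.

(** The rescaling turns a coefficient of L E into the defect of the normalized recurrence times a
    factor that is nonzero when [mu] is. It is read in both directions: to solve the equation and to
    recover the recurrence from a solution. *)
Lemma heun_coef_scaled (b : nat -> C) (j : nat) :
  heun_coef n lam mu (fun k => b k * (mu ^ k * / RtoC (INR (Factorial.fact k)))) (S j) =
    mu ^ S j * / RtoC (INR (Factorial.fact j)) * (n + RtoC (INR j)) *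
    ((1 + heun_al n lam j) * b (S j) + heun_be n mu j * b (S (S j)) - b j).
Proof using Hsep.
  unfold heun_coef, heun_al, heun_be; rewrite !RtoC_fact_S.
  assert (H1 := RtoC_INR_S_neq j); assert (H2 := RtoC_INR_S_neq (S j)); assert (H3 := RtoC_fact_neq j).
  assert (H4 := separated_neq n d j Hsep).
  set (s2 := RtoC (INR (S (S j)))) in *; set (s1 := RtoC (INR (S j))) in *.
  set (f := RtoC (INR (Factorial.fact j))) in *; set (s0 := RtoC (INR j)) in *.
  rewrite !Cpow_S; set (m := mu ^ j); field; auto.
Qed.

(** Multiples are treated at once because the entire extension of an arbitrary solution is one. *)
Lemma heun_E_multiple_ode (kappa : C) (F : C -> C) (z : C) :
  (forall w, F w = kappa * heun_E n lam mu w) ->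
  heun_L n lam mu F z = kappa * heun_xi n lam mu /\ exists e, has_cderiv F z e.
Proof using Hsep.
  intros HF; assert (Hz := Cmod_ge_0 z).
  set (rho := (/ (16 * (Cmod z + 1)))%R).
  assert (Hrho : (0 < rho)%R) by (apply Rinv_0_lt_compat; lra).
  destruct (heun_a_bound rho Hrho) as [M HM].
  destruct (heun_L_pser n lam mu (fun k => kappa * heun_a n lam mu k) (Cmod kappa * M) rho F z Hrho)
    as [HL Hd].
  - intros k; rewrite Cmod_mult, Rmult_assoc; apply Rmult_le_compat_l; [apply Cmod_ge_0|apply HM].
  - intros w _; rewrite HF; apply is_pser_scal, heun_E_pser.
  - replace (Cmod z * (16 * rho))%R with (Cmod z * / (Cmod z + 1))%R by (unfold rho; field; lra).
    apply (Rmult_lt_reg_r (Cmod z + 1)); [lra|].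
    rewrite Rmult_assoc, Rinv_l by lra; lra.
  - split; [|exact Hd].
    (* All coefficients of positive index vanish by the recurrence, so the partial sums from the
       first term on are constant. *)
    apply Ccv_unique with (1 := HL); apply Ccv_incr.
    apply Ccv_ext with (fun _ => kappa * heun_xi n lam mu); [|apply Ccv_const].
    intros k; rewrite csum_first, csum_zero, <- heun_coef_a_0; [simpl; ring|].
    intros j; rewrite (heun_coef_ext _ _ _ _ (fun k => kappa * heun_b n lam mu k *
      (mu ^ k * / RtoC (INR (Factorial.fact k))))) by (intros i; unfold heun_a; ring).
    rewrite heun_coef_scaled, (heun_b_rec j); ring.
Qed.

Lemma heun_E_ode (z : C) :
  heun_L n lam mu (heun_E n lam mu) z = heun_xi n lam mu /\ exists e, has_cderiv (heun_E n lam mu) z e.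
Proof using Hsep.
  rewrite <- (Cmult_1_l (heun_xi n lam mu)); apply heun_E_multiple_ode; intros w; ring.
Qed.

Lemma heun_b_nonzero : exists k, heun_b n lam mu k <> 0.
Proof using Hsep.
  exact (minimal_solution_nonzero _ _ c heun_c_nonneg heun_al_bound heun_be_bound).
Qed.

Lemma heun_E_nonzero : mu <> 0 -> exists z, heun_E n lam mu z <> 0.
Proof using Hsep.
  intros Hmu; apply NNPP; intros Hno.
  destruct heun_b_nonzero as [k Hk]; apply Hk.
  assert (H : heun_a n lam mu k = 0).
  { apply (pser_zero_coeffs (heun_a n lam mu) 1 Rlt_0_1); intros z _.
    replace (RtoC 0) with (heun_E n lam mu z); [apply heun_E_pser|].
    apply NNPP; intros Hne; apply Hno; now exists z. }
  assert (H2 : mu ^ k * / RtoC (INR (Factorial.fact k)) <> 0).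
  { apply Cmult_neq_0; [now apply Cpow_nz|].
    intros E; apply (RtoC_fact_neq k); replace (RtoC (INR _)) with (/ / RtoC (INR (Factorial.fact k)))
      by (field; apply RtoC_fact_neq).
    rewrite E; unfold Cinv, RtoC; simpl; f_equal; unfold Rdiv; ring. }
  unfold heun_a in H; apply NNPP; intros Hne; exact (Cmult_neq_0 _ _ Hne H2 H).
Qed.

Lemma heun_E_holomorphic : holomorphic_on whole_plane (heun_E n lam mu).
Proof using Hsep.
  intros z _; destruct (heun_E_ode z) as [_ [e He]]; exists e; now apply is_derive_has_cderiv.
Qed.

Lemma heun_E_solution : mu <> 0 ->
  heun_solution n lam mu whole_plane (heun_E n lam mu) (heun_xi n lam mu).
Proof using Hsep.
  intros Hmu; split; [apply heun_E_holomorphic|]; split.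
  - destruct (heun_E_nonzero Hmu) as [z Hz]; exists z; split; [exact I|exact Hz].
  - intros z _; apply heun_E_ode.
Qed.

(* The Casoratian of [b] with the minimal solution gains a factor of order k^2 at each step,
   whereas a sequence [b] of factorial growth only allows a factor of order k. *)
Lemma casoratian_zero (b : nat -> C) (M q : R) :
  (0 < q)%R -> (forall k, Cmod (b k) <= M * q ^ k * INR (Factorial.fact k))%R ->
  (forall k, b k = (1 + heun_al n lam k) * b (S k) + heun_be n mu k * b (S (S k))) ->
  b O * heun_b n lam mu 1 - b 1%nat * heun_b n lam mu 0 = 0.
Proof using Hsep.
  intros Hq Hb Hrec.
  set (W := fun k => b k * heun_b n lam mu (S k) - b (S k) * heun_b n lam mu k).
  (* The terms with 1 + al cancel, which leaves a first-order recursion for the Casoratian. *)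
  assert (HW : forall k, W k = - heun_be n mu k * W (S k)).
  { intros k; unfold W; rewrite (Hrec k), (heun_b_rec k); ring. }
  assert (Hc := heun_c_nonneg).
  assert (HM : (0 <= M)%R) by (generalize (Hb O) (Cmod_ge_0 (b O)); simpl; lra).
  set (B := exp (4 * c)).
  assert (HB : forall k, (Cmod (heun_b n lam mu k) <= B)%R)
    by exact (minimal_solution_bound _ _ c heun_c_nonneg heun_al_bound heun_be_bound).
  assert (HB0 : (0 < B)%R) by apply exp_pos.
  (* Since |be_k| <= c/(k+1)^2, iteration from 0 to k produces the square of the factorial. *)
  assert (Hprod : forall k, (Cmod (W O) * (INR (Factorial.fact k) * INR (Factorial.fact k)) <= c ^ k * Cmod (W k))%R).
  { induction k as [|k IH]; [simpl; lra|].
    rewrite (HW k), Cmod_mult, Cmod_opp in IH.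
    assert (Hbk := heun_be_bound k); assert (HwS := Cmod_ge_0 (W (S k))).
    change (Factorial.fact (S k)) with (S k * Factorial.fact k)%nat; rewrite mult_INR.
    assert (Hk := INR_S_ge1 k); set (t := INR (S k)) in *; set (F := INR (Factorial.fact k)) in *.
    assert (Hck : (0 <= c ^ k)%R) by now apply pow_le.
    apply Rle_trans with (t * t * (c ^ k * (Cmod (heun_be n mu k) * Cmod (W (S k)))))%R.
    { replace (Cmod (W O) * (t * F * (t * F)))%R with (t * t * (Cmod (W O) * (F * F)))%R by ring.
      apply Rmult_le_compat_l; [nra|exact IH]. }
    apply Rle_trans with (t * t * (c ^ k * (c / (t * t) * Cmod (W (S k)))))%R.
    { apply Rmult_le_compat_l; [nra|]; apply Rmult_le_compat_l; [exact Hck|].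
      apply Rmult_le_compat_r; assumption. }
    apply Req_le; simpl; field; lra. }
  (* In the bound for b_(k+1) the factor k + 1 of its factorial is absorbed by 2^k, so W_k is at
     most of size (2 q)^k k!. *)
  set (Q := (M * B * (1 + 2 * q))%R).
  assert (HQ : (0 <= Q)%R) by (apply Rmult_le_pos; [apply Rmult_le_pos; lra|lra]).
  assert (HWk : forall k, (Cmod (W k) <= Q * (2 * q) ^ k * INR (Factorial.fact k))%R).
  { intros k; unfold W; eapply Rle_trans; [apply Cmod_minus_le|]; rewrite !Cmod_mult.
    assert (P1 := Hb k); assert (P2 := Hb (S k)).
    change (Factorial.fact (S k)) with (S k * Factorial.fact k)%nat in P2; rewrite mult_INR in P2.
    assert (HF := pos_INR (Factorial.fact k)); set (F := INR (Factorial.fact k)) in *.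
    assert (H2 := INR_S_le_pow2 k); assert (Hk := INR_S_ge1 k); set (t := INR (S k)) in *.
    assert (Hqk : (0 < q ^ k)%R) by now apply pow_lt.
    assert (H2k : (1 <= 2 ^ k)%R) by lra.
    rewrite Rpow_mult_distr; set (T := (2 ^ k)%R) in *; set (p := (q ^ k)%R) in *.
    assert (R1 : (Cmod (b k) * Cmod (heun_b n lam mu (S k)) <= M * (T * p) * F * B)%R).
    { apply Rmult_le_compat; try apply Cmod_ge_0; [|apply HB].
      eapply Rle_trans; [exact P1|]; apply Rmult_le_compat_r; [exact HF|].
      apply Rmult_le_compat_l; [exact HM|nra]. }
    assert (R2 : (Cmod (b (S k)) * Cmod (heun_b n lam mu k) <= M * (q * (T * p)) * F * B)%R).
    { apply Rmult_le_compat; try apply Cmod_ge_0; [|apply HB].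
      eapply Rle_trans; [exact P2|]; simpl; fold p.
      replace (M * (q * p) * (t * F))%R with (M * (q * p) * F * t)%R by ring.
      replace (M * (q * (T * p)) * F)%R with (M * (q * p) * F * T)%R by ring.
      apply Rmult_le_compat_l; [repeat apply Rmult_le_pos; lra|exact H2]. }
    unfold Q.
    replace (M * B * (1 + 2 * q) * (T * p) * F)%R
      with (M * (T * p) * F * B + M * (q * (T * p)) * F * B + M * (q * (T * p)) * F * B)%R by ring.
    assert (0 <= M * (q * (T * p)) * F * B)%R; [repeat apply Rmult_le_pos; lra|lra]. }
  apply Cmod_eq_0; fold (W O); apply Rle_antisym; [|apply Cmod_ge_0].
  (* One factorial survives: |W_0| <= Q (2 c q)^k / k!, which tends to 0. *)
  assert (Hlim := cv_speed_pow_fact (c * (2 * q))); apply is_lim_seq_Reals in Hlim.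
  apply (is_lim_seq_le (fun _ => Cmod (W O))
    (fun k => Q * ((c * (2 * q)) ^ k / INR (Factorial.fact k)))%R (Cmod (W O)) 0%R).
  - intros k; assert (HF := INR_fact_lt_0 k).
    apply (Rmult_le_reg_r (INR (Factorial.fact k) * INR (Factorial.fact k))); [nra|].
    eapply Rle_trans; [apply Hprod|].
    replace (Q * ((c * (2 * q)) ^ k / INR (Factorial.fact k)) * (INR (Factorial.fact k) * INR (Factorial.fact k)))%R
      with (c ^ k * (Q * (2 * q) ^ k * INR (Factorial.fact k)))%R
      by (rewrite (Rpow_mult_distr c); field; lra).
    apply Rmult_le_compat_l; [now apply pow_le|apply HWk].
  - apply is_lim_seq_const.
  - replace (Finite 0) with (Rbar_mult Q 0%R) by (simpl; f_equal; ring).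
    now apply is_lim_seq_scal_l.
Qed.

(** A zero Casoratian makes the pairs of initial values proportional. Forward recursion, possible as
    [heun_be] is nonzero, spreads this to all indices and also shows that the minimal solution does
    not start with two zeros. *)
Lemma heun_recurrence_unique (b : nat -> C) (M q : R) :
  mu <> 0 -> (0 < q)%R -> (forall k, Cmod (b k) <= M * q ^ k * INR (Factorial.fact k))%R ->
  (forall k, b k = (1 + heun_al n lam k) * b (S k) + heun_be n mu k * b (S (S k))) ->
  exists kappa, forall k, b k = kappa * heun_b n lam mu k.
Proof using Hsep.
  intros Hmu Hq Hb Hrec.
  assert (HW := casoratian_zero b M q Hq Hb Hrec).
  assert (Hbe : forall k, heun_be n mu k <> 0).
  { intros k; unfold heun_be; assert (H1 := RtoC_INR_S_neq k); assert (H2 := separated_neq n d k Hsep).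
    intros E; apply (Cmult_neq_0 _ _ Hmu Hmu).
    replace (mu * mu) with (mu * mu * (/ RtoC (INR (S k)) * / (n + RtoC (INR k)))
      * (RtoC (INR (S k)) * (n + RtoC (INR k)))) by (field; auto).
    rewrite E; ring. }
  assert (Hzero : forall f : nat -> C,
    (forall k, f k = (1 + heun_al n lam k) * f (S k) + heun_be n mu k * f (S (S k))) ->
    f O = 0 -> f 1%nat = 0 -> forall k, f k = 0).
  { intros f Hf H0 H1 k; enough (f k = 0 /\ f (S k) = 0) by tauto.
    induction k as [|k [IH1 IH2]]; [now split|split; [exact IH2|]].
    assert (E := Hf k); rewrite IH1, IH2 in E.
    replace (f (S (S k))) with (((1 + heun_al n lam k) * 0 + heun_be n mu k * f (S (S k))) / heun_be n mu k)
      by (field; apply Hbe).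
    rewrite <- E; field; apply Hbe. }
  enough (H : exists kappa, b O = kappa * heun_b n lam mu 0 /\ b 1%nat = kappa * heun_b n lam mu 1).
  { destruct H as [kappa [H0 H1]]; exists kappa; intros k; apply Ceq_minus.
    apply (Hzero (fun k => b k - kappa * heun_b n lam mu k)).
    - intros j; rewrite (Hrec j), (heun_b_rec j) at 1; ring.
    - rewrite H0; ring.
    - rewrite H1; ring. }
  destruct (Ceq_dec (heun_b n lam mu 0) 0) as [E0|N0].
  - destruct (Ceq_dec (heun_b n lam mu 1) 0) as [E1|N1].
    + exfalso; destruct heun_b_nonzero as [k Hk]; apply Hk.
      apply (Hzero (heun_b n lam mu)); [exact heun_b_rec|exact E0|exact E1].
    + exists (b 1%nat / heun_b n lam mu 1); split; [|field; exact N1].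
      rewrite E0; transitivity (b O * heun_b n lam mu 1 / heun_b n lam mu 1); [field; exact N1|].
      rewrite E0 in HW; replace (b O * heun_b n lam mu 1) with (RtoC 0); [field; exact N1|].
      rewrite <- HW; ring.
  - exists (b O / heun_b n lam mu 0); split; [field; exact N0|].
    replace (b O / heun_b n lam mu 0 * heun_b n lam mu 1) with (b O * heun_b n lam mu 1 / heun_b n lam mu 0)
      by (field; exact N0).
    replace (b O * heun_b n lam mu 1) with (b 1%nat * heun_b n lam mu 0); [field; exact N0|].
    symmetry; apply Ceq_minus; exact HW.
Qed.

(** A geometric bound on the Taylor coefficients becomes factorial growth of the rescaled sequence
    b, which the Casoratian argument tolerates. Both the uniqueness and the extension clause rest on
    this comparison with the entire solution. *)
Lemma heun_solution_proportional (U : C -> Prop) (E : C -> C) (e : C) :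
  mu <> 0 -> zero_neighborhood U -> heun_solution n lam mu U E e ->
  exists kappa : C, kappa <> 0 /\ e = kappa * heun_xi n lam mu /\
    forall z, U z -> E z = kappa * heun_E n lam mu z.
Proof using Hsep.
  intros Hmu [HU [HUc HU0]] [HE [[z1 [Hz1 Hnz]] HL]].
  destruct (holomorphic_on_expansion U E 0 HU HE HU0) as [a [M [rho [Hrho [Ha Hs]]]]].
  assert (HEs : forall w, (Cmod w * rho < 1)%R -> is_pser a w (E w)).
  { intros w Hw; specialize (Hs w); replace (w - 0) with w in Hs by ring; now apply Hs. }
  destruct (proj1 (open_Cmod U) HU 0 HU0) as [r [Hr Hin]].
  (* These are the coefficients of L E - e: the constant is moved to index 0 so that the uniqueness
     of zero coefficients applies. *)
  set (coef := fun k => heun_coef n lam mu a k + match k with O => - e | S _ => RtoC 0 end).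
  assert (Hcoef : forall k, coef k = 0).
  { assert (Hrho16 : (0 < / (16 * rho))%R) by (apply Rinv_0_lt_compat; lra).
    apply (pser_zero_coeffs coef (Rmin (/ (16 * rho)) r)); [now apply Rmin_pos|]; intros z Hz.
    assert (H1 := Rlt_le_trans _ _ _ Hz (Rmin_l _ _)).
    assert (H2 := Rlt_le_trans _ _ _ Hz (Rmin_r _ _)).
    assert (Hz16 : (Cmod z * (16 * rho) < 1)%R).
    { apply (Rmult_lt_compat_r (16 * rho)) in H1; [|lra]; rewrite Rinv_l in H1; lra. }
    destruct (heun_L_pser n lam mu a M rho E z Hrho Ha HEs Hz16) as [P _].
    rewrite HL in P by (apply Hin; now replace (z - 0) with z by ring).
    replace (RtoC 0) with (e + - e) by ring.
    apply is_pser_plus; [exact P|].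
    apply Ccv_incr, Ccv_ext with (fun _ => - e); [|apply Ccv_const].
    intros k; rewrite csum_first, csum_zero; [simpl; ring|intros j; ring]. }
  assert (Hmup : (0 < Cmod mu)%R) by now apply Cmod_gt_0.
  assert (Hmuk : forall k, mu ^ k <> 0) by (intros k; now apply Cpow_nz).
  set (b := fun k => a k * (RtoC (INR (Factorial.fact k)) * / mu ^ k)).
  assert (Hab : forall k, a k = b k * (mu ^ k * / RtoC (INR (Factorial.fact k)))).
  { intros k; unfold b; field; split; [apply RtoC_fact_neq|apply Hmuk]. }
  destruct (heun_recurrence_unique b M (rho / Cmod mu)) as [kappa Hkappa].
  - exact Hmu.
  - now apply Rdiv_lt_0_compat.
  - intros k; unfold b; rewrite !Cmod_mult, Cmod_inv, Cmod_pow by apply Hmuk.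
    rewrite Cmod_R, Rabs_right by (apply Rle_ge, pos_INR).
    unfold Rdiv; rewrite Rpow_mult_distr, pow_inv.
    replace (M * (rho ^ k * / Cmod mu ^ k) * INR (Factorial.fact k))%R
      with (M * rho ^ k * (INR (Factorial.fact k) * / Cmod mu ^ k))%R by ring.
    apply Rmult_le_compat_r; [|apply Ha].
    apply Rmult_le_pos; [apply pos_INR|now apply Rlt_le, Rinv_0_lt_compat, pow_lt].
  - intros k; symmetry; apply Ceq_minus.
    assert (H := Hcoef (S k)); unfold coef in H; rewrite Cplus_0_r in H.
    rewrite (heun_coef_ext n lam mu _ _ _ Hab), heun_coef_scaled in H.
    apply NNPP; intros Hne; revert H; repeat apply Cmult_neq_0; try exact Hne.
    + exact Hmu.
    + apply Hmuk.
    + intros H0; apply C1_nz; rewrite <- (Cinv_l _ (RtoC_fact_neq k)), H0; ring.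
    + exact (separated_neq n d k Hsep).
  - assert (Haa : forall k, a k = kappa * heun_a n lam mu k).
    { intros k; rewrite Hab, Hkappa; unfold heun_a; ring. }
    (* Taylor expansion gives equality only on a disc about 0; connectedness of [U] carries it to
       the rest. *)
    assert (HEk : forall z, U z -> E z = kappa * heun_E n lam mu z).
    { apply (identity_theorem U E (fun z => kappa * heun_E n lam mu z) 0 (/ rho)); try assumption.
      - intros z _; destruct (heun_E_ode z) as [_ [e' He']].
        exists (kappa * e'); now apply is_derive_has_cderiv, has_cderiv_scal.
      - now apply Rinv_0_lt_compat.
      - intros z Hz; replace (z - 0) with z in Hz by ring.
        apply Ccv_unique with (1 := HEs z ltac:(apply (Rmult_lt_compat_r rho) in Hz; [|lra];
          rewrite Rinv_l in Hz; lra)).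
        apply (is_pser_ext (fun k => kappa * heun_a n lam mu k)); [intros k; now rewrite Haa|].
        apply is_pser_scal, heun_E_pser. }
    exists kappa; split; [|split; [|exact HEk]].
    + intros H0; apply Hnz; rewrite HEk, H0 by exact Hz1; ring.
    + assert (H := Hcoef O); unfold coef in H.
      rewrite (heun_coef_ext n lam mu _ _ _ Haa) in H.
      replace (heun_coef n lam mu (fun k => kappa * heun_a n lam mu k) 0)
        with (kappa * heun_coef n lam mu (heun_a n lam mu) 0) in H by (simpl; ring).
      rewrite heun_coef_a_0 in H; symmetry; now apply Ceq_minus.
Qed.

End Heun.

(** * Dependence on the parameters *)

Lemma coordinate_id : @coordinate C_NormedModule (fun z => z).
Proof. repeat split; intros; apply Rle_refl. Qed.

Lemma coordinate_fst (U W : NormedModule C_AbsRing) (p : U -> C) :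
  coordinate p -> @coordinate (prod_NormedModule C_AbsRing U W) (fun v => p (fst v)).
Proof.
  intros [P1 [P2 P3]]; split; [|split].
  - intros h k; apply (P1 (fst h) (fst k)).
  - intros a h; apply (P2 a (fst h)).
  - intros [h1 h2]; eapply Rle_trans; [apply P3|].
    eapply Rle_trans; [apply Rmax_l|apply (norm_prod (K := C_AbsRing) h1 h2)].
Qed.

Lemma coordinate_snd (U W : NormedModule C_AbsRing) (p : W -> C) :
  coordinate p -> @coordinate (prod_NormedModule C_AbsRing U W) (fun v => p (snd v)).
Proof.
  intros [P1 [P2 P3]]; split; [|split].
  - intros h k; apply (P1 (snd h) (snd k)).
  - intros a h; apply (P2 a (snd h)).
  - intros [h1 h2]; eapply Rle_trans; [apply P3|].
    eapply Rle_trans; [apply Rmax_r|apply (norm_prod (K := C_AbsRing) h1 h2)].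
Qed.

Section ParameterDependence.
Context {V : NormedModule C_AbsRing} (x : V) (Nc Lc Mc : V -> C).
Context (HN : coordinate Nc) (HL : coordinate Lc) (HM : coordinate Mc).

(** Jet constants satisfy the same inequality as the moduli, with a factor 6 for each product.
    Replacing [c] by [6 * c] in the supersolution therefore gives bounds independent of the number
    of steps. *)
Lemma jet_backward (r c : R) : (0 < r <= 1)%R -> (0 <= c)%R ->
  (forall k, jet x r (c / (INR (S k) * INR (S k))) (fun v => heun_al (Nc v) (Lc v) k)) ->
  (forall k, jet x r (c / (INR (S k) * INR (S k))) (fun v => heun_be (Nc v) (Mc v) k)) ->
  forall m k,
    jet x r (exp (4 * (6 * c) / INR (S k)))
      (fun v => fst (backward (heun_al (Nc v) (Lc v)) (heun_be (Nc v) (Mc v)) k m)) /\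
    jet x r (exp (4 * (6 * c) / INR (S k)))
      (fun v => snd (backward (heun_al (Nc v) (Lc v)) (heun_be (Nc v) (Mc v)) k m)).
Proof using.
  intros Hr Hc Jal Jbe m; assert (Hc6 : (0 <= 6 * c)%R) by lra.
  induction m as [|m IH]; intros k; cbn [backward fst snd].
  - assert (J : jet x r (exp (4 * (6 * c) / INR (S k))) (fun _ => RtoC 1)); [|now split].
    apply jet_weaken with (Cmod 1); [|apply jet_const].
    rewrite Cmod_1; apply (growth_ge1 (6 * c) Hc6 k).
  - destruct (IH (S k)) as [J1 J2]; split.
    + set (B := exp (4 * (6 * c) / INR (S (S k)))) in *.
      set (e := (c / (INR (S k) * INR (S k)))%R).
      apply jet_weaken with (B + (6 * e * B + 6 * e * B))%R.
      { eapply Rle_trans; [|exact (growth_step (6 * c) Hc6 k)].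
        apply Req_le; unfold B, e, Rdiv; ring. }
      apply jet_ext with (fun v =>
        fst (backward (heun_al (Nc v) (Lc v)) (heun_be (Nc v) (Mc v)) (S k) m) +
        (heun_al (Nc v) (Lc v) k * fst (backward (heun_al (Nc v) (Lc v)) (heun_be (Nc v) (Mc v)) (S k) m)
         + heun_be (Nc v) (Mc v) k * snd (backward (heun_al (Nc v) (Lc v)) (heun_be (Nc v) (Mc v)) (S k) m)));
        [intros v; ring|].
      apply jet_plus; [exact J1|]; apply jet_plus; apply jet_mult; auto; [apply Jal|apply Jbe].
    + eapply jet_weaken; [|exact J1]; apply (growth_mono (6 * c) Hc6).
Qed.

(** One radius and one constant serve all k, which is needed to sum the series for E afterwards. The
    separation on the ball is exported since pointwise convergence is needed there too. *)
Lemma jet_heun_b : ~ nonpos_integer (Nc x) ->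
  exists r B, (0 < r <= 1)%R /\
    (forall h, (norm h <= r)%R -> exists d, separated (Nc (plus x h)) d) /\
    forall k, jet x r B (fun v => heun_b (Nc v) (Lc v) (Mc v) k).
Proof using HN HL HM.
  intros Hx; destruct (nonpos_integer_separated _ Hx) as [d [r [Hr Hsep]]].
  assert (Hd : (0 < d)%R).
  { apply (Hsep 0); rewrite Cmod_0; lra. }
  (* A local real constant, not the imaginary unit: the one produced by [jet_inv_coordinate]. *)
  set (Ci := (/ d + / (d * d) + / (d * d * d))%R).
  assert (HCi : (0 < Ci)%R).
  { assert (0 < / d)%R by now apply Rinv_0_lt_compat.
    assert (0 < / (d * d))%R by (apply Rinv_0_lt_compat; nra).
    assert (0 < / (d * d * d))%R by (apply Rinv_0_lt_compat; repeat apply Rmult_lt_0_compat; lra).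
    unfold Ci; lra. }
  set (AL := (1 + Cmod (Lc x))%R); set (AM := (1 + Cmod (Mc x))%R).
  assert (HAL : (1 <= AL)%R) by (unfold AL; generalize (Cmod_ge_0 (Lc x)); lra).
  assert (HAM : (1 <= AM)%R) by (unfold AM; generalize (Cmod_ge_0 (Mc x)); lra).
  assert (Jinv : forall k, jet x r (6 * (Ci / (INR (S k) * INR (S k))))
    (fun v => / RtoC (INR (S k)) * / (Nc v + RtoC (INR k)))).
  { intros k; assert (Hk := INR_S_ge1 k).
    apply jet_weaken with (6 * Cmod (/ RtoC (INR (S k))) * (Ci / INR (S k)))%R.
    - apply Req_le; rewrite Cmod_inv, Cmod_R, Rabs_right by (apply RtoC_INR_S_neq || apply Rle_ge; lra).
      field; lra.
    - apply jet_mult; [exact Hr|apply jet_const|].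
      apply jet_inv_coordinate; auto.
      intros w Hw; now apply (Hsep w Hw). }
  (* The two summands are the jet constants of [heun_al] and [heun_be] times (k+1)^2, each product
     contributing a factor 6. *)
  set (c := (6 * AL * (6 * Ci) + 6 * (6 * AM * AM) * (6 * Ci))%R).
  assert (Hc1 : (0 <= 6 * AL * (6 * Ci))%R) by (repeat apply Rmult_le_pos; lra).
  assert (Hc2 : (0 <= 6 * (6 * AM * AM) * (6 * Ci))%R) by (repeat apply Rmult_le_pos; lra).
  assert (Hc : (0 <= c)%R) by (unfold c; lra).
  assert (Hweak : forall (a : R) k, (a <= c)%R ->
    (a * / (INR (S k) * INR (S k)) <= c / (INR (S k) * INR (S k)))%R).
  { intros a k Ha; apply Rmult_le_compat_r; [|exact Ha].
    apply Rlt_le, Rinv_0_lt_compat; generalize (INR_S_ge1 k); nra. }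
  exists r, (exp (4 * (6 * c))); split; [exact Hr|]; split.
  { intros h Hh; exists d; destruct HN as [N1 [_ N3]]; rewrite N1; apply Hsep.
    eapply Rle_trans; [apply N3|exact Hh]. }
  intros k; unfold heun_b.
  apply jet_weaken with (exp (4 * (6 * c) / INR (S k))).
  { eapply Rle_trans; [exact (growth_le0 (6 * c) ltac:(lra) k)|]; simpl; rewrite Rdiv_1_r; lra. }
  apply jet_lim with (fun m v => fst (backward (heun_al (Nc v) (Lc v)) (heun_be (Nc v) (Mc v)) k m)).
  - exact Hr.
  - intros m; apply jet_backward; [exact Hr|exact Hc| |].
    + intros j; eapply jet_weaken; [apply (Hweak (6 * AL * (6 * Ci))%R j); unfold c; lra|].
      unfold heun_al.
      eapply jet_weaken; [|apply jet_mult; [exact Hr|now apply jet_coordinate|apply Jinv]].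
      fold AL; apply Req_le; unfold Rdiv; ring.
    + intros j; eapply jet_weaken; [apply (Hweak (6 * (6 * AM * AM) * (6 * Ci))%R j); unfold c; lra|].
      unfold heun_be.
      eapply jet_weaken; [|apply jet_mult; [exact Hr| |apply Jinv]].
      2: apply jet_mult; [exact Hr|now apply jet_coordinate|now apply jet_coordinate].
      fold AM; apply Req_le; unfold Rdiv; ring.
  - intros h Hh; apply (heun_b_cv _ _ _ d).
    destruct HN as [N1 [_ N3]]; rewrite N1; apply Hsep.
    eapply Rle_trans; [apply N3|exact Hh].
Qed.

Lemma heun_xi_differentiable : ~ nonpos_integer (Nc x) ->
  @ex_filterdiff C_AbsRing V C_NormedModule (fun v => heun_xi (Nc v) (Lc v) (Mc v)) (locally x).
Proof using HN HL HM.
  intros Hx; destruct (jet_heun_b Hx) as [r [B [Hr [_ J]]]].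
  eapply jet_ex_filterdiff; [exact Hr|]; unfold heun_xi.
  apply jet_plus; apply jet_mult; try exact Hr; try apply J; [apply jet_mult; [exact Hr|..]|];
    now apply jet_coordinate.
Qed.

(** The k-th term has a jet constant of order (6 Y)^k / k!, where [Y] is that of the product of [mu]
    and z. The exponential series then bounds all partial sums uniformly, and the limit inherits the
    bound. *)
Lemma heun_E_differentiable (Zc : V -> C) : coordinate Zc -> ~ nonpos_integer (Nc x) ->
  @ex_filterdiff C_AbsRing V C_NormedModule (fun v => heun_E (Nc v) (Lc v) (Mc v) (Zc v)) (locally x).
Proof using HN HL HM.
  intros HZ Hx; destruct (jet_heun_b Hx) as [r [B [Hr [Hsep J]]]].
  set (Y := (6 * (1 + Cmod (Mc x)) * (1 + Cmod (Zc x)))%R).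
  assert (HY : (1 <= Y)%R).
  { unfold Y; generalize (Cmod_ge_0 (Mc x)) (Cmod_ge_0 (Zc x)); nra. }
  assert (HB : (0 <= B)%R) by exact (jet_nonneg _ _ _ _ (J O)).
  set (term := fun k (v : V) => heun_b (Nc v) (Lc v) (Mc v) k *
    (/ RtoC (INR (Factorial.fact k)) * (Mc v * Zc v) ^ k)).
  assert (Jterm : forall k, jet x r (36 * B * ((6 * Y) ^ k / INR (Factorial.fact k))) (term k)).
  { intros k; unfold term.
    apply jet_weaken with (6 * B * (6 * Cmod (/ RtoC (INR (Factorial.fact k))) * (6 * Y) ^ k))%R.
    - apply Req_le; rewrite Cmod_inv, Cmod_R, Rabs_right
        by (apply RtoC_fact_neq || apply Rle_ge, pos_INR).
      unfold Rdiv; ring.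
    - apply jet_mult; [exact Hr|apply J|]; apply jet_mult; [exact Hr|apply jet_const|].
      apply jet_pow; [exact Hr|exact HY|]; apply jet_mult; [exact Hr|..]; now apply jet_coordinate. }
  (* [csum] up to [S m] matches [sum_n] up to [m], which includes its last index. *)
  assert (Jsum : forall m, jet x r (36 * B * sum_n (fun k => (6 * Y) ^ k / INR (Factorial.fact k))%R m)
    (fun v => csum (fun k => term k v) (S m))).
  { induction m as [|m IH].
    - rewrite sum_O; apply jet_ext with (term O); [intros v; simpl; ring|apply Jterm].
    - rewrite sum_Sn; eapply jet_weaken; [|exact (jet_plus _ _ _ _ _ _ IH (Jterm (S m)))].
      apply Req_le; symmetry; apply Rmult_plus_distr_l. }
  apply jet_ex_filterdiff with r (36 * B * exp (6 * Y))%R; [exact Hr|].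
  apply jet_lim with (fun m v => csum (fun k => term k v) (S m)); [exact Hr| |].
  - intros m; eapply jet_weaken; [|apply Jsum].
    apply Rmult_le_compat_l; [lra|apply pow_div_fact_le_exp; lra].
  - intros h Hh; destruct (Hsep h Hh) as [d Hd].
    set (v := plus x h) in *.
    assert (P := heun_E_pser (Nc v) (Lc v) (Mc v) d Hd (Zc v)).
    unfold is_pser in P; rewrite Ccv_incr in P.
    eapply Ccv_ext; [|exact P]; intros m; apply csum_ext; intros k.
    unfold term, heun_a; rewrite Cpow_mult_l; ring.
Qed.

End ParameterDependence.

Theorem theorem1p3 :
  (forall n lam mu : C, ~ nonpos_integer n -> mu <> 0 ->
     (exists (U : C -> Prop) (E : C -> C) (c : C),
        zero_neighborhood U /\ heun_solution n lam mu U E c)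
     /\ (forall (U1 U2 : C -> Prop) (E1 E2 : C -> C) (c1 c2 : C),
           zero_neighborhood U1 -> heun_solution n lam mu U1 E1 c1 ->
           zero_neighborhood U2 -> heun_solution n lam mu U2 E2 c2 ->
           exists k : C, k <> 0 /\ forall z, U1 z -> U2 z -> E2 z = k * E1 z)
     /\ (forall (U : C -> Prop) (E : C -> C) (c : C),
           zero_neighborhood U -> heun_solution n lam mu U E c ->
           exists F : C -> C,
             heun_solution n lam mu whole_plane F c /\ forall z, U z -> F z = E z))
  /\
  (exists (xi : C3 -> C) (E : C4 -> C),
     holomorphic_on_module C3 param_domain xi
     /\ holomorphic_on_module C4 (fun q : C4 => param_domain (fst q)) E
     /\ forall n lam mu : C, ~ nonpos_integer n -> mu <> 0 ->
          heun_solution n lam mu whole_plane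
            (fun z => E (n, lam, mu, z)) (xi (n, lam, mu))).
Proof.
  assert (Hsep : forall n, ~ nonpos_integer n -> exists d, separated n d).
  { intros n Hn; destruct (nonpos_integer_separated n Hn) as [d [r [Hr H]]]; exists d.
    replace n with (n + 0) by ring; apply H; rewrite Cmod_0; lra. }
  split.
  - intros n lam mu Hn Hmu; destruct (Hsep n Hn) as [d Hd]; split; [|split].
    + exists whole_plane, (heun_E n lam mu), (heun_xi n lam mu).
      split; [exact whole_plane_neighborhood|exact (heun_E_solution n lam mu d Hd Hmu)].
    + intros U1 U2 E1 E2 c1 c2 HU1 HE1 HU2 HE2.
      (* The intersection of the two domains may be disconnected, so each solution is compared on
         its own domain with the entire one. *)
      destruct (heun_solution_proportional n lam mu d Hd U1 E1 c1 Hmu HU1 HE1) as [k1 [Hk1 [_ H1]]].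
      destruct (heun_solution_proportional n lam mu d Hd U2 E2 c2 Hmu HU2 HE2) as [k2 [Hk2 [_ H2]]].
      exists (k2 * / k1); split.
      * apply Cmult_neq_0; [exact Hk2|].
        intros E; apply C1_nz; rewrite <- (Cinv_l _ Hk1), E; ring.
      * intros z Hz1 Hz2; rewrite H1, H2 by assumption; field; exact Hk1.
    + intros U E c HU HE.
      destruct (heun_solution_proportional n lam mu d Hd U E c Hmu HU HE) as [k [Hk [Hc H]]].
      exists (fun z => k * heun_E n lam mu z); split; [|intros z Hz; now rewrite H].
      split; [|split].
      * intros z _; destruct (heun_E_ode n lam mu d Hd z) as [_ [e He]].
        exists (k * e); now apply is_derive_has_cderiv, has_cderiv_scal.
      * destruct (heun_E_nonzero n lam mu d Hd Hmu) as [z Hz]; exists z; split; [exact I|].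
        now apply Cmult_neq_0.
      * intros z _; rewrite Hc.
        exact (proj1 (heun_E_multiple_ode n lam mu d Hd k _ z (fun _ => eq_refl))).
  - exists (fun p : C3 => heun_xi (fst (fst p)) (snd (fst p)) (snd p)).
    exists (fun q : C4 => heun_E (fst (fst (fst q))) (snd (fst (fst q))) (snd (fst q)) (snd q)).
    assert (K1 : @coordinate C3 (fun p => fst (fst p)))
      by exact (coordinate_fst _ _ _ (coordinate_fst _ _ _ coordinate_id)).
    assert (K2 : @coordinate C3 (fun p => snd (fst p)))
      by exact (coordinate_fst _ _ _ (coordinate_snd _ _ _ coordinate_id)).
    assert (K3 : @coordinate C3 (fun p => snd p)) by exact (coordinate_snd _ _ _ coordinate_id).
    split; [|split].
    + intros p [Hp _]; now apply heun_xi_differentiable.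
    + intros q [Hq _].
      apply (heun_E_differentiable (V := C4) q (fun q => fst (fst (fst q))) (fun q => snd (fst (fst q)))
        (fun q => snd (fst q))).
      * exact (coordinate_fst _ _ _ K1).
      * exact (coordinate_fst _ _ _ K2).
      * exact (coordinate_fst _ _ _ K3).
      * exact (coordinate_snd _ _ _ coordinate_id).
      * exact Hq.
    + intros n lam mu Hn Hmu; destruct (Hsep n Hn) as [d Hd].
      exact (heun_E_solution n lam mu d Hd Hmu).
Qed.
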